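(* Let $n\ge m\ge 1$ and let $H(z)=\sum_{j=0}^n A_j z^j+\sum_{j=0}^m B_j\overline{z}^{\,j}$, where $A_0,\dots,A_n,B_0,\dots,B_m$ are mutually independent complex Gaussian random variables with $\mathbb{E}A_j=\mathbb{E}B_j=0$, $\mathbb{E}[A_j^2]=\mathbb{E}[B_j^2]=0$, $\mathbb{E}|A_j|^2=\alpha_j>0$ and $\mathbb{E}|B_j|^2=\beta_j>0$. Then for every open set $T\subseteq\mathbb{C}$, the expected number $\mathbb{E}N_H(T)$ of zeros of $H$ in $T$ equals $$\frac{1}{\pi}\int_T \frac{1}{|z|^2}\,\frac{r_1^2+r_2^2-2r_{12}^2}{r_3^2\sqrt{(r_1+r_2)^2-4r_{12}^2}}\,dA(z),$$ where, writing $s_k=\sum_{j=1}^n j^k\alpha_j|z|^{2j}$ and $t_k=\sum_{j=1}^m j^k\beta_j|z|^{2j}$, $$r_3=\sum_{j=0}^n\alpha_j|z|^{2j}+\sum_{j=0}^m\beta_j|z|^{2j},\quad r_{12}=s_1t_1,\quad r_1=r_3 s_2-s_1^2,\quad r_2=r_3 t_2-t_1^2.$$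
   Context: $dA$ denotes Lebesgue measure on $\mathbb{C}$; $N_H(T)$ is the number of points $z\in T$ with $H(z)=0$. *)

(* Defs.v *)
(* MathComp + MathComp-Analysis, complex numbers from mathcomp-real-closed. *)
From HB Require Import structures.
From mathcomp Require Import all_boot all_order all_algebra.
From mathcomp Require Import all_classical all_reals all_analysis.
From mathcomp Require Import finmap complex.
Set Implicit Arguments. Unset Strict Implicit. Unset Printing Implicit Defensive.
Import Order.TTheory GRing.Theory Num.Theory.
Import numFieldTopology.Exports numFieldNormedType.Exports.
Local Open Scope classical_set_scope.
Local Open Scope ring_scope.

(* Mutual independence of a finite family of real random variables:
   product rule for every finite subfamily and every choice of Borel sets. *)
Definition mutually_independent {d} {T : measurableType d} {R : realType}
  (P : probability T R) {I : finType} (X : I -> T -> R) : Prop :=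
  (forall i, measurable_fun setT (X i)) /\
  forall (J : {set I}) (B : I -> set R), (forall i, measurable (B i)) ->
    P (\big[setI/setT]_(i in J) (X i @^-1` B i))
    = (\prod_(i in J) P (X i @^-1` B i))%E.

(* X is distributed as N(0, v) (mean 0, variance v > 0). *)
Definition centered_normal_rv {d} {T : measurableType d} {R : realType}
  (P : probability T R) (X : T -> R) (v : R) : Prop :=
  forall V : set R, measurable V ->
    P (X @^-1` V) = normal_prob 0 (Num.sqrt v) V.

(* Number of points of a set, +oo if infinite. *)
Definition npoints {T : choiceType} {R : realType} (A : set T) : \bar R :=
  if `[< finite_set A >] then ((#|` fset_set A|)%:R)%:E else +oo%E.

(* The random harmonic polynomial H(z) = sum A_j z^j + sum B_j conj(z)^j
   evaluated at a sample point; A j = a j + i a' j, B j = b j + i b' j. *)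
Definition harm_poly {R : rcfType} (n m : nat) (A B : nat -> R[i]) (z : R[i]) : R[i] :=
  \sum_(j < n.+1) A j * z ^+ j + \sum_(j < m.+1) B j * (z^*)%C ^+ j.

(* N_H(T): number of zeros of H in T (T a set of points (x,y) ~ x + i y). *)
Definition zero_count {R : realType} (n m : nat) (A B : nat -> R[i])
  (T : set (R * R)) : \bar R :=
  npoints [set z : R[i] | T (complex.Re z, complex.Im z) /\ harm_poly n m A B z = 0].

(* The density of the expected number of zeros, at z = x + i y. *)
Definition zero_density {R : realType} (n m : nat) (alpha beta : nat -> R)
  (x y : R) : R :=
  let rho := x ^+ 2 + y ^+ 2 in (* |z|^2 *)
  let s k := \sum_(1 <= j < n.+1) (j%:R ^+ k * alpha j * rho ^+ j) in
  let t k := \sum_(1 <= j < m.+1) (j%:R ^+ k * beta j * rho ^+ j) in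
  let r3 := \sum_(0 <= j < n.+1) (alpha j * rho ^+ j)
          + \sum_(0 <= j < m.+1) (beta j * rho ^+ j) in
  let r12 := s 1%N * t 1%N in
  let r1 := r3 * s 2%N - s 1%N ^+ 2 in
  let r2 := r3 * t 2%N - t 1%N ^+ 2 in
  rho^-1 * ((r1 ^+ 2 + r2 ^+ 2 - 2 * r12 ^+ 2)
            / (r3 ^+ 2 * Num.sqrt ((r1 + r2) ^+ 2 - 4 * r12 ^+ 2))).

(* Main.v *)
Require Import Defs.
From HB Require Import structures.
From mathcomp Require Import all_boot all_order all_algebra.
From mathcomp Require Import all_classical all_reals all_analysis.
From mathcomp Require Import finmap complex.
From mathcomp Require Import measurable_realfun ring lra.
Set Implicit Arguments. Unset Strict Implicit. Unset Printing Implicit Defensive.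
Import Order.TTheory GRing.Theory Num.Theory.
Import numFieldTopology.Exports numFieldNormedType.Exports.
Local Open Scope classical_set_scope.
Local Open Scope ring_scope.

(* The zeros are counted through the area formula. Write H = A_0 + G. For fixed G the
   number of zeros in a square Q, integrated against the Gaussian density phi of A_0, is
   the integral of the number of solutions of G(z) = -w in Q against phi, that is, the
   integral over Q of phi(G(z)) |J(z)|, J = |H_z|^2 - |H_zbar|^2 being the Jacobian. By Tonelli the
   expected number of zeros in Q has density E[phi(G(z)) |J(z)|].

   For z <> 0 the vector (G, z H_z, zbar H_zbar) is a linear image of independent complex
   Gaussians whose phases can be absorbed, so that its real and imaginary parts are
   independent with the same real covariance. Weighting by phi amounts to conditioning on
   H(z) = 0. Orthogonal (Givens) transformations of the standard normal variables, which
   only see Gram matrices, then bring |z|^2 |J| to the form |x (t^2 + t'^2) + y (s^2 + s'^2)|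
   with x > 0 > y, whose expectation is 2 (x^2 + y^2) / (x - y).

   Open sets are exhausted by dyadic squares. *)

(** * Integration in the plane *)

(** Origin of the formula: given [H(z) = 0], the complex covariances of [z H_z] and [zbar H_zbar]
    are [r1 / r3] and [r2 / r3] on the diagonal, [- r12 / r3] off it. A real component has half of
    these, and [x], [y] are the eigenvalues of the Jacobian form relative to them:
    [x + y = (r1 - r2) / (2 r3)] and [x y = - (r1 r2 - r12^2) / (4 r3^2)]. Hence [x^2 + y^2 = (r1^2
    + r2^2 - 2 r12^2) / (4 r3^2)] and [x - y = sqrt ((r1 + r2)^2 - 4 r12^2) / (2 r3)], while the
    density of [H(z)] at 0 is [1 / (pi r3)]. Two obstacles shape the proof. [G] is neither injective
    nor free of critical points, so the area formula is assembled by bisection from estimates on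
    small squares, with a separate one where [J = 0]. And the number of zeros, possibly infinite,
    must be measurable in the coefficients: it is the increasing limit of the numbers of dyadic
    squares that contain a zero, so that no bound on the number of zeros is ever needed. *)

Section Transfer.
Local Open Scope ereal_scope.
Context {d1 d2 : measure_display} {X : measurableType d1} {Y : measurableType d2} {R : realType}.

Definition push (mu : {measure set X -> \bar R}) (phi : X -> Y) (mphi : measurable_fun [set: X] phi) :
  {measure set Y -> \bar R} :=
  measure_function_pushforward__canonical__measure_function_Measure mu mphi.

Lemma pushE mu (phi : X -> Y) (mphi : measurable_fun setT phi) A : push mu mphi A = mu (phi @^-1` A).
Proof. by []. Qed.

Lemma ge0_integral_push mu (phi : X -> Y) (mphi : measurable_fun setT phi) (f : Y -> \bar R) :
  measurable_fun setT f -> (forall y, 0 <= f y) ->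
  \int[push mu mphi]_y f y = \int[mu]_x f (phi x).
Proof.
by move=> mf f0; rewrite (ge0_integral_pushforward mphi mu measurableT mf)// => ? _.
Qed.

End Transfer.

Section Tonelli.
Local Open Scope ereal_scope.
Context {d1 d2 : measure_display} {T1 : measurableType d1} {T2 : measurableType d2} {R : realType}.
Variables (m1 : {sigma_finite_measure set T1 -> \bar R}) (m2 : {sigma_finite_measure set T2 -> \bar R}).
Variable F : T1 -> T2 -> \bar R.
Hypotheses (mF : measurable_fun [set: T1 * T2] (fun z => F z.1 z.2)) (F0 : forall x y, 0 <= F x y).

Lemma tonelli : \int[m1]_x \int[m2]_y F x y = \int[m2]_y \int[m1]_x F x y.
Proof. exact: (fubini_tonelli (fun z => F z.1 z.2)). Qed.

Lemma tonelli_prod : \int[m1 \x m2]_z F z.1 z.2 = \int[m1]_x \int[m2]_y F x y.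
Proof. exact: (fubini_tonelli1 (fun z => F z.1 z.2)). Qed.

Lemma measurable_int2 : measurable_fun setT (fun x => \int[m2]_y F x y).
Proof. exact: (measurable_fun_fubini_tonelli_F (fun z => F z.1 z.2)). Qed.

Lemma measurable_int1 : measurable_fun setT (fun y => \int[m1]_x F x y).
Proof. exact: (measurable_fun_fubini_tonelli_G (fun z => F z.1 z.2)). Qed.

End Tonelli.

Lemma ge0_intZl {d} {T : measurableType d} {R : realType} (mu : {measure set T -> \bar R}) (k : R) (f : T -> \bar R) :
  0 <= k -> measurable_fun setT f -> (forall x, 0 <= f x)%E ->
  (\int[mu]_x (k%:E * f x) = k%:E * \int[mu]_x f x)%E.
Proof. by move=> k0 mf f0; rewrite ge0_integralZl. Qed.

Section Affine1.
Context {R : realType}.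
Local Notation mu := (@lebesgue_measure R).

(** Lebesgue measure and [|a|] times its push-forward under the affine map agree on half-open
    intervals, hence everywhere by uniqueness. A negative [a] reverses the interval and moves the
    closed end, which leaves the length unchanged. *)
Lemma ge0_integral_affine (a b : R) (f : R -> \bar R) : a != 0 ->
  measurable_fun setT f -> (forall x, 0 <= f x)%E ->
  (\int[mu]_x f (a * x + b)%R = `|a|^-1%:E * \int[mu]_x f x)%E.
Proof.
move=> a0 mf f0.
pose phi (x : measurableTypeR R) : measurableTypeR R := a * x + b.
have mphi : measurable_fun setT phi.
  by apply: measurable_funD => //; apply: measurable_funM.
have ia : 0 <= `|a| by [].
pose m := mscale (NngNum ia) (push mu mphi).
have E X : ocitv X -> mu X = m X.
  move=> [[u v] /= uv] <-.
  rewrite /m /mscale pushE /=.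
  have [a_gt0|a_le0] := ltP 0 a.
    have -> : phi @^-1` `]u, v]%classic = `](u - b) / a, (v - b) / a]%classic.
      apply/seteqP; split=> x /=; rewrite !in_itv/= /phi;
      by rewrite ltr_pdivrMr// ler_pdivlMr// ltrBlDr lerBrDr mulrC.
    rewrite !lebesgue_measure_itv/= !lte_fin gtr0_norm//.
    rewrite ltr_pM2r ?invr_gt0// ltrD2r; case: ifPn => _; last by rewrite mule0.
    by rewrite -!EFinB -EFinM; congr EFin; field.
  have a_lt0 : a < 0 by rewrite lt_neqAle a0.
  have -> : phi @^-1` `]u, v]%classic = `[(v - b) / a, (u - b) / a[%classic.
    apply/seteqP; split=> x /=; rewrite !in_itv/= /phi;
    by rewrite ler_ndivrMr// ltr_ndivlMr// ltrBlDr lerBrDr mulrC andbC.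
  rewrite !lebesgue_measure_itv/= !lte_fin ltr0_norm//.
  rewrite ltr_nM2r ?invr_lt0// ltrD2r; case: ifPn => _; last by rewrite mule0.
  by rewrite -!EFinB -EFinM; congr EFin; field.
have -> : (\int[mu]_x f x = \int[m]_x f x)%E.
  by apply: eq_measure_integral => A mA _; apply: lebesgue_measure_unique.
rewrite /m ge0_integral_mscale//= ge0_integral_push//=.
by rewrite muleA -EFinM mulVf ?mul1e// normr_eq0.
Qed.

End Affine1.

Section Linear2.
Context {R : realType}.
Local Notation mu := (@lebesgue_measure R).
Implicit Types f : R * R -> \bar R.

Let meas_lin (a b c d : R) f : measurable_fun setT f ->
  measurable_fun setT (fun z : R * R => f (a * z.1 + b * z.2, c * z.1 + d * z.2)).
Proof.
move=> mf; apply: (measurableT_comp mf).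
by apply: measurable_fun_pair => /=; apply: measurable_funD; apply: measurable_funM.
Qed.

Lemma measurable_section2 f x : measurable_fun setT f -> measurable_fun setT (fun y => f (x, y)).
Proof. by move=> mf; apply: (measurableT_comp mf); exact: measurable_fun_pair. Qed.

(** Gaussian elimination: with [u = a x + b y] the second entry becomes [c / a * u + e * y], where
    [e = det / a], so two one-dimensional substitutions suffice. *)
Let linear2_aux (a b c d : R) f : a != 0 -> a * d - b * c != 0 ->
  measurable_fun setT f -> (forall x, 0 <= f x)%E ->
  (\int[mu]_x \int[mu]_y f (a * x + b * y, c * x + d * y)%R
   = `|a * d - b * c|^-1%:E * \int[mu]_x \int[mu]_y f (x, y))%E.
Proof.
move=> a0 det0 mf f0.
pose e := d - b * c / a.
have e0 : e != 0.
  apply: contra det0 => /eqP; rewrite /e => h; apply/eqP.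
  have -> : a * d - b * c = a * (d - b * c / a) by field.
  by rewrite h mulr0.
rewrite (@tonelli _ _ _ _ _ mu mu (fun x y => f (a * x + b * y, c * x + d * y)))//=; last exact: meas_lin.
pose g y u := f (u, c / a * u + e * y).
transitivity (\int[mu]_y (`|a|^-1%:E * \int[mu]_u g y u))%E.
  apply: eq_integral => y _.
  rewrite -(@ge0_integral_affine _ a (b * y))//; last by move=> x; exact: f0.
    by apply: eq_integral => x _; rewrite /g /e; congr (f (_, _)); field.
  apply: (measurableT_comp mf); apply: measurable_fun_pair => //=.
  by apply: measurable_funD => //; apply: measurable_funM.
have mg : measurable_fun setT (fun z : R * R => g z.1 z.2).
  apply: (measurableT_comp mf); apply: measurable_fun_pair => //=.
  by apply: measurable_funD => //; apply: measurable_funM.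
have gE0 y u : (0 <= g y u)%E := f0 _.
have a'0 : 0 <= `|a|^-1 by rewrite invr_ge0.
rewrite (ge0_intZl mu a'0 (measurable_int2 mu mg gE0)); last first.
  by move=> y; apply: integral_ge0 => u _; exact: f0.
rewrite (tonelli mu mu mg gE0).
transitivity (`|a|^-1%:E * \int[mu]_u (`|e|^-1%:E * \int[mu]_y f (u, y)))%E.
  congr (_ * _)%E; apply: eq_integral => u _.
  rewrite -(@ge0_integral_affine _ e (c / a * u))//; last exact: measurable_section2.
  by apply: eq_integral => x _; rewrite /g addrC.
rewrite (@ge0_intZl _ _ _ mu)//; last 2 first.
  - apply: (@measurable_int2 _ _ _ _ _ mu (fun x y => f (x, y))) => //.
    by rewrite (_ : (fun _ => _) = f)//; apply/funext => -[].
  - by move=> y; apply: integral_ge0 => u _; exact: f0.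
rewrite muleA -EFinM -invfM -normrM; congr ((`|_|^-1)%:E * _)%E.
by rewrite /e; field.
Qed.

Lemma ge0_integral_linear2 (a b c d : R) f : a * d - b * c != 0 ->
  measurable_fun setT f -> (forall x, 0 <= f x)%E ->
  (\int[mu]_x \int[mu]_y f (a * x + b * y, c * x + d * y)%R
   = `|a * d - b * c|^-1%:E * \int[mu]_x \int[mu]_y f (x, y))%E.
Proof.
move=> det0 mf f0; have [a0|a0] := eqVneq a 0; last exact: linear2_aux.
have b0 : b != 0 by apply: contraNneq det0 => ->; rewrite a0 !mul0r subrr.
(* Exchanging the two variables makes [b] the pivot and only changes the sign of the determinant. *)
rewrite (@tonelli _ _ _ _ _ mu mu (fun x y => f (a * x + b * y, c * x + d * y)))//=; last exact: meas_lin.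
under eq_integral => y _ do under eq_integral => x _ do
  rewrite [(a * _ + _)%R]addrC [(c * _ + _)%R]addrC.
have detN : b * c - a * d = - (a * d - b * c) by ring.
by rewrite linear2_aux// detN ?oppr_eq0// normrN.
Qed.

End Linear2.

(** * Counting points by dyadic squares *)

Section Cells.
Context {R : realType}.
Implicit Types (p : R * R) (h : R) (Z : set (R * R)).

(** Half-open, so that the four children partition the square. *)
Definition sq p h : set (R * R) :=
  [set z | p.1 <= z.1 < p.1 + h /\ p.2 <= z.2 < p.2 + h].

Definition children p h : seq (R * R) :=
  [:: p; (p.1 + h / 2, p.2); (p.1, p.2 + h / 2); (p.1 + h / 2, p.2 + h / 2)].

Lemma measurable_sq p h : measurable (sq p h).
Proof.
rewrite (_ : sq p h = `[p.1, p.1 + h[%classic `*` `[p.2, p.2 + h[%classic).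
  by apply: measurableX; exact: measurable_itv.
by apply/seteqP; split => z; rewrite /sq/= !in_itv.
Qed.

(** Stated for any measure because it serves several: counting measure for numbers of points, Dirac
    masses for integrals over squares. *)
Lemma measure_children (mu : {measure set (R * R) -> \bar R}) Z p h :
  0 <= h -> measurable Z ->
  mu (Z `&` sq p h) = (\sum_(q <- children p h) mu (Z `&` sq q (h / 2)))%E.
Proof.
move=> h0 mZ.
pose X := [set z : R * R | z.1 < p.1 + h / 2].
pose Y := [set z : R * R | z.2 < p.2 + h / 2].
have mX : measurable X.
  rewrite (_ : X = `]-oo, p.1 + h / 2[%classic `*` setT).
    by apply: measurableX => //; exact: measurable_itv.
  by apply/seteqP; split => z; rewrite /X/= in_itv/= ?andbT => // -[].
have mY : measurable Y.
  rewrite (_ : Y = setT `*` `]-oo, p.2 + h / 2[%classic).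
    by apply: measurableX => //; exact: measurable_itv.
  by apply/seteqP; split => z; rewrite /Y/= in_itv/= ?andbT => // -[].
have mA : measurable (Z `&` sq p h) by apply: measurableI => //; exact: measurable_sq.
rewrite (measureDI mu mA mX) (measureDI mu (measurableD mA mX) mY)
  (measureDI mu (measurableI _ _ mA mX) mY).
pose B1 : set (R * R) := sq p (h / 2).
have sqE q (k : R) z : sq q k z <-> [/\ q.1 <= z.1, z.1 < q.1 + k, q.2 <= z.2 & z.2 < q.2 + k].
  by rewrite /sq/=; split=> [[/andP[? ?] /andP[? ?]]|[? ? ? ?]]; split=> //; apply/andP.
have -> : (Z `&` sq p h) `\` X `\` Y = Z `&` sq (p.1 + h / 2, p.2 + h / 2) (h / 2).
  apply/seteqP; split => z; rewrite /X/Y/=.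
    move=> [[[Zz /sqE[? ? ? ?]] /negP]]; rewrite -leNgt => ? /negP; rewrite -leNgt => ?.
    by split=> //; apply/sqE; split => /=; lra.
  move=> [Zz /sqE/= [? ? ? ?]]; split; last by apply/negP; rewrite -leNgt; lra.
  by split; [split => //; apply/sqE; split; lra|apply/negP; rewrite -leNgt; lra].
have -> : ((Z `&` sq p h) `\` X) `&` Y = Z `&` sq (p.1 + h / 2, p.2) (h / 2).
  apply/seteqP; split => z; rewrite /X/Y/=.
    move=> [[[Zz /sqE[? ? ? ?]] /negP]]; rewrite -leNgt => ? ?.
    by split=> //; apply/sqE; split => /=; lra.
  move=> [Zz /sqE/= [? ? ? ?]]; split; last by lra.
  by split; [split => //; apply/sqE; split; lra|apply/negP; rewrite -leNgt; lra].
have -> : ((Z `&` sq p h) `&` X) `\` Y = Z `&` sq (p.1, p.2 + h / 2) (h / 2).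
  apply/seteqP; split => z; rewrite /X/Y/=.
    move=> [[[Zz /sqE[? ? ? ?]] ?] /negP]; rewrite -leNgt => ?.
    by split=> //; apply/sqE; split => /=; lra.
  move=> [Zz /sqE/= [? ? ? ?]]; split; last by apply/negP; rewrite -leNgt; lra.
  by split; [split => //; apply/sqE; split; lra|lra].
have -> : (Z `&` sq p h) `&` X `&` Y = Z `&` sq p (h / 2).
  apply/seteqP; split => z; rewrite /X/Y/=.
    move=> [[[Zz /sqE[? ? ? ?]] ?] ?].
    by split=> //; apply/sqE; split => /=; lra.
  move=> [Zz /sqE/= [? ? ? ?]]; split; last by lra.
  by split; [split => //; apply/sqE; split; lra|lra].
rewrite /children !big_cons big_nil adde0.
have ac (a b c e : \bar R) : ((a + b) + (c + e) = e + (b + (c + a)))%E.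
  by rewrite addeC [(c + e)%E]addeC -addeA; congr (_ + _)%E; rewrite addeA [RHS]addeC.
exact: ac.
Qed.

(** How many of the [4^k] subsquares of side [h / 2^k] meet [Z]. It depends only on which squares
    are hit, a condition that can be shown measurable in a parameter. *)
Fixpoint dcount (k : nat) Z p h : nat :=
  if k is k'.+1 then \sum_(q <- children p h) dcount k' Z q (h / 2)
  else `[< (Z `&` sq p h) !=set0 >] : nat.

Lemma sq_children p h z : sq p h z -> exists2 q, q \in children p h & sq q (h / 2) z.
Proof.
move=> [/andP[? ?] /andP[? ?]].
case: (ltP z.1 (p.1 + h / 2)) => [?|?]; case: (ltP z.2 (p.2 + h / 2)) => [?|?].
- by exists p; rewrite ?inE ?eqxx//; split; apply/andP; split; lra.
- exists (p.1, p.2 + h / 2); rewrite ?inE ?eqxx ?orbT//; split => /=; apply/andP; split; lra.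
- exists (p.1 + h / 2, p.2); rewrite ?inE ?eqxx ?orbT//; split => /=; apply/andP; split; lra.
- exists (p.1 + h / 2, p.2 + h / 2); rewrite ?inE ?eqxx ?orbT//; split => /=; apply/andP; split; lra.
Qed.

Lemma children_sub p h q : 0 <= h -> q \in children p h -> sq q (h / 2) `<=` sq p h.
Proof.
move=> h0; rewrite !inE => /or4P[] /eqP-> z [/= /andP[? ?] /andP[? ?]];
by split; apply/andP; split; lra.
Qed.

Lemma dcount_leS Z p h k : (dcount k Z p h <= dcount k.+1 Z p h)%N.
Proof.
elim: k p h => [|k IH] p h; last by apply: leq_sum => q _; exact: IH.
rewrite /=; case: asboolP => //= -[z [Zz /sq_children[q qin qz]]].
have : (1 <= dcount 0 Z q (h / 2))%N by rewrite /= asboolT//; exists z.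
by rewrite (big_rem q qin)/= => /leq_trans; apply; rewrite leq_addr.
Qed.

Lemma dcount_homo Z p h : {homo (fun k => dcount k Z p h) : m n / (m <= n)%N}.
Proof. by apply: homo_leq => //; [exact: leq_trans|move=> k; exact: dcount_leS]. Qed.

Lemma dcountS Z Z' p h k : Z `<=` Z' -> (dcount k Z p h <= dcount k Z' p h)%N.
Proof.
move=> ZZ; elim: k p h => [|k IH] p h; last by apply: leq_sum => q _; exact: IH.
rewrite /=; case: asboolP => //= -[z [Zz zp]].
by rewrite asboolT//; exists z; split=> //; exact: ZZ.
Qed.

Local Notation ct := (@counting _ R).

Lemma counting_ge1 (T : choiceType) (A : set T) : A !=set0 -> (1 <= @counting T R A)%E.
Proof.
move=> [x Ax]; rewrite /counting; case: asboolP => fA; last by rewrite leey.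
rewrite lee_fin ler1n cardfs_gt0; apply/fset0Pn; exists x.
by rewrite in_fset_set// mem_set.
Qed.

Lemma dcount_le Z p h k : 0 <= h -> measurable Z ->
  ((dcount k Z p h)%:R%:E <= ct (Z `&` sq p h))%E.
Proof.
move=> h0 mZ; elim: k p h h0 => [|k IH] p h h0.
  rewrite /=; case: asboolP => //= Zp; last by rewrite measure_ge0.
  exact: counting_ge1.
rewrite (measure_children ct)//= natr_sum -sumEFin.
by apply: lee_sum => q _; apply: IH; rewrite divr_ge0.
Qed.

(** After [k] halvings the side is at most the separation [e]; a half-open square of side at most
    [e] contains at most one point. *)
Lemma le_dcount (e : R) Z p h k : 0 <= h -> h <= e * 2 ^+ k -> measurable Z ->
  (forall z z', Z z -> Z z' -> z != z' -> e <= Num.max `|z.1 - z'.1| `|z.2 - z'.2|) ->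
  (ct (Z `&` sq p h) <= (dcount k Z p h)%:R%:E)%E.
Proof.
move=> h0 + mZ sepZ; elim: k p h h0 => [|k IH] p h h0.
  rewrite expr0 mulr1 => he /=; case: asboolP => [[z [Zz zp]]|Z0]; last first.
    rewrite [X in ct X](_ : _ = set0) ?measure0//.
    by apply/eqP/negPn/negP => /set0P.
  suff -> : Z `&` sq p h = [set z].
    by rewrite /counting asboolT// fset_set1 cardfs1.
  apply/seteqP; split => [z' [Zz' z'p]|_ ->//].
  apply/eqP/negPn/negP => zz'.
  have := sepZ _ _ Zz' Zz zz'; apply/negP; rewrite -ltNge; apply: lt_le_trans he.
  case: zp z'p => [/andP[? ?] /andP[? ?]] [/andP[? ?] /andP[? ?]].
  by rewrite gt_max !ltr_norml; apply/andP; split; apply/andP; split; lra.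
rewrite exprS => he; rewrite (measure_children ct)//= natr_sum -sumEFin.
by apply: lee_sum => q _; apply: IH; [rewrite divr_ge0|lra].
Qed.

Lemma seq_lb (T : eqType) (s : seq T) (f : T -> R) : (forall x, x \in s -> 0 < f x) ->
  exists2 e, 0 < e & forall x, x \in s -> e <= f x.
Proof.
elim: s => [|x s IH] f0; first by exists 1.
have [y ys|e e0 ef] := IH; first by apply: f0; rewrite inE ys orbT.
exists (Num.min e (f x)); first by rewrite lt_min e0 f0// inE eqxx.
by move=> y; rewrite inE ge_min => /predU1P[->|/ef ->//]; rewrite lexx orbT.
Qed.

Lemma finite_separated Z : finite_set Z -> exists2 e : R, 0 < e &
  forall z z', Z z -> Z z' -> z != z' -> e <= Num.max `|z.1 - z'.1| `|z.2 - z'.2|.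
Proof.
move=> /finite_fsetP[s Zs].
(* The value 1 on the diagonal is a dummy that keeps [f] positive on all pairs. *)
pose f (u : (R * R) * (R * R)) := if u.1 == u.2 then 1 else Num.max `|u.1.1 - u.2.1| `|u.1.2 - u.2.2|.
have [|e e0 He] := @seq_lb _ [seq (z, z') | z <- s, z' <- s] f.
  move=> [z z'] _; rewrite /f/=; case: eqVneq => // zz'.
  rewrite lt_max !normr_gt0 !subr_eq0 -negb_and; apply: contra zz' => /andP[/eqP h1 /eqP h2].
  by rewrite (surjective_pairing z) (surjective_pairing z') h1 h2.
exists e => // z z'; rewrite Zs/= => zs z's zz'.
have /He : (z, z') \in [seq (z, z') | z <- s, z' <- s] by apply: allpairs_f.
by rewrite /f/= (negbTE zz').
Qed.

Lemma measurable_finite Z : finite_set Z -> measurable Z.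
Proof.
move=> /finite_fsetP[s ->].
rewrite [X in measurable X](_ : _ = \big[setU/set0]_(z <- s) ([set z.1] `*` [set z.2])).
  by apply: bigsetU_measurable => z _; apply: measurableX.
rewrite -bigcup_seq; apply/seteqP; split => [z zs|z [z' z's [/= h1 h2]]].
  by exists z.
by rewrite (surjective_pairing z) h1 h2 -surjective_pairing.
Qed.

(** Every finite part of [Z] in the square has its points separated by the subsquares of some
    generation, so the supremum bounds its cardinality; an infinite [Z] has finite parts of every
    size. *)
Lemma cvg_dcount Z p h : 0 <= h -> measurable Z ->
  (dcount k Z p h)%:R%:E @[k --> \oo] --> ct (Z `&` sq p h).
Proof.
move=> h0 mZ.
have nd : {homo (fun k => (dcount k Z p h)%:R%:E : \bar R) : m n / (m <= n)%N >-> (m <= n)%E}.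
  by move=> m n mn; rewrite lee_fin ler_nat; exact: dcount_homo.
rewrite [X in _ --> X](_ : _ = ereal_sup (range (fun k => (dcount k Z p h)%:R%:E : \bar R))).
  exact: ereal_nondecreasing_cvgn.
apply/eqP; rewrite eq_le; apply/andP; split; last first.
  by apply: ge_ereal_sup => _ [k _ <-]; exact: dcount_le.
have key D : finite_set D -> D `<=` Z `&` sq p h ->
    (ct D <= ereal_sup (range (fun k => (dcount k Z p h)%:R%:E : \bar R)))%E.
  move=> fD DZ.
  have [e e0 sepD] := finite_separated fD.
  have [k hk] : exists k, h <= e * 2 ^+ k.
    exists (Num.truncn (h / e)).+1; rewrite mulrC -ler_pdivrMr//.
    apply: le_trans (ltW (truncnS_gt _)) _.
    by rewrite -natrX ler_nat ltnW// ltn_expl.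
  have -> : D = D `&` sq p h by apply/esym/setIidPl => z /DZ[].
  apply: le_trans (le_dcount p h0 hk (measurable_finite fD) sepD) _.
  apply: (@le_trans _ _ (dcount k Z p h)%:R%:E); last by apply: ereal_sup_ubound; exists k.
  by rewrite lee_fin ler_nat; apply: dcountS => z /DZ[].
have [fZ|iZ] := pselect (finite_set (Z `&` sq p h)); first exact: key.
rewrite [X in (_ <= X)%E](_ : _ = +oo%E) ?leey//.
apply/eqyP => r _.
have [B BZ nB] := infinite_set_fset (Num.truncn `|r|).+1 iZ.
apply: (@le_trans _ _ (#|` B|%:R)%:E).
  rewrite lee_fin (le_trans (ler_norm r))// (le_trans (ltW (truncnS_gt _)))//.
  by rewrite ler_nat.
have := key _ (finite_fset B) BZ.
by rewrite /counting asboolT ?set_fsetK//; exact: finite_fset.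
Qed.

End Cells.

Section ContinuousPairs.
Context {R : realType} {T : topologicalType}.

Lemma continuous_pair (f g : T -> R) : continuous f -> continuous g ->
  continuous (fun x => (f x, g x)).
Proof.
move=> cf cg x.
exact: (@cvg_pair _ _ _ (nbhs x) (nbhs (f x)) (nbhs (g x)) _ _ _ f g (cf x) (cg x)).
Qed.

Lemma continuous_fst : continuous (fun z : R * R => z.1).
Proof. by move=> z; exact: cvg_fst. Qed.

Lemma continuous_snd : continuous (fun z : R * R => z.2).
Proof. by move=> z; exact: cvg_snd. Qed.

End ContinuousPairs.

(** * Measurability of the number of zeros in the coefficients *)

Section HitMeasurable.
Context {R : realType} {d : measure_display} {C : measurableType d}.
Variable H : C -> R * R -> R * R.
Hypothesis mH : forall z, measurable_fun setT (fun c => H c z).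
Hypothesis cH : forall c, continuous (H c).

(** Retraction onto a closed interval; taken coordinatewise, it sends the rational points to a dense
    subset of any closed box, even a degenerate one. *)
Let clamp (a b : R) (t : R) := Num.max a (Num.min b t).
Let clamp2 (p : R * R) (l : R) (z : R * R) := (clamp p.1 (p.1 + l) z.1, clamp p.2 (p.2 + l) z.2).

Let continuous_clamp a b : continuous (clamp a b).
Proof.
move=> t; rewrite /clamp; apply: continuous_max; first exact: cst_continuous.
by apply: continuous_min; [exact: cst_continuous|exact: cvg_id].
Qed.

Let continuous_clamp2 p l : continuous (clamp2 p l).
Proof.
apply: continuous_pair => z.
  by apply: (@continuous_comp _ _ _ fst (clamp _ _)); [exact: continuous_fst|exact: continuous_clamp].
by apply: (@continuous_comp _ _ _ snd (clamp _ _)); [exact: continuous_snd|exact: continuous_clamp].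
Qed.

Let clampP a b t : a <= b -> a <= clamp a b t <= b.
Proof. by move=> ab; rewrite /clamp le_max lexx/= ge_max ab ge_min lexx. Qed.

Let clamp_id a b t : a <= t <= b -> clamp a b t = t.
Proof. by move=> /andP[? ?]; rewrite /clamp min_r// max_r. Qed.

(** A continuous map on a compact box has a zero as soon as its norm takes arbitrarily small values
    on a dense set. This expresses the event by countably many conditions on single values of
    [H]. *)
Let hit_box p l : 0 <= l ->
  [set c | exists2 z, (p.1 <= z.1 <= p.1 + l) && (p.2 <= z.2 <= p.2 + l) & H c z = 0] =
  \bigcap_n \bigcup_q1 \bigcup_q2
    [set c | `|H c (clamp2 p l (ratr q1, ratr q2))| < n.+1%:R^-1].
Proof.
move=> l0; apply/seteqP; split => c /=.
  move=> [z zp Hz] n _.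
  pose u w := `|H c (clamp2 p l w)|.
  have cu : continuous u.
    move=> w; rewrite /u; apply: (@continuous_comp _ _ _ (H c \o clamp2 p l) (fun w => `|w|)).
      by apply: continuous_comp; [exact: continuous_clamp2|exact: cH].
    exact: norm_continuous.
  have uz : u z < n.+1%:R^-1.
    case/andP: zp => z1 z2.
    by rewrite /u /clamp2 !clamp_id// -surjective_pairing Hz normr0 invr_gt0.
  have : \forall w \near z, u w < n.+1%:R^-1.
    have nb : \forall v \near u z, v < n.+1%:R^-1 by exact: lt_nbhsl.
    exact: (cu z _ nb).
  move=> [[A B] /= [nA nB] AB].
  move: nA => /nbhs_ballP[e1 /= e10 Ae].
  move: nB => /nbhs_ballP[e2 /= e20 Be].
  have [q1 hq1] := @rat_in_itvoo R z.1 (z.1 + e1) ltac:(by rewrite ltrDl).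
  have [q2 hq2] := @rat_in_itvoo R z.2 (z.2 + e2) ltac:(by rewrite ltrDl).
  exists q1 => //; exists q2 => //=.
  apply: (AB (ratr q1, ratr q2)); split => /=.
    apply: Ae; rewrite /ball/= ltr_norml; move: hq1; rewrite in_itv/= => /andP[? ?].
    by apply/andP; split; lra.
  apply: Be; rewrite /ball/= ltr_norml; move: hq2; rewrite in_itv/= => /andP[? ?].
  by apply/andP; split; lra.
move=> hc.
pose K := `[p.1, p.1 + l]%classic `*` `[p.2, p.2 + l]%classic.
have K0 : K !=set0.
  exists p; split; rewrite /= in_itv/= lexx/=; lra.
have cK : compact K by apply: compact_setX; exact: segment_compact.
have cu : {within K, continuous (fun z => `|H c z|)}.
  apply: continuous_subspaceT => z.
  by apply: (@continuous_comp _ _ _ (H c) (fun w => `|w|)); [exact: cH|exact: norm_continuous].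
have [z zK zmin] := compact_EVT_min K0 cK cu.
move: zK => /set_mem[]; rewrite /= !in_itv/= => z1 z2.
exists z; first by rewrite z1 z2.
apply/eqP; rewrite -normr_eq0 eq_le normr_ge0 andbT.
apply/ler_addgt0Pr => e e0; rewrite add0r.
have [n ne] : exists n, n.+1%:R^-1 < e.
  exists (Num.truncn e^-1); rewrite -[ltRHS]invrK ltf_pV2 ?posrE ?invr_gt0//.
  exact: truncnS_gt.
have [q1 _ [q2 _ /= hq]] := hc n I.
apply: le_trans (ltW (lt_trans hq ne)); apply: zmin.
by apply/mem_set; split; rewrite /= in_itv/= clampP// lerDl.
Qed.

Let measurable_hit_box p l : 0 <= l ->
  measurable [set c | exists2 z, (p.1 <= z.1 <= p.1 + l) && (p.2 <= z.2 <= p.2 + l) & H c z = 0].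
Proof.
move=> l0; rewrite hit_box//.
apply: bigcapT_measurable => n; apply: bigcupT_measurable_rat => q1; apply: bigcupT_measurable_rat => q2.
set z := clamp2 _ _ _.
rewrite (_ : [set c | _] = (fun c => (H c z).1) @^-1` `]- n.+1%:R^-1, n.+1%:R^-1[%classic
    `&` (fun c => (H c z).2) @^-1` `]- n.+1%:R^-1, n.+1%:R^-1[%classic); last first.
  apply/seteqP; split => c /=; rewrite !in_itv/= prod_normE gt_max -!ltr_norml.
    by move/andP.
  by move=> [-> ->].
rewrite -[X in measurable X]setTI setIA.
have m1 : measurable_fun setT (fun c => (H c z).1) by exact: (measurableT_comp measurable_fst (mH z)).
have m2 : measurable_fun setT (fun c => (H c z).2) by exact: (measurableT_comp measurable_snd (mH z)).
rewrite setTI -[X in X `&` _]setTI -[X in _ `&` X]setTI.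
by apply: measurableI; [apply: m1|apply: m2] => //; exact: measurable_itv.
Qed.

(** The half-open square is the increasing union of the closed boxes of side [h - h / n.+1]. *)
Lemma measurable_hit_sq p h : measurable [set c | ([set z | H c z = 0] `&` sq p h) !=set0].
Proof.
have [h0|h0] := ltP 0 h; last first.
  rewrite (_ : [set c | _] = set0)//; apply/seteqP; split => // c [z [_ [/andP[? ?] _]]].
  have : z.1 < z.1 by lra.
  by rewrite ltxx.
rewrite (_ : [set c | _] = \bigcup_n [set c | exists2 z,
    (p.1 <= z.1 <= p.1 + (h - h / n.+1%:R)) && (p.2 <= z.2 <= p.2 + (h - h / n.+1%:R)) & H c z = 0]).
  apply: bigcupT_measurable => n; apply: measurable_hit_box.
  by rewrite subr_ge0 ler_pdivrMr// ler_peMr// ?ler1n// ltW.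
apply/seteqP; split => c /=; last first.
  move=> [n _ [z]]; have : 0 < h / n.+1%:R by rewrite divr_gt0.
  set w := h / _ => w0 /andP[/andP[? ?] /andP[? ?]] Hz; exists z; split => //.
  by split; apply/andP; split; lra.
move=> [z [Hz [/andP[z1 z1'] /andP[z2 z2']]]].
pose e := Num.min (p.1 + h - z.1) (p.2 + h - z.2).
have e0 : 0 < e by rewrite lt_min; apply/andP; split; lra.
have en : h / (Num.truncn (h / e)).+1%:R <= e.
  rewrite ler_pdivrMr// mulrC -ler_pdivrMr//; exact: ltW (truncnS_gt _).
have ? : e <= p.1 + h - z.1 by rewrite ge_min lexx.
have ? : e <= p.2 + h - z.2 by rewrite ge_min lexx orbT.
exists (Num.truncn (h / e)) => //; exists z => //.
set w := h / _ in en *.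
by apply/andP; split; apply/andP; split; lra.
Qed.

Lemma measurable_dcount k p h :
  measurable_fun setT (fun c => (dcount k [set z | H c z = 0] p h)%:R%:E : \bar R).
Proof.
apply/measurable_EFinP.
elim: k p h => [|k IH] p h.
  rewrite (_ : (fun _ => _) = \1_[set c | ([set z | H c z = 0] `&` sq p h) !=set0]).
    by apply: measurable_indic; exact: measurable_hit_sq.
  by apply/funext => c; rewrite indicE/= -[_ \in _]/(`[< _ >]).
under eq_fun do rewrite /= natr_sum.
by apply: measurable_sum => q; exact: IH.
Qed.

Hypothesis mHc : forall c, measurable_fun setT (H c).

Lemma measurable_zeros c : measurable [set z | H c z = 0].
Proof.
rewrite (_ : [set z | _] = (setT `&` (fun z => (H c z).1) @^-1` [set 0]) `&` (setT `&` (fun z => (H c z).2) @^-1` [set 0])).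
  apply: measurableI.
    exact: (measurableT_comp measurable_fst (mHc c)).
  exact: (measurableT_comp measurable_snd (mHc c)).
apply/seteqP; split => z /=; first by move=> ->.
by move=> [[_ h1] [_ h2]]; rewrite (surjective_pairing (H c z)) h1 h2.
Qed.

Lemma measurable_counting p h : 0 <= h ->
  measurable_fun setT (fun c => @counting _ R ([set z | H c z = 0] `&` sq p h)).
Proof.
move=> h0; apply: (emeasurable_fun_cvg (fun k c => (dcount k [set z | H c z = 0] p h)%:R%:E)).
  by move=> k; exact: measurable_dcount.
by move=> c _; apply: cvg_dcount => //; exact: measurable_zeros.
Qed.

End HitMeasurable.

(** * The area formula *)

Section StrictDifferentiability.
Context {R : realType}.
Implicit Types (z : R * R).

Lemma norm_pair_le z (r : R) : (`|z| <= r) = (`|z.1| <= r) && (`|z.2| <= r).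
Proof. by rewrite prod_normE ge_max. Qed.

Lemma norm_pair_lt z (r : R) : (`|z| < r) = (`|z.1| < r) && (`|z.2| < r).
Proof. by rewrite prod_normE gt_max. Qed.

Lemma norm_fst_le z : `|z.1| <= `|z|.
Proof. by rewrite prod_normE le_max lexx. Qed.

Lemma norm_snd_le z : `|z.2| <= `|z|.
Proof. by rewrite prod_normE le_max lexx orbT. Qed.

(* Strict differentiability: it gives local injectivity without continuity of the partials. *)
Definition sdiff (f : R * R -> R) (p q : R) z0 := forall e, 0 < e ->
  exists2 dl, 0 < dl & forall z z', `|z - z0| < dl -> `|z' - z0| < dl ->
    `|f z - f z' - (p * (z.1 - z'.1) + q * (z.2 - z'.2))| <= e * `|z - z'|.

Lemma near_norm_ball (P : R * R -> Prop) z0 : (\forall z \near z0, P z) ->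
  exists2 dl, 0 < dl & forall z, `|z - z0| < dl -> P z.
Proof.
move=> /nbhs_ballP[e /= e0 eP]; exists e => // z ze; apply: eP.
by rewrite ball_prod_normE /ball_/= distrC.
Qed.

Lemma continuous_ball (f : R * R -> R) z0 : {for z0, continuous f} -> forall e, 0 < e ->
  exists2 dl, 0 < dl & forall z, `|z - z0| < dl -> `|f z - f z0| < e.
Proof.
move=> cf e e0; apply: (@near_norm_ball (fun z => `|f z - f z0| < e)).
exact: (@cvgr_distC_lt _ _ _ _ _ f (f z0) cf).
Qed.

Definition near_id (Phi : R * R -> R * R) (k : R) z0 dl :=
  forall z z', `|z - z0| < dl -> `|z' - z0| < dl ->
    `|Phi z - Phi z' - (z - z')| <= k * `|z - z'|.

(** At a minimum of [|Phi z - t|] on the closed ball, one more step [z - (Phi z - t)] of the fixed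
    point iteration stays in the ball and shrinks the residual by the factor [k < 1]; the residual
    is therefore already zero. *)
Lemma near_id_surj Phi k z0 dl c0 r t : continuous Phi -> 0 <= k -> k < 1 -> near_id Phi k z0 dl ->
  0 < r -> (forall z, `|z - c0| <= r -> `|z - z0| < dl) ->
  `|t - Phi c0| <= (1 - k) * r -> exists2 z, `|z - c0| <= r & Phi z = t.
Proof.
move=> cPhi k0 k1 nid r0 sub ht.
pose U : set (R * R) := [set z | `|z - c0| <= r].
pose f z := z - (Phi z - t).
have c0U : U c0 by rewrite /U/= subrr normr0 ltW.
have fU : {homo f : z / U z}.
  move=> z Uz; rewrite /U/= /f.
  have -> : z - (Phi z - t) - c0 = (t - Phi c0) - (Phi z - Phi c0 - (z - c0)).
    by apply: injective_projections => /=; ring.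
  apply: le_trans (ler_normB _ _) _.
  have := nid z c0 (sub _ Uz) (sub _ c0U).
  have : k * `|z - c0| <= k * r by apply: ler_wpM2l.
  lra.
have cU : compact U.
  rewrite (_ : U = `[c0.1 - r, c0.1 + r]%classic `*` `[c0.2 - r, c0.2 + r]%classic).
    by apply: compact_setX; exact: segment_compact.
  apply/seteqP; split => z; rewrite /U/= norm_pair_le/= !in_itv/= !ler_norml.
    by move=> /andP[/andP[? ?] /andP[? ?]]; split; apply/andP; split; lra.
  by move=> [/andP[? ?] /andP[? ?]]; apply/andP; split; apply/andP; split; lra.
have cont : {within U, continuous (fun z => `|Phi z - t|)}.
  apply: continuous_subspaceT => z.
  apply: (@continuous_comp _ _ _ (fun z => Phi z - t) (fun z => `|z|)); last exact: norm_continuous.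
  by apply: continuousB; [exact: cPhi|exact: cst_continuous].
have [z /set_mem Uz zmin] := compact_EVT_min (ex_intro _ _ c0U) cU cont.
exists z => //; apply/eqP; rewrite -subr_eq0 -normr_eq0.
have /zmin : f z \in U by apply/mem_set/fU.
have := nid (f z) z (sub _ (fU _ Uz)) (sub _ Uz).
have -> : Phi (f z) - Phi z - (f z - z) = Phi (f z) - t.
  by apply: injective_projections => /=; ring.
have -> : f z - z = - (Phi z - t) by apply: injective_projections => /=; ring.
rewrite normrN => h1 h2; rewrite eq_le normr_ge0 andbT.
have : (1 - k) * `|Phi z - t| <= 0 by lra.
by rewrite pmulr_rle0// subr_gt0.
Qed.

Variables (G : R * R -> R * R) (a b c d : R).
Local Notation D := (a * d - b * c).
Local Notation Phi := (fun w : R * R => ((d * w.1 - b * w.2) / D, (a * w.2 - c * w.1) / D)).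

Lemma near_id_linear z0 k : D != 0 -> 0 < k ->
  sdiff (fun z => (G z).1) a b z0 -> sdiff (fun z => (G z).2) c d z0 ->
  exists2 dl, 0 < dl & near_id (fun z => Phi (G z)) k z0 dl.
Proof.
move=> D0 k0 s1 s2.
pose N := `|a| + `|b| + `|c| + `|d| + 1.
have N0 : 0 < N by rewrite /N ltr_wpDl// !addr_ge0.
(* [N / |D|] bounds the absolute row sums of the inverse matrix, so an error [e |z - z'|] in each
   coordinate of [G] becomes at most [k |z - z'|]. *)
pose e := k * `|D| / N.
have e0 : 0 < e by rewrite divr_gt0// mulr_gt0// normr_gt0.
have [d1 d10 h1] := s1 e e0; have [d2 d20 h2] := s2 e e0.
exists (Num.min d1 d2) => [|z z']; first by rewrite lt_min d10.
rewrite !lt_min => /andP[/h1{}h1 /h2{}h2] /andP[/h1{}h1 /h2{}h2].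
move: h1 h2; set E1 := _ - _ - _; set E2 := (G z).2 - _ - _ => h1 h2.
have -> : Phi (G z) - Phi (G z') - (z - z') = ((d * E1 - b * E2) / D, (a * E2 - c * E1) / D).
  by apply: injective_projections => /=; rewrite /E1 /E2; field.
have key x y : `|x| + `|y| <= N -> `|(x * E1 - y * E2) / D| <= k * `|z - z'|.
  move=> xyN; rewrite normrM normfV ler_pdivrMr ?normr_gt0//.
  apply: le_trans (ler_normB _ _) _; rewrite !normrM.
  apply: (@le_trans _ _ ((`|x| + `|y|) * (e * `|z - z'|))).
    by rewrite mulrDl lerD// ler_wpM2l.
  apply: (@le_trans _ _ (N * (e * `|z - z'|))).
    by rewrite ler_wpM2r// mulr_ge0// ltW.
  rewrite (_ : N * _ = k * `|z - z'| * `|D|)// /e; field.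
  by rewrite lt0r_neq0.
rewrite norm_pair_le/=; apply/andP; split.
  by apply: key; rewrite /N; have := normr_ge0 a; have := normr_ge0 c; lra.
have -> : a * E2 - c * E1 = (- c) * E1 - (- a) * E2 by ring.
by apply: key; rewrite /N !normrN; have := normr_ge0 b; have := normr_ge0 d; lra.
Qed.

End StrictDifferentiability.

Section Boxes.
Context {R : realType}.
Local Notation mu := (@lebesgue_measure R).
Local Notation mu2 := (mu \x mu)%E.

Lemma measurable_lin (a b : R) : measurable_fun setT (fun z : R * R => a * z.1 + b * z.2).
Proof. by apply: measurable_funD; apply: measurable_funM. Qed.

Lemma measure_linear_box (a b c d t1 t2 r1 r2 : R) (I1 I2 : set R) :
  a * d - b * c != 0 -> measurable I1 -> measurable I2 ->
  mu2 [set w | I1 (a * w.1 + b * w.2) /\ I2 (c * w.1 + d * w.2)] =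
  (`|a * d - b * c|^-1%:E * (mu I1 * mu I2))%E.
Proof.
move=> det0 m1 m2.
pose f (w : R * R) := (\1_(I1 `*` I2) w)%:E : \bar R.
have mI : measurable (I1 `*` I2) by exact: measurableX.
have mf : measurable_fun setT f by apply/measurable_EFinP; exact: measurable_indic.
have f0 w : (0 <= f w)%E by rewrite lee_fin.
set B := [set w | _].
have BE w : (\1_B w)%:E = f (a * w.1 + b * w.2, c * w.1 + d * w.2).
  congr EFin; rewrite !indicE; congr (_ _); apply/idP/idP => /set_mem h; apply/mem_set; exact: h.
have mB : measurable B.
  rewrite (_ : B = (setT `&` (fun z : R * R => a * z.1 + b * z.2) @^-1` I1) `&`
    (setT `&` (fun z : R * R => c * z.1 + d * z.2) @^-1` I2)).
    by apply: measurableI; apply: measurable_lin.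
  by apply/seteqP; split => w/= => [[? ?]|[[_ ?] [_ ?]]].
have -> : mu2 B = (\int[mu2]_w (\1_B w)%:E)%E by rewrite integral_indic// setIT.
under eq_integral do rewrite BE.
rewrite (@tonelli_prod _ _ _ _ _ mu mu (fun x y => f (a * x + b * y, c * x + d * y))) => //; last first.
  apply: (measurableT_comp mf); apply: measurable_fun_pair; exact: measurable_lin.
rewrite ge0_integral_linear2//; congr (_ * _)%E.
have mf' : measurable_fun setT (fun z : R * R => f (z.1, z.2)).
  have -> : (fun z : R * R => f (z.1, z.2)) = f by apply/funext => -[].
  exact: mf.
rewrite -(@tonelli_prod _ _ _ _ _ mu mu (fun x y => f (x, y)) mf')//.
transitivity (\int[mu2]_w (\1_(I1 `*` I2) w)%:E)%E.
  by apply: eq_integral => -[].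
by rewrite integral_indic//= ?setIT ?product_measure1E//; exact: measurableX.
Qed.

Lemma mu2_sq p (h : R) : 0 <= h -> mu2 (sq p h) = (h ^+ 2)%:E.
Proof.
move=> h0; pose A : set R := `[p.1, p.1 + h[%classic; pose B : set R := `[p.2, p.2 + h[%classic.
have -> : sq p h = A `*` B by apply/seteqP; split => z; rewrite /sq/A/B/= !in_itv.
have -> : mu2 (A `*` B) = (mu A * mu B)%E by apply: product_measure1E; exact: measurable_itv.
rewrite !lebesgue_measure_itv/= !lte_fin !ltrDl.
move: h0; rewrite le_eqVlt => /predU1P[<-|h0]; first by rewrite ltxx mul0e expr0n.
by rewrite h0 -!EFinB -EFinM; congr EFin; ring.
Qed.

End Boxes.

(** * Bisection principle for squares *)

Section Cousin.
Context {R : realType}.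
Implicit Types (p q z : R * R) (h : R).

Lemma sq_corner p h : 0 < h -> sq p h p.
Proof. by move=> h0; split; apply/andP; split=> //; rewrite ltrDl. Qed.

(** Compactness of the closed square provides one generation [k] that is fine enough at every
    corner; the gluing hypothesis then climbs back from side [h / 2^k] to [h]. *)
Lemma cousin_sq (Pr : R * R -> R -> Prop) :
  (forall p h, 0 < h -> (forall q, q \in children p h -> Pr q (h / 2)) -> Pr p h) ->
  (forall z0, exists2 dl, 0 < dl & forall p h, 0 < h ->
     (forall z, sq p h z -> `|z - z0| < dl) -> Pr p h) ->
  forall p h, 0 < h -> Pr p h.
Proof.
move=> glue loc p h h0.
pose K := `[p.1, p.1 + h]%classic `*` `[p.2, p.2 + h]%classic.
have cK : compact K by apply: compact_setX; exact: segment_compact.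
have [] := compact_near_coveringP K => /(_ cK) nc _.
have h2 k : 0 < h / 2 ^+ k by rewrite divr_gt0// exprn_gt0.
have := nc _ \oo (fun k q => Pr q (h / 2 ^+ k)) _; case.
  move=> z0 _; have [dl dl0 Hdl] := loc z0.
  (* From generation [m] on the side is at most [dl / 2]; with a corner closer than [dl / 2] to
     [z0], the whole square stays within [dl]. *)
  pose m := (Num.truncn (h / (dl / 2))).+1.
  exists ([set q | `|q - z0| < dl / 2], [set k | (m <= k)%N]).
    split => /=.
      apply/nbhs_ballP; exists (dl / 2) => /=; first by rewrite divr_gt0.
      by move=> q; rewrite ball_prod_normE /ball_/= distrC.
    by exists m.
  move=> [q k] /= [qz mk]; apply: Hdl => // z zq.
  have hk : h / 2 ^+ k <= dl / 2.
    rewrite ler_pdivrMr ?exprn_gt0// mulrC -ler_pdivrMr ?divr_gt0//.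
    apply: le_trans (ltW (truncnS_gt _)) _.
    by rewrite -natrX ler_nat (leq_trans mk)// ltnW// ltn_expl.
  move: qz zq; rewrite !norm_pair_lt/= !ltr_norml.
  move=> /andP[/andP[? ?] /andP[? ?]] [/andP[? ?] /andP[? ?]].
  by apply/andP; split; apply/andP; split; lra.
move=> k _ /(_ k (leqnn _)) PK.
have key j q : sq q (h / 2 ^+ k * 2 ^+ j) `<=` K -> Pr q (h / 2 ^+ k * 2 ^+ j).
  elim: j q => [|j IH] q sub.
    by rewrite expr0 mulr1; apply: PK; apply: sub; apply: sq_corner; rewrite expr0 mulr1.
  have l0 : 0 < h / 2 ^+ k * 2 ^+ j.+1 by rewrite mulr_gt0// exprn_gt0.
  apply: glue => // q' q'q.
  have E : h / 2 ^+ k * 2 ^+ j.+1 / 2 = h / 2 ^+ k * 2 ^+ j by rewrite exprS; field; rewrite expf_neq0.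
  rewrite E; apply: IH; rewrite -E; apply: subset_trans sub.
  exact: children_sub (ltW l0) q'q.
have E : h = h / 2 ^+ k * 2 ^+ k by rewrite divfK// expf_neq0.
rewrite E; apply: key; rewrite -E => z [/andP[? ?] /andP[? ?]].
by split; rewrite /= in_itv/=; apply/andP; split; rewrite // ltW.
Qed.

Lemma sq_dist p h z z' : sq p h z -> sq p h z' -> `|z - z'| <= h.
Proof.
move=> [/andP[? ?] /andP[? ?]] [/andP[? ?] /andP[? ?]].
by rewrite norm_pair_le/= !ler_norml; apply/andP; split; apply/andP; split; lra.
Qed.

Definition sq_center p h : R * R := (p.1 + h / 2, p.2 + h / 2).

Lemma sq_centerP p h : 0 < h -> sq p h (sq_center p h).
Proof. by move=> h0; split; apply/andP; split => /=; lra. Qed.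

Lemma sq_center_dist p h z : sq p h z -> `|z - sq_center p h| <= h / 2.
Proof.
move=> [/andP[? ?] /andP[? ?]].
by rewrite norm_pair_le/= !ler_norml; apply/andP; split; apply/andP; split; lra.
Qed.

Lemma sq_center_ball p h r z : r < h / 2 -> `|z - sq_center p h| <= r -> sq p h z.
Proof.
move=> rh; rewrite norm_pair_le/= !ler_norml => /andP[/andP[? ?] /andP[? ?]].
by split; apply/andP; split; lra.
Qed.

End Cousin.

Section AreaFormula.
Context {R : realType}.
Local Notation mu := (@lebesgue_measure R).
Local Notation mu2 := (mu \x mu)%E.
Variables (G : R * R -> R * R) (a b c d g : R * R -> R).
Hypotheses (cG : continuous G) (mG : measurable_fun setT G).
Hypotheses (sG1 : forall z, sdiff (fun z => (G z).1) (a z) (b z) z)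
  (sG2 : forall z, sdiff (fun z => (G z).2) (c z) (d z) z).
Local Notation J z := (a z * d z - b z * c z).
Hypotheses (cJ : continuous (fun z => J z)) (mJ : measurable_fun setT (fun z => J z)).
Hypotheses (cg : continuous g) (mg : measurable_fun setT g) (g0 : forall w, 0 <= g w).
Local Notation ct := (@counting _ R).
Let H (w z : R * R) : R * R := G z - w.
Local Notation zeros w := [set z | H w z = 0].

Let cH w : continuous (H w).
Proof. by move=> z; apply: continuousB; [exact: cG|exact: cst_continuous]. Qed.

Let mH z : measurable_fun setT (fun w => H w z).
Proof.
rewrite (_ : (fun w => _) = (fun w : R * R => ((G z).1 - w.1, (G z).2 - w.2))).
  by apply: measurable_fun_pair => /=; apply: measurable_funB.
by apply/funext => w; apply: injective_projections.
Qed.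

Let mHc w : measurable_fun setT (H w).
Proof.
rewrite (_ : H w = (fun z : R * R => ((G z).1 - w.1, (G z).2 - w.2))).
  apply: measurable_fun_pair => /=; apply: measurable_funB => //.
    exact: (measurableT_comp measurable_fst mG).
  exact: (measurableT_comp measurable_snd mG).
by apply/funext => z; apply: injective_projections.
Qed.

Let mzeros w : measurable (zeros w).
Proof. exact: (@measurable_zeros _ _ _ H mHc). Qed.

Let mct p h : 0 <= h -> measurable_fun setT (fun w => ct (zeros w `&` sq p h)).
Proof. exact: (@measurable_counting _ _ _ H mH cH mHc). Qed.

Let zerosE w : zeros w = [set z | G z = w].
Proof. by apply/seteqP; split=> z /=; [move/eqP; rewrite subr_eq0 => /eqP|move=> <-; exact: subrr]. Qed.

Lemma measurable_counting_fiber p h : 0 <= h ->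
  measurable_fun setT (fun w => ct ([set z | G z = w] `&` sq p h)).
Proof. by move=> h0; under eq_fun do rewrite -zerosE; exact: mct. Qed.

Let mdc k p h : measurable_fun setT (fun w => (dcount k (zeros w) p h)%:R%:E : \bar R).
Proof. exact: (@measurable_dcount _ _ _ H mH cH). Qed.

Let mgE : measurable_fun setT (fun w => (g w)%:E).
Proof. exact/measurable_EFinP. Qed.

(** [F] and [I] are the two sides of the area formula, viewed as additive functions of the
    square. *)
Let F p h := (\int[mu2]_w (ct (zeros w `&` sq p h) * (g w)%:E))%E.
Let f z := (g (G z) * `|J z|)%:E.
Let I p h := (\int[mu2]_(z in sq p h) f z)%E.

Let f0 z : (0 <= f z)%E. Proof. by rewrite lee_fin mulr_ge0. Qed.

Let mf : measurable_fun setT f.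
Proof.
apply/measurable_EFinP; apply: measurable_funM; first exact: (measurableT_comp mg mG).
exact: (measurableT_comp (@normr_measurable R setT) mJ).
Qed.

Let F0 p h : (0 <= F p h)%E.
Proof. by apply: integral_ge0 => w _; rewrite mule_ge0// lee_fin. Qed.

Let F_children p h : 0 <= h -> F p h = (\sum_(q <- children p h) F q (h / 2))%E.
Proof.
move=> h0; rewrite /F -ge0_integral_sum//; last 2 first.
- move=> q; apply: emeasurable_funM; last exact: mgE.
  by apply: mct; rewrite divr_ge0.
- by move=> q w _; rewrite mule_ge0// lee_fin.
apply: eq_integral => w _; rewrite (measure_children ct)//.
by rewrite ge0_sume_distrl.
Qed.

Let I_children p h : 0 <= h -> I p h = (\sum_(q <- children p h) I q (h / 2))%E.
Proof.
move=> h0; rewrite /I; under [RHS]eq_bigr do rewrite integral_mkcond.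
rewrite integral_mkcond -ge0_integral_sum//; last 2 first.
- move=> q; apply/(measurable_restrictT _ _).1; first exact: measurable_sq.
  exact: measurable_funTS.
- by move=> q z _; rewrite patchE; case: ifP.
(* The indicator of a square at [z] is the Dirac mass at [z] of that square, so [measure_children]
   splits the integrand pointwise. *)
have E (z : R * R) q l : (f \_ (sq q l)) z = (f z * @dirac _ (R * R)%type z R (setT `&` sq q l))%E.
  by rewrite patchE diracE setTI; case: ifP; rewrite ?mule1 ?mule0.
have E2 (z : R * R) : ((f \_ (sq p h)) z = \sum_(q <- children p h) (f \_ (sq q (h / 2))) z)%E.
  rewrite E (measure_children (@dirac _ (R * R)%type z R))// ge0_sume_distrr//.
  by apply: eq_bigr => q _; rewrite E.
by apply: eq_integral => z _; exact: E2.
Qed.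

Let I_local z0 e : 0 < e -> exists2 dl, 0 < dl & forall p h, 0 < h ->
  (forall z, sq p h z -> `|z - z0| < dl) ->
  (((g (G z0) * `|J z0| - e) * h ^+ 2)%:E <= I p h /\
   I p h <= ((g (G z0) * `|J z0| + e) * h ^+ 2)%:E)%E.
Proof.
move=> e0.
have cf : {for z0, continuous (fun z => g (G z) * `|J z|)}.
  apply: cvgM; first by apply: (@continuous_comp _ _ _ G g); [exact: cG|exact: cg].
  apply: (@continuous_comp _ _ _ (fun z => J z) (fun t => `|t|)); first exact: cJ.
  exact: norm_continuous.
have [dl dl0 Hdl] := continuous_ball cf e0; exists dl => // p h h0 sub.
have msq := measurable_sq p h.
have cst k : (\int[mu2]_(z in sq p h) (cst k%:E) z = (k * h ^+ 2)%:E)%E.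
  by rewrite integral_cst//= EFinM -(mu2_sq p (ltW h0)).
split; last first.
  rewrite -cst; apply: ge0_le_integral => //=; first exact: measurable_funTS.
  by move=> z /sub/Hdl; rewrite lee_fin ltr_norml => /andP[_ ?]; lra.
(* The lower bound may be negative, while monotonicity of the integral is applied to non-negative
   functions. *)
apply: (@le_trans _ _ (Num.max 0 (g (G z0) * `|J z0| - e) * h ^+ 2)%:E).
  by rewrite lee_fin ler_wpM2r ?sqr_ge0// le_max lexx orbT.
rewrite -cst; apply: ge0_le_integral => //=.
- by move=> _ _; rewrite lee_fin le_max lexx.
- exact: measurable_funTS.
- move=> z /sub/Hdl; rewrite lee_fin ge_max ltr_norml => /andP[? _].
  by apply/andP; split; [rewrite mulr_ge0|lra].
Qed.

Let mass_le (N : R * R -> \bar R) (K : set (R * R)) M :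
  measurable_fun setT N -> (forall w, 0 <= N w)%E -> measurable K -> 0 <= M ->
  (forall w, ~ K w -> N w = 0)%E -> (forall w, K w -> (N w * (g w)%:E <= M%:E)%E) ->
  (\int[mu2]_w (N w * (g w)%:E) <= M%:E * mu2 K)%E.
Proof.
move=> mN N0 mK M0 out inn.
have -> : (M%:E * mu2 K = \int[mu2]_w (M%:E * (\1_K w)%:E))%E.
  by rewrite ge0_integralZl//= ?integral_indic ?setIT//; apply/measurable_EFinP/measurable_indic.
apply: ge0_le_integral => //=.
- by move=> w _; apply: mule_ge0 => //; rewrite lee_fin.
- by apply: emeasurable_funM; [exact: mN|exact: mgE].
- apply/measurable_EFinP; apply: measurable_funM => //; exact: measurable_indic.
move=> w _; rewrite -EFinM indicE.
have [Kw|nKw] := pselect (K w); last by rewrite out// mul0e memNset// mulr0.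
by rewrite mem_set//= mulr1 inn.
Qed.

Let hit_mass p h (K : set (R * R)) M : 0 <= h -> measurable K -> 0 <= M ->
  (forall w, ~ K w -> zeros w `&` sq p h = set0) ->
  (forall w, K w -> (ct (zeros w `&` sq p h) <= 1)%E) ->
  (forall z, sq p h z -> g (G z) <= M) ->
  (F p h <= M%:E * mu2 K)%E.
Proof.
move=> h0 mK M0 out one gM; apply: mass_le => //.
- exact: mct.
- by move=> w nK; rewrite out// measure0.
move=> w Kw.
have [[z [/eqP]]|/set0P/negP/negPn/eqP ->] := pselect ((zeros w `&` sq p h) !=set0); last first.
  by rewrite measure0 mul0e lee_fin.
rewrite subr_eq0 => /eqP Ew /gM gz; subst w.
rewrite -[leRHS]mul1e; apply: lee_pmul => //; rewrite ?lee_fin//.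
exact: one.
Qed.

(** The two rows of the inverse of the differential of [G] at [z0]. *)
Let phi1 z0 (w : R * R) := d z0 / J z0 * w.1 + - b z0 / J z0 * w.2.
Let phi2 z0 (w : R * R) := - c z0 / J z0 * w.1 + a z0 / J z0 * w.2.

Let phi_det z0 : J z0 != 0 ->
  d z0 / J z0 * (a z0 / J z0) - - b z0 / J z0 * (- c z0 / J z0) = (J z0)^-1.
Proof. by move=> J0; field. Qed.

(* Composing [G] with the inverse of its differential at [z0] gives a small Lipschitz
   perturbation of the identity, so [G] is injective on the square and its image lies
   between two concentric parallelograms. *)
Let F_local z0 e : J z0 != 0 -> 0 < e -> exists2 dl, 0 < dl & forall p h, 0 < h ->
  (forall z, sq p h z -> `|z - z0| < dl) ->
  (((g (G z0) * `|J z0| - e) * h ^+ 2)%:E <= F p h /\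
   F p h <= ((g (G z0) * `|J z0| + e) * h ^+ 2)%:E)%E.
Proof.
move=> J0 e0; set v := g (G z0); set D := `|J z0|.
have D0 : 0 < D by rewrite normr_gt0.
have v0 : 0 <= v by exact: g0.
(* With this [N] and [s <= 1 / 2], both [max 0 (v - s) (1 - s)^2 D] from below and
   [(v + s) (1 + s)^2 D] from above are within [s N <= e] of [v D]. *)
pose N := D * (4 + 3 * v) + 1.
have N0 : 0 < N by rewrite /N ltr_wpDl// mulr_ge0 ?(ltW D0)// addr_ge0// mulr_ge0.
pose s := Num.min (1 / 2) (e / N).
have s0 : 0 < s by rewrite lt_min divr_gt0//= divr_gt0.
have s1 : s <= 1 / 2 by rewrite ge_min lexx.
have sN : s * N <= e by rewrite -ler_pdivlMr// ge_min lexx orbT.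
have [d1 d10 nid] := near_id_linear J0 s0 (sG1 z0) (sG2 z0).
have cgG : {for z0, continuous (fun z => g (G z))}.
  by apply: (@continuous_comp _ _ _ G g); [exact: cG|exact: cg].
have [d2 d20 gd] := continuous_ball cgG s0.
exists (Num.min d1 d2) => [|p h h0 sub]; first by rewrite lt_min d10.
have sub1 z : sq p h z -> `|z - z0| < d1 by move=> /sub; rewrite lt_min => /andP[].
have sub2 z : sq p h z -> v - s <= g (G z) <= v + s.
  move=> /sub; rewrite lt_min => /andP[_ /gd]; rewrite ltr_norml => /andP[? ?].
  by apply/andP; rewrite /v; split; lra.
pose Psi z := (phi1 z0 (G z), phi2 z0 (G z)).
have nid' z z' : `|z - z0| < d1 -> `|z' - z0| < d1 -> `|Psi z - Psi z' - (z - z')| <= s * `|z - z'|.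
  move=> zd zd'; have := nid z z' zd zd'; congr (`|_ - _ - _| <= _);
  by rewrite /Psi/phi1/phi2; apply: injective_projections => /=; ring.
have injG z z' : sq p h z -> sq p h z' -> G z = G z' -> z = z'.
  move=> /sub1 zd /sub1 zd' E; have := nid' _ _ zd zd'.
  rewrite /Psi E subrr sub0r normrN => h1.
  have : (1 - s) * `|z - z'| <= 0 by lra.
  rewrite pmulr_rle0 ?subr_gt0; last by lra.
  by rewrite normr_le0 subr_eq0 => /eqP.
pose c0 := sq_center p h.
have c0sq : sq p h c0 by exact: sq_centerP.
have dist_c0 z : sq p h z -> `|z - c0| <= h / 2 by exact: sq_center_dist.
(* The flags select the end points: [box false true] is the open parallelogram that the image of the
   square covers, [box true false] the closed one that contains the image. *)
pose box (b1 b2 : bool) r : set (R * R) := [set w |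
  [set` Interval (BSide b1 ((Psi c0).1 - r)) (BSide b2 ((Psi c0).1 + r))] (phi1 z0 w) /\
  [set` Interval (BSide b1 ((Psi c0).2 - r)) (BSide b2 ((Psi c0).2 + r))] (phi2 z0 w)].
have detE := phi_det J0.
have mbox b1 b2 r : measurable (box b1 b2 r).
  rewrite (_ : box _ _ _ = (setT `&` phi1 z0 @^-1` [set` Interval (BSide b1 ((Psi c0).1 - r)) (BSide b2 ((Psi c0).1 + r))]) `&`
      (setT `&` phi2 z0 @^-1` [set` Interval (BSide b1 ((Psi c0).2 - r)) (BSide b2 ((Psi c0).2 + r))])).
    by apply: measurableI; apply: measurable_lin => //; exact: measurable_itv.
  by apply/seteqP; split => w/= => [[? ?]|[[_ ?] [_ ?]]].
have boxE b1 b2 r : 0 < r -> mu2 (box b1 b2 r) = (D * (2 * r) ^+ 2)%:E.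
  move=> r0; rewrite /box measure_linear_box ?detE ?invr_eq0//; try exact: measurable_itv.
  have lt (x : R) : x - r < x + r by lra.
  rewrite !lebesgue_measure_itv/= !lte_fin !lt.
  by rewrite -!EFinB -!EFinM normfV invrK; congr EFin; rewrite -/D; ring.
have s1' : 0 < 1 - s by lra.
have s1'' : s < 1 by lra.
split.
  pose r := (1 - s) * (h / 2).
  have r0 : 0 < r by rewrite mulr_gt0// divr_gt0.
  pose M := Num.max 0 (v - s).
  have M0 : 0 <= M by rewrite le_max lexx.
  have Mv : v - s <= M by rewrite le_max lexx orbT.
  apply: (@le_trans _ _ (M%:E * mu2 (box false true r))%E).
    rewrite boxE// -EFinM lee_fin /r.
    rewrite (_ : M * _ = (M * (1 - s) ^+ 2 * D) * h ^+ 2); last by field.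
    rewrite ler_pM2r ?exprn_gt0//.
    apply: (@le_trans _ _ ((v - s * (1 + 2 * v)) * D)); last first.
      rewrite ler_pM2r//; have [vs|vs] := leP v s.
        apply: (@le_trans _ _ 0); last by rewrite mulr_ge0// sqr_ge0.
        have : 0 <= s * (2 * v) by rewrite mulr_ge0 ?mulr_ge0// ltW.
        by rewrite mulrDr mulr1; lra.
      apply: (@le_trans _ _ ((v - s) * (1 - s) ^+ 2)); last by rewrite ler_wpM2r// sqr_ge0.
      have -> : (v - s) * (1 - s) ^+ 2 = v - s * (1 + 2 * v) + s ^+ 2 * (v - s) + 2 * s ^+ 2 by ring.
      have : 0 <= s ^+ 2 * (v - s) by rewrite mulr_ge0 ?sqr_ge0// subr_ge0 ltW.
      have : 0 <= s ^+ 2 by rewrite sqr_ge0.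
      by lra.
    apply: (@le_trans _ _ (v * D - s * N)); first by rewrite lerD2l lerN2.
    rewrite /N; have : 0 <= s * (D * (3 + v)) by rewrite !mulr_ge0 ?addr_ge0// ltW.
    by move=> ?; have := s0; lra.
  have -> : (M%:E * mu2 (box false true r) = \int[mu2]_w (M%:E * (\1_(box false true r) w)%:E))%E.
    rewrite ge0_integralZl//= ?integral_indic ?setIT//; first exact: mbox.
    by apply/measurable_EFinP/measurable_indic; exact: mbox.
  apply: ge0_le_integral => //=.
  - by move=> w _; rewrite mule_ge0.
  - by apply/measurable_EFinP; apply: measurable_funM => //; apply: measurable_indic; exact: mbox.
  - by apply: emeasurable_funM; [apply: mct; exact: ltW|exact: mgE].
  move=> w _; rewrite -EFinM indicE; have [Bw|nBw] := pselect (box false true r w); last first.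
    by rewrite memNset// mulr0 mule_ge0// lee_fin.
  rewrite mem_set// mulr1.
  pose t := (phi1 z0 w, phi2 z0 w).
  have tlt : `|t - Psi c0| < (1 - s) * (h / 2).
    move: Bw => -[]; rewrite /= !in_itv/= -/(phi1 _ _) -/(phi2 _ _) => h1 h2.
    by rewrite norm_pair_lt/= !ltr_distl h1 h2.
  (* The radius must be below [h / 2] for the closed ball to lie in the square, and at least
     [|t - Psi c0| / (1 - s)] for [near_id_surj]; [h / 4] only makes it positive. *)
  pose r1 := Num.max (h / 4) (`|t - Psi c0| / (1 - s)).
  have r1h : r1 < h / 2.
    rewrite gt_max; apply/andP; split; first by lra.
    by rewrite ltr_pdivrMr// mulrC.
  have r10 : 0 < r1 by rewrite lt_max divr_gt0.
  have ballsq z : `|z - c0| <= r1 -> sq p h z by exact: sq_center_ball.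
  have cPsi : continuous Psi.
    have c1 x y : continuous (fun z : R * R => x * (G z).1 + y * (G z).2).
      move=> z; apply: cvgD; apply: cvgM; try exact: cvg_cst.
        by apply: (@continuous_comp _ _ _ G fst); [exact: cG|exact: continuous_fst].
      by apply: (@continuous_comp _ _ _ G snd); [exact: cG|exact: continuous_snd].
    by apply: continuous_pair; exact: c1.
  have [||z zc Pz] := @near_id_surj _ Psi s z0 d1 c0 r1 t cPsi (ltW s0) s1'' nid' r10.
  - by move=> z /ballsq/sub1.
  - by rewrite mulrC -ler_pdivrMr// le_max lexx orbT.
  have Gz : G z = w.
    move: Pz; rewrite /Psi /t => -[].
    rewrite /phi1 /phi2 => e1 e2.
    apply: injective_projections.
      have -> : (G z).1 = a z0 * (d z0 / J z0 * (G z).1 + - b z0 / J z0 * (G z).2) +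
         b z0 * (- c z0 / J z0 * (G z).1 + a z0 / J z0 * (G z).2) by field.
      by rewrite e1 e2; field.
    have -> : (G z).2 = c z0 * (d z0 / J z0 * (G z).1 + - b z0 / J z0 * (G z).2) +
       d z0 * (- c z0 / J z0 * (G z).1 + a z0 / J z0 * (G z).2) by field.
    by rewrite e1 e2; field.
  have zsq := ballsq _ zc.
  apply: (@le_trans _ _ (1 * (g w)%:E)%E).
    rewrite mul1e lee_fin -Gz ge_max g0/=.
    by case/andP: (sub2 _ zsq).
  apply: lee_pmul => //; first by rewrite lee_fin.
  by apply: counting_ge1; exists z; split => //=; rewrite /H Gz subrr.
pose r := (1 + s) * (h / 2).
have r0 : 0 < r by rewrite mulr_gt0 ?divr_gt0//; lra.
apply: (@le_trans _ _ ((v + s)%:E * mu2 (box true false r))%E); last first.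
  rewrite boxE// -EFinM lee_fin /r.
  rewrite (_ : (v + s) * _ = ((v + s) * (1 + s) ^+ 2 * D) * h ^+ 2); last by field.
  rewrite ler_pM2r ?exprn_gt0//.
  apply: (@le_trans _ _ (v * D + s * N)); last by rewrite lerD2l.
  apply: (@le_trans _ _ ((v + s * (4 + 3 * v)) * D)); last by rewrite /N; have := s0; lra.
  rewrite ler_pM2r//.
  have -> : (v + s) * (1 + s) ^+ 2 = v + s * (1 + 2 * v + s * (v + 2 + s)) by ring.
  rewrite lerD2l ler_pM2l//.
  have : s * (v + 2 + s) <= 1 * (v + 2 + s) by rewrite ler_wpM2r//; lra.
  by lra.
have fwd w : (zeros w `&` sq p h) !=set0 -> box true false r w.
  move=> [z [/eqP]]; rewrite subr_eq0 => /eqP <- zsq.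
  have := nid' z c0 (sub1 _ zsq) (sub1 _ c0sq).
  have hz := dist_c0 _ zsq.
  have := ler_normD (Psi z - Psi c0 - (z - c0)) (z - c0); rewrite subrK => h1 h2.
  have : `|Psi z - Psi c0| <= r.
    rewrite /r; have : s * `|z - c0| <= s * (h / 2) by rewrite ler_pM2l.
    by lra.
  rewrite norm_pair_le/= !ler_distl => /andP[hr1 hr2].
  by split; rewrite /= in_itv/= -/(phi1 _ _) -/(phi2 _ _).
apply: hit_mass.
- exact: ltW.
- exact: mbox.
- by rewrite addr_ge0// ltW.
- move=> w nB; apply/eqP/negPn/negP => /set0P/fwd //.
- move=> w _; have [[z [/eqP zw zsq]]|/set0P/negP/negPn/eqP ->] := pselect ((zeros w `&` sq p h) !=set0); last first.
    by rewrite measure0.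
  rewrite (_ : _ `&` _ = [set z]); first by rewrite /counting asboolT// fset_set1 cardfs1.
  apply/seteqP; split => [z' [/eqP z'w z'sq]|_ ->]; last by split=> //; exact/eqP.
  apply: injG => //; move: zw z'w; rewrite !subr_eq0 => /eqP -> /eqP ->//.
- by move=> z /sub2/andP[].
Qed.

(** That [l] is non-zero is stated as a determinant, the one of the matrix with rows [l] and [l]
    turned by a right angle: these are the axes of the strip in [F_local0]. *)
Let left_kernel (x y u v : R) : x * v - y * u = 0 ->
  exists l : R * R, [/\ l.1 * l.1 - l.2 * - l.2 != 0, l.1 * x + l.2 * u = 0 & l.1 * y + l.2 * v = 0].
Proof.
move=> det.
have sos (l1 l2 : R) : (l1 != 0) || (l2 != 0) -> l1 * l1 - l2 * - l2 != 0.
  move=> h; rewrite mulrN opprK -!expr2 paddr_eq0 ?sqr_ge0// !expf_eq0/=.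
  by rewrite negb_and.
have [xu|] := boolP ((u != 0) || (- x != 0)).
  by exists (u, - x); split => /=; [exact: sos|ring|rewrite -oppr0 -det; ring].
rewrite negb_or !negbK oppr_eq0 => /andP[/eqP u0 /eqP x0].
have [yv|] := boolP ((v != 0) || (- y != 0)).
  by exists (v, - y); split => /=; [exact: sos|rewrite u0 x0; ring|ring].
rewrite negb_or !negbK oppr_eq0 => /andP[/eqP v0 /eqP y0].
by exists (1, 0); split => /=; [by apply: sos; rewrite oner_eq0|rewrite u0 x0; ring|rewrite v0 y0; ring].
Qed.

(* A linear functional killing the differential at [z0] confines the image of every small
   square of side [l] to a strip of area [o(l^2)]; the bound for the counts of hits by
   dyadic subsquares passes to the number of zeros by monotone convergence. *)
Let F_local0 z0 e : J z0 = 0 -> 0 < e -> exists2 dl, 0 < dl & forall p h, 0 < h ->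
  (forall z, sq p h z -> `|z - z0| < dl) -> (F p h <= (e * h ^+ 2)%:E)%E.
Proof.
move=> J0 e0.
have [[l1 l2] /= [q0 k1 k2]] := left_kernel J0.
set q := _ - _ in q0.
pose N := `|l1| + `|l2|.
have N0 : 0 <= N by rewrite addr_ge0.
pose Lr := `|a z0| + `|b z0| + `|c z0| + `|d z0|.
have Lr0 : 0 <= Lr by rewrite !addr_ge0.
pose K := N * (Lr + 1).
have K0 : 0 <= K by rewrite mulr_ge0// addr_ge0.
pose M := g (G z0) + 1.
have M0 : 0 < M by rewrite ltr_wpDl.
(* The strip will have sides [2 N s l] and [2 K l] in coordinates of determinant [q], under a
   density at most [M]; its mass is then at most [s A l^2]. *)
pose A := M * (`|q|^-1 * (4 * N * K)).
have A0 : 0 <= A.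
  by apply: mulr_ge0; [exact: ltW|rewrite mulr_ge0 ?invr_ge0// mulr_ge0// mulr_ge0].
pose s := Num.min 1 (e / (A + 1)).
have A10 : 0 < A + 1 by rewrite ltr_wpDl.
have s0 : 0 < s by rewrite lt_min ltr01 divr_gt0.
have s1 : s <= 1 by rewrite ge_min lexx.
have sA : s * (A + 1) <= e by rewrite -ler_pdivlMr// ge_min lexx orbT.
have [d1 d10 h1] := sG1 z0 s0; have [d2 d20 h2] := sG2 z0 s0.
have cgG : {for z0, continuous (fun z => g (G z))}.
  by apply: (@continuous_comp _ _ _ G g); [exact: cG|exact: cg].
have [d3 d30 gd] := continuous_ball cgG ltr01.
pose dl := Num.min d1 (Num.min d2 d3).
exists dl => [|p h h0 sub]; first by rewrite !lt_min d10 d20.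
(* At generation 0 the count is at most one, which replaces the injectivity that is missing at a
   critical point. *)
have base p' l : 0 < l -> (forall z, sq p' l z -> `|z - z0| < dl) ->
    (\int[mu2]_w ((dcount 0 (zeros w) p' l)%:R%:E * (g w)%:E) <= (e * l ^+ 2)%:E)%E.
  move=> l0 sub'.
  have p'p' := sq_corner p' l0.
  pose P1 w := l1 * w.1 + l2 * w.2; pose P2 w := - l2 * w.1 + l1 * w.2.
  pose I1 : set R := `[P1 (G p') - N * s * l, P1 (G p') + N * s * l]%classic.
  pose I2 : set R := `[P2 (G p') - K * l, P2 (G p') + K * l]%classic.
  pose B : set (R * R) := [set w | I1 (l1 * w.1 + l2 * w.2) /\ I2 (- l2 * w.1 + l1 * w.2)].
  have mI1 : measurable I1 by exact: measurable_itv.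
  have mI2 : measurable I2 by exact: measurable_itv.
  have mB : measurable B.
    rewrite (_ : B = (setT `&` (fun z : R * R => l1 * z.1 + l2 * z.2) @^-1` I1) `&`
      (setT `&` (fun z : R * R => - l2 * z.1 + l1 * z.2) @^-1` I2)).
      by apply: measurableI; apply: measurable_lin.
    by apply/seteqP; split => w/= => [[? ?]|[[_ ?] [_ ?]]].
  have len (x r : R) : 0 <= r -> mu `[x - r, x + r]%classic = (2 * r)%:E.
    move=> r0; rewrite lebesgue_measure_itv/= lte_fin.
    case: ltP => h'; first by rewrite -EFinB; congr EFin; ring.
    by congr EFin; lra.
  have fwd z : sq p' l z -> B (G z) /\ g (G z) <= M.
    move=> zsq; have := sub' _ zsq; have := sub' _ p'p'.
    rewrite !lt_min => /and3P[q1 q2 q3] /and3P[z1 z2 z3]; split; last first.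
      by move/gd: z3; rewrite ltr_norml /M => /andP[? ?]; lra.
    have zl : `|z - p'| <= l by exact: sq_dist zsq p'p'.
    have := h1 _ _ z1 q1; have := h2 _ _ z2 q2.
    set E2 := (G z).2 - _ - _; set E1 := (G z).1 - _ - _ => H2 H1.
    have sl : s * `|z - p'| <= s * l by rewrite ler_pM2l.
    have {}H1 := le_trans H1 sl; have {}H2 := le_trans H2 sl.
    have x1 := le_trans (norm_fst_le _) zl; have x2 := le_trans (norm_snd_le _) zl.
    have T1 : P1 (G z) - P1 (G p') = l1 * E1 + l2 * E2.
      transitivity (l1 * E1 + l2 * E2 + (l1 * a z0 + l2 * c z0) * (z.1 - p'.1) + (l1 * b z0 + l2 * d z0) * (z.2 - p'.2)).
        by rewrite /P1 /E1 /E2; ring.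
      by rewrite k1 k2; ring.
    have B1 : `|P1 (G z) - P1 (G p')| <= N * s * l.
      rewrite T1 (le_trans (ler_normD _ _))// !normrM /N -mulrA mulrDl.
      by apply: lerD; rewrite ler_wpM2l.
    have lin x y : `|x| + `|y| <= Lr -> `|x * (z.1 - p'.1) + y * (z.2 - p'.2)| <= Lr * l.
      move=> xy; rewrite (le_trans (ler_normD _ _))// !normrM.
      apply: (@le_trans _ _ ((`|x| + `|y|) * l)); last by rewrite ler_wpM2r// ltW.
      by rewrite mulrDl; apply: lerD; rewrite ler_wpM2l.
    have sl1 : s * l <= l by rewrite -[leRHS]mul1r ler_pM2r.
    have G1 : `|(G z).1 - (G p').1| <= (Lr + 1) * l.
      have -> : (G z).1 - (G p').1 = E1 + (a z0 * (z.1 - p'.1) + b z0 * (z.2 - p'.2)) by rewrite /E1; ring.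
      rewrite (le_trans (ler_normD _ _))//.
      have /lin linab : `|a z0| + `|b z0| <= Lr by rewrite /Lr -addrA lerDl addr_ge0.
      by rewrite mulrDl mul1r addrC; apply: lerD => //; exact: le_trans sl1.
    have G2 : `|(G z).2 - (G p').2| <= (Lr + 1) * l.
      have -> : (G z).2 - (G p').2 = E2 + (c z0 * (z.1 - p'.1) + d z0 * (z.2 - p'.2)) by rewrite /E2; ring.
      rewrite (le_trans (ler_normD _ _))//.
      have /lin lincd : `|c z0| + `|d z0| <= Lr by rewrite /Lr -addrA lerDr addr_ge0.
      by rewrite mulrDl mul1r addrC; apply: lerD => //; exact: le_trans sl1.
    have B2 : `|P2 (G z) - P2 (G p')| <= K * l.
      have -> : P2 (G z) - P2 (G p') = - l2 * ((G z).1 - (G p').1) + l1 * ((G z).2 - (G p').2) by rewrite /P2; ring.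
      rewrite (le_trans (ler_normD _ _))// !normrM normrN /K /N.
      by rewrite -mulrA mulrDl addrC; apply: lerD; rewrite ler_wpM2l.
    move: B1 B2; rewrite !ler_distl => hB1 hB2.
    by split; rewrite /I1 /I2 /= in_itv/= -/(P1 _) -/(P2 _).
  have hitP w : ((zeros w `&` sq p' l) !=set0) -> B w /\ g w <= M.
    by move=> [z [/eqP]]; rewrite subr_eq0 => /eqP <-; exact: fwd.
  apply: (@le_trans _ _ (M%:E * mu2 B)%E).
    apply: mass_le; [exact: mdc|by []|exact: mB|exact: ltW| |].
      move=> w nB; rewrite /= asboolF// => /hitP[].
      by move=> /nB.
    move=> w Bw /=; case: asboolP => [/hitP[_]|_]; last by rewrite mul0e lee_fin ltW.
    by rewrite mul1e lee_fin.
  have mI1E : mu I1 = (2 * (N * s * l))%:E.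
    by apply: len; rewrite !mulr_ge0// ltW.
  have mI2E : mu I2 = (2 * (K * l))%:E by apply: len; rewrite mulr_ge0// ltW.
  rewrite /B measure_linear_box// mI1E mI2E -!EFinM lee_fin -/q.
  rewrite (_ : M * _ = s * A * l ^+ 2); last by rewrite /A; ring.
  rewrite ler_pM2r ?exprn_gt0//; apply: le_trans sA.
  by rewrite ler_pM2l// lerDl.
have key k p' l : 0 < l -> (forall z, sq p' l z -> `|z - z0| < dl) ->
    (\int[mu2]_w ((dcount k (zeros w) p' l)%:R%:E * (g w)%:E) <= (e * l ^+ 2)%:E)%E.
  elim: k p' l => [|k IH] p' l l0 sub'; first exact: base.
  have -> : (\int[mu2]_w ((dcount k.+1 (zeros w) p' l)%:R%:E * (g w)%:E) =
     \sum_(q <- children p' l) \int[mu2]_w ((dcount k (zeros w) q (l / 2))%:R%:E * (g w)%:E))%E.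
    rewrite -ge0_integral_sum//; last 2 first.
    - by move=> q'; apply: emeasurable_funM; [exact: mdc|exact: mgE].
    - by move=> q' w _; rewrite mule_ge0// lee_fin.
    apply: eq_integral => w _; rewrite /= natr_sum -sumEFin ge0_sume_distrl// => q' _.
  apply: (@le_trans _ _ (\sum_(q <- children p' l) (e * (l / 2) ^+ 2)%:E)%E); last first.
    by rewrite /children !big_cons big_nil -!EFinD lee_fin; lra.
  rewrite big_seq [leRHS]big_seq; apply: lee_sum => q' q'in; apply: IH; first by rewrite divr_gt0.
  by move=> z /(children_sub (ltW l0) q'in)/sub'.
have nd w : {homo (fun k => (dcount k (zeros w) p h)%:R%:E * (g w)%:E)%E : m n / (m <= n)%N >-> (m <= n)%E}.
  by move=> m n mn; apply: lee_wpmul2r; rewrite ?lee_fin// ler_nat dcount_homo.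
have -> : F p h = (\int[mu2]_w limn (fun k => (dcount k (zeros w) p h)%:R%:E * (g w)%:E))%E.
  apply: eq_integral => w _; apply/esym/cvg_lim => //.
  apply: cvgeZr => //; apply: cvg_dcount => //; exact: ltW.
rewrite (@monotone_convergence _ _ _ mu2 _ measurableT (fun k w => (dcount k (zeros w) p h)%:R%:E * (g w)%:E)%E).
- apply: lime_le; last by near=> k; exact: key.
  apply: ereal_nondecreasing_is_cvgn => m n mn; apply: ge0_le_integral => //.
  + by move=> w _; rewrite mule_ge0// lee_fin.
  + by apply: emeasurable_funM; [exact: mdc|exact: mgE].
  + by apply: emeasurable_funM; [exact: mdc|exact: mgE].
  + by move=> w _; exact: nd.
- by move=> k; apply: emeasurable_funM; [exact: mdc|exact: mgE].
- by move=> k w _; rewrite mule_ge0// lee_fin.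
- by move=> w _; exact: nd.
Unshelve. all: by end_near.
Qed.

Let FI_local z0 e : 0 < e -> exists2 dl, 0 < dl & forall p h, 0 < h ->
  (forall z, sq p h z -> `|z - z0| < dl) ->
  (F p h <= I p h + (e * h ^+ 2)%:E)%E /\ (I p h <= F p h + (e * h ^+ 2)%:E)%E.
Proof.
move=> e0; have e20 : 0 < e / 2 by rewrite divr_gt0.
have [d1 d10 h1] := I_local z0 e20.
have I0 p h : (0 <= I p h)%E by apply: integral_ge0.
have [J0|J0] := eqVneq (J z0) 0.
  have [d2 d20 h2] := F_local0 J0 e0.
  exists (Num.min d1 d2) => [|p h h0 sub]; first by rewrite lt_min d10.
  have [|_ I1] := h1 p h h0; first by move=> z /sub; rewrite lt_min => /andP[].
  have F1 : (F p h <= (e * h ^+ 2)%:E)%E by apply: h2 => // z /sub; rewrite lt_min => /andP[].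
  split; first by rewrite (le_trans F1)// leeDr.
  apply: le_trans I1 _; rewrite J0 normr0 mulr0 add0r.
  apply: (@le_trans _ _ (e * h ^+ 2)%:E); last by rewrite leeDr.
  by rewrite lee_fin ler_pM2r ?exprn_gt0//; lra.
have [d2 d20 h2] := F_local J0 e20.
exists (Num.min d1 d2) => [|p h h0 sub]; first by rewrite lt_min d10.
have [|I1 I2] := h1 p h h0; first by move=> z /sub; rewrite lt_min => /andP[].
have [|F1 F2] := h2 p h h0; first by move=> z /sub; rewrite lt_min => /andP[].
split; [apply: le_trans F2 _|apply: le_trans I2 _];
  [apply: (le_trans _ (leeD2r _ I1))|apply: (le_trans _ (leeD2r _ F1))];
  by rewrite -EFinD lee_fin; lra.
Qed.

(* Both sides are additive over dyadic subsquares and agree locally up to [e h^2], so the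
   bisection principle [cousin_sq] applies. *)
Lemma area_formula p h : 0 < h ->
  (\int[mu2]_w (ct ([set z | G z = w] `&` sq p h) * (g w)%:E) =
   \int[mu2]_(z in sq p h) (g (G z) * `|J z|)%:E)%E.
Proof.
move=> h0; rewrite -/(I p h).
transitivity (F p h).
  by apply: eq_integral => w _; rewrite -zerosE.
have sum4 (e : R) q l : (\sum_(i <- children q l) (e * (l / 2) ^+ 2)%:E = (e * l ^+ 2)%:E)%E.
  by rewrite /children !big_cons big_nil -!EFinD; congr EFin; field.
have bisect (A B : R * R -> R -> \bar R) :
    (forall q (l : R), 0 <= l -> A q l = (\sum_(i <- children q l) A i (l / 2)%R)%E) ->
    (forall q (l : R), 0 <= l -> B q l = (\sum_(i <- children q l) B i (l / 2)%R)%E) ->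
    (forall z0 (e : R), 0 < e -> exists2 dl, 0 < dl & forall q l, 0 < l ->
      (forall z, sq q l z -> `|z - z0| < dl) -> (A q l <= B q l + (e * l ^+ 2)%:E)%E) ->
    (A p h <= B p h)%E.
  move=> hA hB loc; apply/lee_addgt0Pr => e e0.
  (* The error is allotted per unit of area, so that the errors of four children add up exactly to
     the error of their parent. *)
  have k0 : 0 < e / h ^+ 2 by rewrite divr_gt0// exprn_gt0.
  have -> : e = e / h ^+ 2 * h ^+ 2 by field; rewrite gt_eqF.
  move: (e / h ^+ 2) k0 => k k0.
  apply: (@cousin_sq _ (fun p h => A p h <= B p h + (k * h ^+ 2)%:E)%E) => //; last first.
    by move=> z0; exact: loc.
  move=> q l l0 hq; rewrite hA; last exact: ltW.
  apply: (@le_trans _ _ (\sum_(i <- children q l) (B i (l / 2)%R + (k * (l / 2) ^+ 2)%:E))%E).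
    by rewrite !big_seq; apply: lee_sum => i iq; exact: hq.
  by rewrite big_split/= sum4 -hB//; exact: ltW.
apply/eqP; rewrite eq_le; apply/andP; split; apply: bisect => // z0 e e0;
  have [dl dl0 hd] := FI_local z0 e0; exists dl => // q l l0 sub; by have [] := hd q l l0 sub.
Qed.

End AreaFormula.

(** * Sums of independent normal variables *)

Section CoefficientSpace.
Context {R : realType} {I : finType}.

(** These sets are stable under intersection, and independence computes their probabilities; a law
    on [cspace] is thus determined by the hypotheses. *)
Definition boxes : set (set (I -> R)) :=
  [set A | exists2 B : I -> set R, (forall i, measurable (B i)) & A = [set x | forall i, B i (x i)]].

Definition cspace := g_sigma_algebraType boxes.

Lemma measurable_boxE d (T : measurableType d) (f : T -> I -> R) (B : I -> set R) :
  (forall i, measurable_fun setT (fun t => f t i)) -> (forall i, measurable (B i)) ->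
  measurable [set t | forall i, B i (f t i)].
Proof.
move=> mf mB.
rewrite (_ : [set t | _] = \big[setI/setT]_(i : I) (setT `&` (fun t => f t i) @^-1` B i)).
  by apply: bigsetI_measurable => i _; apply: mf.
rewrite -bigcap_seq; apply/seteqP; split => t /=.
  by move=> h i _ /=; split.
by move=> h i; have [] := h i (mem_index_enum i).
Qed.

Lemma measurable_to_cspace d (T : measurableType d) (f : T -> cspace) :
  (forall i, measurable_fun setT (fun t => f t i)) -> measurable_fun setT f.
Proof.
move=> mf; apply: (@measurability _ _ _ _ setT f boxes) => //.
by move=> _ [_ [B mB ->] <-]; rewrite setTI; exact: measurable_boxE.
Qed.

Lemma measurable_coord (i : I) : measurable_fun setT (fun x : cspace => x i).
Proof.
move=> _ B mB; rewrite setTI; apply: sub_sigma_algebra.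
exists (fun j => if j == i then B else setT); first by move=> j; case: ifP.
apply/seteqP; split => x /=; first by move=> Bx j; case: eqVneq => [->|].
by move=> /(_ i); rewrite eqxx.
Qed.

Definition upd (x : I -> R) (i : I) (t : R) : I -> R := fun j => if j == i then t else x j.

Lemma measurable_upd i : measurable_fun setT (fun z : cspace * R => upd z.1 i z.2 : cspace).
Proof.
apply: measurable_to_cspace => j; rewrite /upd; case: eqVneq => _; first exact: measurable_snd.
exact: (measurableT_comp (measurable_coord j) measurable_fst).
Qed.

End CoefficientSpace.

Section Resampling.
Context {d} {T : measurableType d} {R : realType} (P : probability T R) {I : finType} (X : I -> T -> R).
Hypothesis indX : mutually_independent P X.
Local Notation vec w := (fun i => X i w).

Let mX i : measurable_fun setT (X i). Proof. exact: indX.1. Qed.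

Lemma measurable_vec : measurable_fun setT (fun w => vec w : @cspace R I).
Proof. by apply: measurable_to_cspace. Qed.

Let P_box (B : I -> set R) : (forall i, measurable (B i)) ->
  P [set w | forall i, B i (X i w)] = (\prod_i P (X i @^-1` B i))%E.
Proof.
move=> mB; have := indX.2 [set: I]%SET B mB.
rewrite (eq_bigl xpredT) => [|i]; last by rewrite inE.
rewrite [in RHS](eq_bigl xpredT) => [<-|i]; last by rewrite inE.
congr (P _); rewrite -bigcap_seq; apply/seteqP; split => w /=; first by move=> h i _; exact: h.
by move=> h i; exact: (h i (mem_index_enum i)).
Qed.

(* By independence [X i] may be replaced by a fresh copy. *)
Lemma resample (nu : probability (measurableTypeR R) R) (i : I) (F : @cspace R I -> \bar R) :
  (forall V, measurable V -> P (X i @^-1` V) = nu V) ->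
  measurable_fun setT F -> (forall x, 0 <= F x)%E ->
  (\int[P]_w F (vec w) = \int[P]_w \int[nu]_t F (upd (vec w) i t))%E.
Proof.
move=> lawX mF F0.
pose phi (z : T * R) : @cspace R I := upd (vec z.1) i z.2.
have mphi : measurable_fun setT phi.
  apply: measurable_to_cspace => j; rewrite /phi/upd; case: eqVneq => _; first exact: measurable_snd.
  exact: (measurableT_comp (mX j) measurable_fst).
pose m1 := push P measurable_vec; pose m2 := push (P \x nu)%E mphi.
have E (A : set (@cspace R I)) : measurable A -> m1 A = m2 A.
  move=> mA; apply: (@measure_unique _ _ (@cspace R I) boxes (fun=> setT) _ _ _ _ m1 m2) => //.
  - move=> _ _ [A1 mA1 ->] [A2 mA2 ->]; exists (fun j => A1 j `&` A2 j).
      by move=> j; exact: measurableI.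
    apply/seteqP; split => x /=; first by move=> [h1 h2] j; split; [exact: h1|exact: h2].
    by move=> h; split=> j; have [] := h j.
  - by move=> _; exists (fun=> setT) => //; apply/seteqP; split.
  - by rewrite bigcup_const.
  - move=> _ [B mB ->].
    rewrite /m1 /m2 !pushE.
    (* Removing the [i]-th constraint leaves an event on the other variables, whose probability
       multiplies [nu (B i)] on both sides. *)
    pose B' j := if j == i then setT else B j.
    have mB' j : measurable (B' j) by rewrite /B'; case: ifP.
    rewrite (_ : phi @^-1` _ = [set w | forall j, B' j (X j w)] `*` B i); last first.
      apply/seteqP; split => -[w t] /=.
        move=> h; split => /=; last by have := h i; rewrite /phi/upd eqxx.
        by move=> j; rewrite /B'; have := h j; rewrite /phi/upd; case: eqVneq.
      by move=> [/= h Bt] j; rewrite /phi/upd/=; case: eqVneq => [->//|ji]; have := h j; rewrite /B' (negbTE ji).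
    set A1 := [set w | forall j, B' j (X j w)].
    have mA1 : measurable A1 by exact: measurable_boxE.
    rewrite [RHS](_ : _ = (P A1 * nu (B i))%E); last by apply: product_measure1E => //; exact: mB.
    rewrite [LHS](P_box mB) /A1 (P_box mB') (bigD1 i)//= [in RHS](bigD1 i)//=.
    rewrite {1}/B' eqxx preimage_setT probability_setT mul1e lawX// muleC; congr (_ * _)%E.
    by apply: eq_bigr => j ji; rewrite /B' (negbTE ji).
  - move=> _; rewrite (_ : m1 setT = P setT)//.
    by rewrite probability_setT ltry.
rewrite -(ge0_integral_push P measurable_vec mF F0).
transitivity (\int[m2]_y F y)%E.
  by apply: eq_measure_integral => A mA _; exact: E.
rewrite (ge0_integral_push (P \x nu)%E mphi mF F0) /phi.
rewrite (@tonelli_prod _ _ _ _ _ P nu (fun w t => F (upd (vec w) i t)))//.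
exact: (measurableT_comp mF mphi).
Qed.

End Resampling.

Section NormalIntegral.
Context {R : realType}.
Local Notation mu := (@lebesgue_measure R).

(** The Radon-Nikodym derivative of the normal law and [normal_pdf] have the same integral over
    every measurable set, so they agree almost everywhere. *)
Lemma ge0_integral_normal (s : R) (f : R -> \bar R) :
  measurable_fun setT f -> (forall x, 0 <= f x)%E ->
  (\int[normal_prob 0 s]_x f x = \int[mu]_x (f x * (normal_pdf 0 s x)%:E))%E.
Proof.
move=> mf f0; have dom := @normal_prob_dominates R 0 s.
rewrite -(Radon_Nikodym_SigmaFinite.change_of_variables dom)//.
have mg : measurable_fun setT (Radon_Nikodym_SigmaFinite.f (normal_prob 0 s) mu).
  exact: measurable_int (Radon_Nikodym_SigmaFinite.f_integrable dom).
have mp : measurable_fun setT (fun x => (normal_pdf 0 s x)%:E).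
  by apply/measurable_EFinP; exact: measurable_normal_pdf.
apply: ge0_ae_eq_integral => //.
- exact: emeasurable_funM.
- exact: emeasurable_funM.
- by move=> x _; rewrite mule_ge0//; exact: Radon_Nikodym_SigmaFinite.f_ge0.
- by move=> x _; rewrite mule_ge0// lee_fin normal_pdf_ge0.
apply: ae_eqe_mul2l; apply: integral_ae_eq => //.
  exact: Radon_Nikodym_SigmaFinite.f_integrable.
by move=> E _ mE; rewrite -Radon_Nikodym_SigmaFinite.f_integral.
Qed.

Definition gam : probability (measurableTypeR R) R := normal_prob 0 1.
Definition gpdf (x : R) : R := (Num.sqrt (2 * pi))^-1 * expR (- x ^+ 2 / 2).

Lemma gpdfE : gpdf = normal_pdf 0 1.
Proof.
apply/funext => x; rewrite normal_pdfE ?oner_neq0// /gpdf /normal_peak /normal_fun.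
by rewrite !expr1n mul1r mulr_natl subr0.
Qed.

Lemma gpdf_ge0 x : 0 <= gpdf x. Proof. by rewrite gpdfE normal_pdf_ge0. Qed.

Lemma measurable_gpdf : measurable_fun setT gpdf.
Proof. by rewrite gpdfE; exact: measurable_normal_pdf. Qed.

Lemma gpdfM x y : gpdf x * gpdf y =
  (Num.sqrt (2 * pi))^-1 ^+ 2 * expR (- (x ^+ 2 + y ^+ 2) / 2).
Proof. by rewrite /gpdf mulrACA -expr2 -expRD; congr (_ * expR _); field. Qed.

Lemma ge0_integral_gam (f : R -> \bar R) :
  measurable_fun setT f -> (forall x, 0 <= f x)%E ->
  (\int[gam]_x f x = \int[mu]_x (f x * (gpdf x)%:E))%E.
Proof. by move=> mf f0; rewrite gpdfE; exact: ge0_integral_normal. Qed.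

Lemma normal_pdf_gpdf (s x : R) : 0 < s -> normal_pdf 0 s x = s^-1 * gpdf (x / s).
Proof.
move=> s0; rewrite normal_pdfE ?gt_eqF// /normal_peak /normal_fun /gpdf subr0.
rewrite mulrA; congr (_ * expR _).
  rewrite -mulrnAr sqrtrM ?sqr_ge0// sqrtr_sqr gtr0_norm// invfM.
  by congr (_ * (Num.sqrt _)^-1); rewrite mulr_natl.
by rewrite -mulr_natr; field; rewrite gt_eqF.
Qed.

Lemma ge0_integral_normal_scale (s : R) (f : R -> \bar R) : 0 < s ->
  measurable_fun setT f -> (forall x, 0 <= f x)%E ->
  (\int[normal_prob 0 s]_x f x = \int[gam]_x f (s * x)%R)%E.
Proof.
move=> s0 mf f0; rewrite ge0_integral_normal// ge0_integral_gam//; last first.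
  by apply: (measurableT_comp mf); exact: measurable_funM.
pose k y := (f y * (gpdf (y / s))%:E)%E.
have mk : measurable_fun setT k.
  apply: emeasurable_funM => //; apply/measurable_EFinP.
  by apply: (measurableT_comp measurable_gpdf); exact: measurable_funM.
have k0 y : (0 <= k y)%E by rewrite mule_ge0// lee_fin gpdf_ge0.
transitivity (\int[mu]_x k (s * x + 0)%R)%E; last first.
  by apply: eq_integral => x _; rewrite /k addr0; congr (_ * (gpdf _)%:E)%E; field; rewrite gt_eqF.
rewrite (ge0_integral_affine 0 _ mk)// ?gt_eqF// -ge0_intZl//.
apply: eq_integral => x _; rewrite normal_pdf_gpdf// gtr0_norm// /k EFinM.
by rewrite muleCA.
Qed.

Lemma ge0_integral_gam2 (h : R * R -> \bar R) : measurable_fun setT h -> (forall x, 0 <= h x)%E ->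
  (\int[gam]_x \int[gam]_y h (x, y) = \int[mu]_x \int[mu]_y (h (x, y) * (gpdf x * gpdf y)%:E))%E.
Proof.
move=> mh h0.
have mh' x : measurable_fun setT (fun y => h (x, y)) by exact: measurable_section2.
have mh2 : measurable_fun setT (fun z : R * R => h (z.1, z.2)).
  by have -> : (fun z : R * R => h (z.1, z.2)) = h by apply/funext => -[].
rewrite ge0_integral_gam; last 2 first.
- exact: (@measurable_int2 _ _ _ _ _ gam (fun x y => h (x, y))).
- by move=> x; apply: integral_ge0.
apply: eq_integral => x _; rewrite ge0_integral_gam//.
rewrite muleC -ge0_intZl ?gpdf_ge0//.
- by apply: eq_integral => y _; rewrite EFinM muleCA.
- apply: emeasurable_funM; first exact: mh'.
  by apply/measurable_EFinP; exact: measurable_gpdf.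
- by move=> y; rewrite mule_ge0// lee_fin gpdf_ge0.
Qed.

(** The joint density depends on [x^2 + y^2] alone and a rotation has determinant 1. *)
Lemma ge0_integral_gam_rotate (c s : R) (f : R * R -> \bar R) : c ^+ 2 + s ^+ 2 = 1 ->
  measurable_fun setT f -> (forall x, 0 <= f x)%E ->
  (\int[gam]_x \int[gam]_y f (c * x - s * y, s * x + c * y)%R = \int[gam]_x \int[gam]_y f (x, y))%E.
Proof.
move=> cs mf f0.
have dens := @ge0_integral_gam2.
have mrot : measurable_fun setT (fun z : R * R => f (c * z.1 - s * z.2, s * z.1 + c * z.2)).
  apply: (measurableT_comp mf); apply: measurable_fun_pair => /=.
    by apply: measurable_funB; apply: measurable_funM.
  by apply: measurable_funD; apply: measurable_funM.
apply: (etrans (dens _ mrot (fun z => f0 _))); apply/esym; apply: (etrans (dens f mf f0)).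
apply/esym.
pose k (z : R * R) := (f z * (gpdf z.1 * gpdf z.2)%:E)%E.
have mk : measurable_fun setT k.
  apply: emeasurable_funM => //; apply/measurable_EFinP.
  by apply: measurable_funM; apply: (measurableT_comp measurable_gpdf).
have k0 z : (0 <= k z)%E by rewrite mule_ge0// lee_fin mulr_ge0 ?gpdf_ge0.
have det : c * c - - s * s = 1 by rewrite -cs; ring.
have := @ge0_integral_linear2 R c (- s) s c k; rewrite det oner_neq0 normr1 invr1 mul1e.
move=> /(_ isT mk k0) <-.
apply: eq_integral => x _; apply: eq_integral => y _; rewrite /k/= mulNr; congr (_ * (_)%:E)%E.
rewrite !gpdfM; congr (_ * expR (- _ / 2)).
transitivity ((c ^+ 2 + s ^+ 2) * (x ^+ 2 + y ^+ 2)); last by ring.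
by rewrite cs mul1r.
Qed.

End NormalIntegral.

(** Passes between the interleaved order, natural for complex coefficients, and the order with all
    real parts first, natural for the reduction of the Jacobian form. *)
Lemma perm_pairs (S T : eqType) (f g : S -> T) (s : seq S) :
  perm_eq (flatten [seq [:: f e; g e] | e <- s]) (map f s ++ map g s).
Proof.
elim: s => //= e s IH; rewrite perm_cons perm_sym.
by rewrite -[g e :: map g s]cat1s perm_catCA /= perm_cons perm_sym.
Qed.

Lemma perm_pairs_cat (S T : eqType) (f g : S -> T) (s1 s2 : seq S) :
  perm_eq (map f (s1 ++ s2) ++ map g (s1 ++ s2))
    (flatten [seq [:: f e; g e] | e <- s1] ++ (map f s2 ++ map g s2)).
Proof.
by rewrite -(permPl (perm_pairs f g (s1 ++ s2))) map_cat flatten_cat perm_cat2l perm_pairs.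
Qed.

(** * Gaussian vectors given by lists of directions *)

Section GaussianSums.
Context {R : realType}.
Local Notation gam := (@gam R).
(** Three real parts followed by three imaginary parts; the complex triple will be
    [(G, z H_z, zbar H_zbar)]. *)
Local Notation V := ((R * R * R) * (R * R * R))%type.
Implicit Types (f : V -> \bar R) (v w : V) (ws : seq V).

Lemma measurable_line w : measurable_fun setT (fun z : V * R => z.1 + z.2 *: w).
Proof.
have m1 : measurable_fun setT (fun z : V * R => z.1) by exact: measurable_fst.
have m2 : measurable_fun setT (fun z : V * R => z.2) by exact: measurable_snd.
have lin (p : V -> R) (k : R) : measurable_fun setT p -> measurable_fun setT (fun z : V * R => p z.1 + z.2 * k).
  move=> mp; apply: measurable_funD; first exact: (measurableT_comp mp m1).
  by apply: measurable_funM.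
have p1 : measurable_fun setT (fun v : V => v.1) by exact: measurable_fst.
have p2 : measurable_fun setT (fun v : V => v.2) by exact: measurable_snd.
have p11 : measurable_fun setT (fun v : V => v.1.1) by exact: (measurableT_comp measurable_fst p1).
have p21 : measurable_fun setT (fun v : V => v.2.1) by exact: (measurableT_comp measurable_fst p2).
apply/measurable_fun_pairP; split; (apply/measurable_fun_pairP; split; first (apply/measurable_fun_pairP; split)).
- exact: (lin (fun v => v.1.1.1) w.1.1.1 (measurableT_comp measurable_fst p11)).
- exact: (lin (fun v => v.1.1.2) w.1.1.2 (measurableT_comp measurable_snd p11)).
- exact: (lin (fun v => v.1.2) w.1.2 (measurableT_comp measurable_snd p1)).
- exact: (lin (fun v => v.2.1.1) w.2.1.1 (measurableT_comp measurable_fst p21)).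
- exact: (lin (fun v => v.2.1.2) w.2.1.2 (measurableT_comp measurable_snd p21)).
- exact: (lin (fun v => v.2.2) w.2.2 (measurableT_comp measurable_snd p2)).
Qed.

Definition nice f := measurable_fun setT f /\ (forall v, 0 <= f v)%E.

(* [Ex [:: w1; ..; wk] f v] is the expectation of [f (v + t1 w1 + .. + tk wk)] for
   independent standard normal [t1, .., tk]. *)
Fixpoint Ex ws f v : \bar R :=
  if ws is w :: ws' then (\int[gam]_t Ex ws' f (v + t *: w)%R)%E else f v.

Lemma nice_line f w : nice f ->
  measurable_fun setT (fun z : V * R => f (z.1 + z.2 *: w)).
Proof. by move=> [mf _]; exact: (measurableT_comp mf (measurable_line w)). Qed.

Lemma nice_section f v w : nice f -> measurable_fun setT (fun t : R => f (v + t *: w)).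
Proof.
move=> nf; apply: (measurableT_comp (nice_line w nf) (g := fun t : R => (v, t))).
exact: measurable_fun_pair.
Qed.

Lemma nice_Ex ws f : nice f -> nice (Ex ws f).
Proof.
move=> nf; elim: ws => [//|w ws IH]; split => [|v]; last by apply: integral_ge0 => t _; exact: IH.2.
apply: (@measurable_int2 _ _ _ _ _ gam (fun v t => Ex ws f (v + t *: w))).
  exact: nice_line.
by move=> v t; exact: IH.2.
Qed.

Lemma Ex_cat ws ws' f v : Ex (ws ++ ws') f v = Ex ws (Ex ws' f) v.
Proof. by elim: ws v => //= w ws IH v; apply: eq_integral => t _; rewrite IH. Qed.

(** Equality in law of the two Gaussian vectors. Quantifying over the shift [v] makes it compatible
    with concatenation. *)
Definition eqv ws ws' := forall f, nice f -> forall v, Ex ws f v = Ex ws' f v.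

Lemma eqv_sym ws ws' : eqv ws ws' -> eqv ws' ws.
Proof. by move=> h f nf v; rewrite h. Qed.

Lemma eqv_trans ws2 ws1 ws3 : eqv ws1 ws2 -> eqv ws2 ws3 -> eqv ws1 ws3.
Proof. by move=> h1 h2 f nf v; rewrite h1// h2. Qed.

Lemma eqv_cat ws1 ws1' ws2 ws2' : eqv ws1 ws1' -> eqv ws2 ws2' -> eqv (ws1 ++ ws2) (ws1' ++ ws2').
Proof.
move=> h1 h2 f nf v; rewrite !Ex_cat h1; last exact: nice_Ex.
by congr (Ex _ _ v); apply/funext => u; exact: h2.
Qed.

Lemma eqv_cons w ws ws' : eqv ws ws' -> eqv (w :: ws) (w :: ws').
Proof. by move=> h f nf v /=; apply: eq_integral => t _; exact: h. Qed.

Lemma nice_plane f v w1 w2 : nice f ->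
  measurable_fun setT (fun z : R * R => f (v + z.1 *: w1 + z.2 *: w2)).
Proof.
move=> nf; apply: (measurableT_comp (nice_line w2 nf) (g := fun z : R * R => (v + z.1 *: w1, z.2))).
apply: measurable_fun_pair => //.
apply: (measurableT_comp (measurable_line w1) (g := fun z : R * R => (v, z.1))).
exact: measurable_fun_pair.
Qed.

Lemma eqv_rot (c s : R) w1 w2 ws : c ^+ 2 + s ^+ 2 = 1 ->
  eqv [:: w1, w2 & ws] [:: c *: w1 + s *: w2, c *: w2 - s *: w1 & ws].
Proof.
move=> cs f nf v /=.
pose h (z : R * R) := Ex ws f (v + z.1 *: w1 + z.2 *: w2).
have nE := nice_Ex ws nf.
have := @ge0_integral_gam_rotate R c s h cs (nice_plane _ _ _ nE) (fun z => nE.2 _).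
rewrite /h/= => <-; apply: eq_integral => x _; apply: eq_integral => y _.
congr (Ex _ _ _).
have E3 (a p q : R * R * R) : a + (c * x - s * y) *: p + (s * x + c * y) *: q =
    a + x *: (c *: p + s *: q) + y *: (c *: q - s *: p).
  by apply: injective_projections; first apply: injective_projections;
    rewrite /= /GRing.scale/=; ring.
by apply: injective_projections; exact: E3.
Qed.

Lemma eqv_swap w1 w2 ws : eqv [:: w1, w2 & ws] [:: w2, w1 & ws].
Proof.
move=> f nf v /=; have nE := nice_Ex ws nf.
rewrite (@tonelli _ _ _ _ _ gam gam (fun x y => Ex ws f (v + x *: w1 + y *: w2))).
- by apply: eq_integral => y _; apply: eq_integral => x _; rewrite addrAC.
- exact: nice_plane.
- by move=> x y; exact: nE.2.
Qed.

Lemma eqv0 ws : eqv (0 :: ws) ws.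
Proof.
move=> f nf v /=; under eq_integral do rewrite scaler0 addr0.
rewrite integral_cst//= probability_setT mule1//.
Qed.

Lemma eqv_perm ws ws' : perm_eq ws ws' -> eqv ws ws'.
Proof.
have mv w s1 s2 : eqv (s1 ++ w :: s2) (w :: s1 ++ s2).
  elim: s1 => [//|u s1 IH]; apply: eqv_trans (eqv_swap u w _).
  exact: eqv_cons.
elim: ws ws' => [|w ws IH] ws' p; first by move: p; rewrite perm_sym => /perm_nilP ->.
have /splitPr wsP : w \in ws' by rewrite -(perm_mem p) mem_head.
case: wsP p => s1 s2 p; apply: eqv_trans (eqv_sym (mv w s1 s2)).
apply: eqv_cons; apply: IH.
by rewrite -(perm_cons w) (perm_trans p)// -cat1s perm_catCA.
Qed.

Lemma eqv_map_pair (T : eqType) (F F' : T -> seq V) (s : seq T) :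
  (forall i, i \in s -> eqv (F i) (F' i)) -> eqv (flatten (map F s)) (flatten (map F' s)).
Proof.
elim: s => [//|i s IH] h /=; apply: eqv_cat; first by apply: h; rewrite mem_head.
by apply: IH => j js; apply: h; rewrite inE js orbT.
Qed.

End GaussianSums.

(** * Elimination by plane rotations *)

Section Givens.
Context {R : realType} {U : lmodType R}.
Implicit Types (w : U) (ws : seq U) (l : U -> R).

Definition islin (l : U -> R) := forall a x y, l (a *: x + y) = a * l x + l y.

Lemma islin_comb l : islin l -> forall a b x y, l (a *: x + b *: y) = a * l x + b * l y.
Proof.
move=> h a b x y; rewrite h; congr (_ + _).
have h0 : l 0 = 0 by have := h (-1) 0 0; rewrite scaler0 addr0 mulN1r addNr.
by rewrite -[b *: y]addr0 h h0 addr0.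
Qed.

(** The covariance of [l1] and [l2] under the Gaussian vector with directions [ws]. *)
Definition gram (l1 l2 : U -> R) (ws : seq U) := \sum_(w <- ws) l1 w * l2 w.

Lemma gram_rot (c s : R) w1 w2 ws l1 l2 : c ^+ 2 + s ^+ 2 = 1 -> islin l1 -> islin l2 ->
  gram l1 l2 [:: c *: w1 + s *: w2, c *: w2 - s *: w1 & ws] = gram l1 l2 [:: w1, w2 & ws].
Proof.
move=> cs h1 h2; rewrite /gram !big_cons !addrA; congr (_ + _).
rewrite -scaleNr !islin_comb//.
transitivity ((c ^+ 2 + s ^+ 2) * (l1 w1 * l2 w1 + l1 w2 * l2 w2)); first by ring.
by rewrite cs mul1r.
Qed.

Lemma gram_cons w ws l1 l2 : gram l1 l2 (w :: ws) = l1 w * l2 w + gram l1 l2 ws.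
Proof. by rewrite /gram big_cons. Qed.

Lemma gram0 l ws : gram l l ws = 0 -> {in ws, forall w, l w = 0}.
Proof.
elim: ws => [//|w ws IH]; rewrite gram_cons => h x.
have g0 : 0 <= gram l l ws by rewrite /gram sumr_ge0// => u _; rewrite -expr2 sqr_ge0.
have s0 : 0 <= l w * l w by rewrite -expr2 sqr_ge0.
rewrite inE => /predU1P[->|]; last by apply: IH; lra.
by apply/eqP; rewrite -sqrf_eq0 expr2; apply/eqP; lra.
Qed.

(** Abstract, because elimination will be run with [eqv2], where each move acts on real and
    imaginary parts at once. *)
Variable E : seq U -> seq U -> Prop.
Hypotheses (Erefl : forall ws, E ws ws)
  (Etrans : forall ws2 ws1 ws3, E ws1 ws2 -> E ws2 ws3 -> E ws1 ws3)
  (Econs : forall w ws ws', E ws ws' -> E (w :: ws) (w :: ws'))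
  (Eswap : forall w1 w2 ws, E [:: w1, w2 & ws] [:: w2, w1 & ws])
  (Erot : forall (c s : R) w1 w2 ws, c ^+ 2 + s ^+ 2 = 1 ->
    E [:: w1, w2 & ws] [:: c *: w1 + s *: w2, c *: w2 - s *: w1 & ws]).

(* Givens elimination. *)
Lemma clear l w ws : islin l -> exists w' ws',
  [/\ E (w :: ws) (w' :: ws'), {in ws', forall u, l u = 0} &
   forall l1 l2, islin l1 -> islin l2 -> gram l1 l2 (w' :: ws') = gram l1 l2 (w :: ws)].
Proof.
move=> hl; elim: ws => [|u ws [w1 [ws1 [E0 z0 g0]]]]; first by exists w, [::]; split => //; exact: Erefl.
have E1 : E [:: w, u & ws] [:: u, w1 & ws1].
  by apply: Etrans (Eswap _ _ _) _; exact: Econs.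
have g1 l1 l2 : islin l1 -> islin l2 -> gram l1 l2 [:: u, w1 & ws1] = gram l1 l2 [:: w, u & ws].
  by move=> i1 i2; rewrite gram_cons g0// !gram_cons addrCA.
pose r := Num.sqrt (l u ^+ 2 + l w1 ^+ 2).
have [r0|r0] := eqVneq r 0.
  exists u, (w1 :: ws1); split => // x; rewrite inE => /predU1P[->|]; last exact: z0.
  move/eqP: r0; rewrite sqrtr_eq0 => h.
  have := sqr_ge0 (l u); have := sqr_ge0 (l w1) => h1 h2.
  by apply/eqP; rewrite -sqrf_eq0; apply/eqP; lra.
have r2 : l u ^+ 2 + l w1 ^+ 2 = r ^+ 2 by rewrite sqr_sqrtr// addr_ge0// sqr_ge0.
have cs : (l u / r) ^+ 2 + (l w1 / r) ^+ 2 = 1.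
  by rewrite !expr_div_n -mulrDl r2 divff// expf_neq0.
exists (l u / r *: u + l w1 / r *: w1), (l u / r *: w1 - l w1 / r *: u :: ws1); split.
- exact: Etrans E1 (Erot _ _ _ cs).
- move=> x; rewrite inE => /predU1P[->|]; last exact: z0.
  by rewrite -scaleNr islin_comb//; ring.
- by move=> l1 l2 i1 i2; rewrite gram_rot// g1.
Qed.

End Givens.

Section ExpectLinear.
Context {d} {T : measurableType d} {R : realType} (P : probability T R) {I : finType} (X : I -> T -> R).
Hypothesis indX : mutually_independent P X.
Variable sd : I -> R.
Hypotheses (sd0 : forall i, 0 < sd i)
  (lawX : forall i V, measurable V -> P (X i @^-1` V) = normal_prob 0 (sd i) V).
Local Notation V := ((R * R * R) * (R * R * R))%type.
Local Notation Ex := (@Ex R).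

Lemma measurable_comb (v : V) (w : I -> V) (l : seq I) :
  measurable_fun setT (fun x : @cspace R I => v + \sum_(i <- l) x i *: w i).
Proof.
elim: l v => [|i l IH] v.
  rewrite (_ : (fun x => _) = cst v); first exact: measurable_cst.
  by apply/funext => x; rewrite big_nil addr0.
pose g (x : @cspace R I) : V * R := (v + \sum_(j <- l) x j *: w j, x i).
rewrite (_ : (fun x => _) = (fun z : V * R => z.1 + z.2 *: w i) \o g).
  apply: (measurableT_comp (measurable_line (w i))).
  by apply: measurable_fun_pair; [exact: IH|exact: measurable_coord].
by apply/funext => x; rewrite big_cons addrA addrAC.
Qed.

(** One variable at a time is replaced by a fresh copy, whose integral Tonelli moves outside. A
    normal variable of deviation [sd i] is [sd i] times a standard one, whence the scaled
    directions. *)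
Lemma expect_linear (f : V -> \bar R) (w : I -> V) (l : seq I) (v : V) : nice f -> uniq l ->
  (\int[P]_o f (v + \sum_(i <- l) X i o *: w i)%R = Ex [seq sd i *: w i | i <- l] f v)%E.
Proof.
move=> nf; elim: l v => [|i l IH] v /=.
  move=> _; under eq_integral do rewrite big_nil addr0.
  by rewrite integral_cst//= probability_setT mule1.
move=> /andP[il ul].
pose F (x : @cspace R I) := f (v + \sum_(j <- i :: l) x j *: w j).
have mF : measurable_fun setT F by exact: (measurableT_comp nf.1 (measurable_comb _ _ _)).
rewrite (@resample _ _ _ P _ X indX (normal_prob 0 (sd i)) i F (@lawX i) mF (fun x => nf.2 _)).
have E x t : F (upd x i t) = f ((v + t *: w i) + \sum_(j <- l) x j *: w j).
  rewrite /F big_cons {1}/upd eqxx addrA; congr (f (_ + _)).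
  by rewrite big_seq [RHS]big_seq; apply: eq_bigr => j jl; rewrite /upd; case: eqVneq jl il => // -> ->.
under eq_integral do under eq_integral do rewrite E.
have mline : measurable_fun setT (fun z : T * R => f ((v + z.2 *: w i) + \sum_(j <- l) X j z.1 *: w j)).
  pose g (z : T * R) : V * R := (v + \sum_(j <- l) X j z.1 *: w j, z.2).
  rewrite (_ : (fun z => _) = (fun z : V * R => f (z.1 + z.2 *: w i)) \o g); last first.
    by apply/funext => z; rewrite /= addrAC.
  apply: (measurableT_comp (nice_line (w i) nf)).
  apply: measurable_fun_pair => //.
  apply: (measurableT_comp (measurable_comb v w l)
    (g := fun z : T * R => (fun j => X j z.1 : R) : cspace)).
  exact: (measurableT_comp (measurable_vec indX) measurable_fst).
pose F2 o t := f ((v + t *: w i) + \sum_(j <- l) X j o *: w j).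
transitivity (\int[normal_prob 0 (sd i)]_t \int[P]_o F2 o t)%E.
  apply: (@tonelli _ _ _ _ _ P (normal_prob 0 (sd i)) F2); first exact: mline.
  by move=> o t; exact: nf.2.
have nE := nice_Ex [seq sd i *: w i | i <- l] nf.
transitivity (\int[normal_prob 0 (sd i)]_t Ex [seq sd i *: w i | i <- l] f (v + t *: w i)%R)%E.
  by apply: eq_integral => t _; exact: IH.
rewrite ge0_integral_normal_scale//.
- by apply: eq_integral => t _; rewrite scalerA [(t * _)%R]mulrC.
- exact: nice_section.
- by move=> t; exact: nE.2.
Qed.

End ExpectLinear.

(** * The expected absolute value of an indefinite form *)

Section ImproperIntegrals.
Context {R : realType}.
Local Notation mu := (@lebesgue_measure R).
Implicit Types (F f : R -> R).

Lemma ge0_FTCy F f (a l : R) : (forall x : R, is_derive x (1 : R) F (f x)) -> continuous f ->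
  (forall x, a <= x -> 0 <= f x) -> F x @[x --> +oo] --> l ->
  (\int[mu]_(x in `[a, +oo[) (f x)%:E = (l - F a)%:E)%E.
Proof.
move=> dF cf f0 Fl; rewrite (@ge0_continuous_FTC2y _ f F a l)//.
- exact: continuous_subspaceT.
- apply: cvg_at_right_filter; apply: differentiable_continuous; apply/derivable1_diffP.
  exact: (@ex_derive _ _ _ _ _ _ _ (dF a)).
- by move=> x _; rewrite derive1E; exact: derive_val.
Qed.

Lemma FTCab F f (a b : R) : a < b -> (forall x : R, is_derive x (1 : R) F (f x)) -> continuous f ->
  (\int[mu]_(x in `[a, b]) (f x)%:E = (F b - F a)%:E)%E.
Proof.
move=> ab dF cf.
have cF : continuous F.
  move=> x; apply: differentiable_continuous; apply/derivable1_diffP.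
  exact: (@ex_derive _ _ _ _ _ _ _ (dF x)).
rewrite (@continuous_FTC2 _ f F a b)//.
- exact: continuous_subspaceT.
- split.
  + by move=> x _; exact: (@ex_derive _ _ _ _ _ _ _ (dF x)).
  + by apply: cvg_at_right_filter; exact: cF.
  + by apply: cvg_at_left_filter; exact: cF.
- by move=> x _; rewrite derive1E; exact: derive_val.
Qed.

Lemma continuous_oneDsqrV : continuous (fun x : R => (1 + x ^+ 2)^-1).
Proof.
move=> x; apply: cvgV; first by rewrite gt_eqF// ltr_pwDl// sqr_ge0.
by apply: cvgD; [exact: cvg_cst|exact: exprn_continuous].
Qed.

Let oneDsqr_neq0 (x : R) : 1 + x ^+ 2 != 0. Proof. by rewrite gt_eqF// ltr_pwDl// sqr_ge0. Qed.

Lemma is_derive_oneDsqrV (x : R) :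
  is_derive x (1 : R) (fun x : R => (1 + x ^+ 2)^-1) (- (2 * x) * (1 + x ^+ 2)^-1 ^+ 2).
Proof.
have h := oneDsqr_neq0 x.
have d1 : is_derive x (1 : R) (fun x : R => 1 + x ^+ 2) (2 * x).
  by apply: is_derive_eq; rewrite /GRing.scale/=; ring.
have d2 := @is_deriveV R (fun x : R => 1 + x ^+ 2) x (2 * x) 1 h d1.
by apply: is_derive_eq; rewrite /GRing.scale/= exprVn; ring.
Qed.

Lemma cvg_oneDsqrV : (1 + x ^+ 2)^-1 @[x --> +oo] --> (0 : R).
Proof.
apply/gtr0_cvgV0.
  by near=> x; rewrite ltr_pwDl// sqr_ge0.
apply/cvgryPge => M; near=> x.
have Mx : M <= x by near: x; apply: nbhs_pinfty_ge; rewrite num_real.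
have : 1 <= x by near: x; apply: nbhs_pinfty_ge; rewrite num_real.
rewrite expr2 => x1; have : x <= x * x by rewrite ler_peMl//; lra.
by lra.
Unshelve. all: by end_near. Qed.

Lemma cvg_exprn {T : Type} {F : set_system T} {FF : Filter F} (f : T -> R) (l : R) n :
  f t @[t --> F] --> l -> f t ^+ n @[t --> F] --> l ^+ n.
Proof. by move=> fl; apply: (cvg_comp f (fun z => z ^+ n) fl); exact: exprn_continuous. Qed.

Lemma cvg_cst_le (u v : R -> R) : (\forall x \near +oo, 0 <= u x <= v x) ->
  v x @[x --> +oo] --> (0 : R) -> u x @[x --> +oo] --> (0 : R).
Proof.
by move=> uv v0; apply: (squeeze_cvgr uv) => //; exact: cvg_cst.
Qed.

Local Notation q := (fun s : R => (1 + s ^+ 2)^-1).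

(** Writing [x + y s^2 = y / q + (x - y)] reduces the density to [s q^2] and [s q^3], with
    antiderivatives [- q / 2] and [- q^2 / 4]. *)
Let prim (x y : R) (s : R) := (- y * q s - (x - y) / 2 * q s ^+ 2) / 2.
Let dens (x y : R) (s : R) := s * (x + y * s ^+ 2) * q s ^+ 3.

Let is_derive_prim x y (s : R) : is_derive s (1 : R) (prim x y) (dens x y s).
Proof.
have d := is_derive_oneDsqrV s.
have h := oneDsqr_neq0 s.
rewrite /prim; apply: is_derive_eq; rewrite /dens /GRing.scale/=; field.
exact: h.
Qed.

Let continuous_dens x y : continuous (dens x y).
Proof.
move=> s; apply: cvgM; last by apply: cvg_exprn; exact: continuous_oneDsqrV.
apply: cvgM; first exact: cvg_id.
by apply: cvgD; [exact: cvg_cst|apply: cvgM; [exact: cvg_cst|exact: exprn_continuous]].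
Qed.

Let cvg_prim x y : prim x y s @[s --> +oo] --> (0 : R).
Proof.
rewrite (_ : 0 = (- y * 0 - (x - y) / 2 * 0 ^+ 2) / 2); last by rewrite expr0n/=; ring.
apply: cvgM; last exact: cvg_cst.
apply: cvgB; apply: cvgM; try exact: cvg_cst; first exact: cvg_oneDsqrV.
by apply: cvg_exprn; exact: cvg_oneDsqrV.
Qed.

Lemma even_integral (f : R -> R) : (forall x, 0 <= f x) -> continuous f -> (forall x, f (- x) = f x) ->
  (\int[mu]_x (f x)%:E = 2%:E * \int[mu]_(x in `[0%R, +oo[) (f x)%:E)%E.
Proof.
move=> f0 cf ef; rewrite ge0_symfun_integralT//; last by move=> x; rewrite /= ef.
by rewrite set_itvcy.
Qed.

(** For [x > 0 > y] the sign changes at [s0 = sqrt (x / - y)] and [prim] vanishes at infinity, so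
    the integral over the line is [2 (2 prim s0 - prim 0)]. *)
Lemma integral_ratio (x y : R) : x * y < 0 ->
  (\int[mu]_s (`|s| * `|x + y * s ^+ 2| * q s ^+ 3)%:E =
   ((x ^+ 2 + y ^+ 2) / (2 * `|x - y|))%:E)%E.
Proof.
wlog x0 : x y / 0 < x => [wl xy|].
  have [x0|x0|x0] := ltgtP 0 x; first exact: wl; last by move: xy; rewrite -x0 mul0r ltxx.
  have := wl (- x) (- y); rewrite oppr_gt0 mulrNN !sqrrN -opprD normrN => /(_ x0 xy) <-.
  by apply: eq_integral => s _; rewrite mulNr -opprD normrN.
rewrite pmulr_rlt0// => y0.
have x_y : 0 < x - y by lra.
pose s0 := Num.sqrt (x / - y).
have s02 : s0 ^+ 2 = x / - y by rewrite sqr_sqrtr// divr_ge0// ?oppr_ge0// ltW.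
have s0_gt0 : 0 < s0 by rewrite sqrtr_gt0 divr_gt0// oppr_gt0.
have prim_s0 : prim x y s0 = y ^+ 2 / (4 * (x - y)).
  have y_neq0 : y != 0 by rewrite lt_eqF.
  have xy_neq0 : x - y != 0 by rewrite gt_eqF.
  by rewrite /prim s02; field; rewrite y_neq0 xy_neq0.
have prim0 : prim x y 0 = - (x + y) / 4.
  by rewrite /prim expr0n/= addr0 invr1; field.
have h0 (s : R) : 0 <= `|s| * `|x + y * s ^+ 2| * q s ^+ 3.
  by rewrite mulr_ge0// exprn_ge0// invr_ge0 addr_ge0// sqr_ge0.
have ch : continuous (fun s : R => `|s| * `|x + y * s ^+ 2| * q s ^+ 3).
  move=> s; apply: cvgM; last by apply: cvg_exprn; exact: continuous_oneDsqrV.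
  apply: cvgM; first by apply: (@continuous_comp _ _ _ id (fun s : R => `|s|)); [exact: cvg_id|exact: norm_continuous].
  apply: (@continuous_comp _ _ _ (fun s : R => x + y * s ^+ 2) (fun s : R => `|s|)); last exact: norm_continuous.
  by apply: cvgD; [exact: cvg_cst|apply: cvgM; [exact: cvg_cst|exact: exprn_continuous]].
rewrite even_integral => [| | |s]; last by rewrite normrN sqrrN.
- have -> : (\int[mu]_(s in `[0%R, +oo[) (`|s| * `|x + y * s ^+ 2| * q s ^+ 3)%:E =
     (prim x y s0 - prim x y 0)%:E + (prim x y s0)%:E)%E.
    have -> : `[0%R, +oo[%classic = `[0%R, s0]%classic `|` `]s0, +oo[%classic :> set R.
      by rewrite -itv_bndbnd_setU// ?bnd_simp ?ltW.
    have mh : measurable_fun setT (fun s : R => (`|s| * `|x + y * s ^+ 2| * q s ^+ 3)%:E).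
      by apply/measurable_EFinP; exact: (continuous_measurable_fun ch).
    rewrite ge0_integral_setU//=; last 3 first.
    - exact: measurable_funTS.
    - by move=> s _; rewrite lee_fin h0.
    - apply/disj_setPRL => s /=; rewrite !in_itv/= andbT => ss0 /andP[_]; lra.
    congr (_ + _)%E.
      transitivity (\int[mu]_(s in `[0%R, s0]) (dens x y s)%:E)%E; last exact: FTCab.
      apply: eq_integral => s /set_mem; rewrite /= in_itv/= => /andP[sg sl]; congr EFin.
      rewrite /dens ger0_norm// ger0_norm//.
      have : s ^+ 2 <= s0 ^+ 2 by rewrite ler_sqr ?nnegrE// ltW.
      by rewrite s02 ler_pdivlMr ?oppr_gt0//; lra.
    rewrite integral_itv_obnd_cbnd; last exact: measurable_funTS.
    transitivity (\int[mu]_(s in `[s0, +oo[) (- dens x y s)%:E)%E.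
      apply: eq_integral => s /set_mem; rewrite /= in_itv/= andbT => sg; congr EFin.
      rewrite /dens ger0_norm; last exact: le_trans (ltW s0_gt0) sg.
      rewrite ler0_norm; first by rewrite mulrN mulNr.
      have : s0 ^+ 2 <= s ^+ 2 by rewrite ler_sqr ?nnegrE// ?ltW// (lt_le_trans s0_gt0).
      by rewrite s02 ler_pdivrMr ?oppr_gt0//; lra.
    rewrite (_ : prim x y s0 = 0 - (- prim x y s0)); last by rewrite opprK add0r.
    apply: (@ge0_FTCy (fun s => - prim x y s) (fun s => - dens x y s)).
    - by move=> s; apply: is_deriveN.
    - by move=> s; apply: cvgN; exact: continuous_dens.
    - move=> s sg; rewrite /dens -mulNr -mulrN; apply: mulr_ge0; last first.
        by rewrite exprn_ge0// invr_ge0 addr_ge0// sqr_ge0.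
      apply: mulr_ge0; first exact: le_trans (ltW s0_gt0) sg.
      rewrite oppr_ge0.
      have : s0 ^+ 2 <= s ^+ 2 by rewrite ler_sqr ?nnegrE// ?ltW// (lt_le_trans s0_gt0).
      by rewrite s02 ler_pdivrMr ?oppr_gt0//; lra.
    - by rewrite -oppr0; apply: cvgN; exact: cvg_prim.
  rewrite -EFinD -EFinM prim_s0 prim0 gtr0_norm//; congr EFin; field.
  by rewrite gt_eqF.
- exact: h0.
- exact: ch.
Qed.

End ImproperIntegrals.

(** * Radial integration *)

Section Radial.
Context {R : realType}.
Local Notation mu := (@lebesgue_measure R).
Local Notation gam := (@gam R).

(** The absolute value is there because the substitution [y = x s] of [polar] lets the radius run
    over the whole line; this also makes the total mass 2. *)
Definition radw (r : R) : R := `|r| * expR (- r ^+ 2 / 2).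

Lemma radw_ge0 r : 0 <= radw r. Proof. by rewrite mulr_ge0// expR_ge0. Qed.

Let continuous_gexp : continuous (fun r : R => expR (- r ^+ 2 / 2)).
Proof.
move=> r; apply: (@continuous_comp _ _ _ (fun r : R => - r ^+ 2 / 2) expR); last exact: continuous_expR.
by apply: cvgM; [apply: cvgN; exact: exprn_continuous|exact: cvg_cst].
Qed.

Let is_derive_gexp (r : R) : is_derive r (1 : R) (fun r : R => expR (- r ^+ 2 / 2)) (- r * expR (- r ^+ 2 / 2)).
Proof.
have d1 : is_derive r (1 : R) (fun r : R => - r ^+ 2 / 2) (- r).
  by apply: is_derive_eq; rewrite /GRing.scale/=; field.
have d2 := @is_derive1_comp R expR (fun r : R => - r ^+ 2 / 2) r _ _ (is_derive_expR _) d1.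
by apply: (@is_derive_eq _ _ _ _ _ _ _ _ d2); rewrite mulrC.
Qed.

Lemma continuous_radw : continuous radw.
Proof.
move=> r; apply: cvgM; last exact: continuous_gexp.
by apply: (@continuous_comp _ _ _ id (fun r : R => `|r|)); [exact: cvg_id|exact: norm_continuous].
Qed.

Lemma measurable_radw : measurable_fun setT radw.
Proof. exact: (continuous_measurable_fun continuous_radw). Qed.

(** The polynomial is that of the antiderivative in [integral_radw4]. With [y = r^2],
    [(1 + y / 6)^3 <= expR (y / 2)], and multiplying by [216 = 6^3] leaves a comparison of cubic
    polynomials coefficient by coefficient. *)
Let moment_bound (r : R) : (r ^+ 4 + 4 * r ^+ 2 + 8) * expR (- r ^+ 2 / 2) <= 216 * (1 + r ^+ 2)^-1.
Proof.
set y := r ^+ 2.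
have y0 : 0 <= y by rewrite sqr_ge0.
have -> : r ^+ 4 = y ^+ 2 by rewrite /y -exprM.
have a0 : 0 < 1 + y / 6 by rewrite ltr_pwDl// divr_ge0.
have h : (1 + y / 6) ^+ 3 <= expR (y / 2).
  rewrite (_ : y / 2 = 3%:R * (y / 6)); last by field.
  rewrite expRM_natl; apply: lerXn2r; [by rewrite nnegrE ltW|by rewrite nnegrE expR_ge0|exact: expR_ge1Dx].
rewrite mulNr expRN.
apply: (@le_trans _ _ ((y ^+ 2 + 4 * y + 8) * ((1 + y / 6) ^+ 3)^-1)).
  rewrite ler_wpM2l//; first by rewrite !addr_ge0// ?sqr_ge0// mulr_ge0.
  by rewrite lef_pV2// posrE ?expR_gt0// exprn_gt0.
rewrite ler_pdivrMr ?exprn_gt0// mulrAC ler_pdivlMr ?ltr_pwDl//.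
have -> : 216 * (1 + y / 6) ^+ 3 = 216 + 108 * y + 18 * y ^+ 2 + y ^+ 3 by field.
have : 0 <= y ^+ 2 by rewrite sqr_ge0.
have : 0 <= y ^+ 3 by rewrite exprn_ge0.
rewrite (_ : (y ^+ 2 + 4 * y + 8) * (1 + y) = y ^+ 3 + 5 * y ^+ 2 + 12 * y + 8); last by ring.
lra.
Qed.

Let cvg_bound (v : R -> R) : (forall r, 0 <= v r <= 216 * (1 + r ^+ 2)^-1) -> v r @[r --> +oo] --> (0 : R).
Proof.
move=> h; apply: (@cvg_cst_le _ v (fun r => 216 * (1 + r ^+ 2)^-1)).
  by near=> r; exact: h.
rewrite -(mulr0 216); apply: cvgM; [exact: cvg_cst|exact: cvg_oneDsqrV].
Unshelve. all: by end_near. Qed.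

Lemma integral_radw : (\int[mu]_r (radw r)%:E = 2%:E)%E.
Proof.
rewrite even_integral; [|exact: radw_ge0|exact: continuous_radw|by move=> r; rewrite /radw normrN sqrrN].
pose F (r : R) := - expR (- r ^+ 2 / 2).
rewrite (_ : (\int[mu]_(x in _) _ = (0 - F 0)%:E)%E).
  by rewrite -EFinM /F expr0n/= oppr0 mul0r expR0; congr EFin; ring.
transitivity (\int[mu]_(x in `[0%R, +oo[) (x * expR (- x ^+ 2 / 2))%:E)%E.
  by apply: eq_integral => r /set_mem; rewrite /= in_itv/= andbT => r0; rewrite /radw ger0_norm.
apply: ge0_FTCy.
- move=> r; have d := is_derive_gexp r; rewrite /F.
  by apply: is_derive_eq; ring.
- by move=> r; apply: cvgM; [exact: cvg_id|exact: continuous_gexp].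
- by move=> r r0; rewrite mulr_ge0// expR_ge0.
- rewrite -oppr0; apply: cvgN; apply: cvg_bound => r; rewrite expR_ge0/=.
  apply: le_trans (moment_bound r); rewrite ler_peMl ?expR_ge0//.
  have := sqr_ge0 r; have : 0 <= r ^+ 4 by rewrite exprn_even_ge0.
  lra.
Qed.

Lemma integral_radw4 : (\int[mu]_r (r ^+ 4 * radw r)%:E = 16%:E)%E.
Proof.
rewrite even_integral; last 3 first.
- by move=> r; rewrite mulr_ge0 ?radw_ge0// exprn_even_ge0.
- by move=> r; apply: cvgM; [exact: exprn_continuous|exact: continuous_radw].
- by move=> r; rewrite /radw normrN sqrrN; congr (_ * _); ring.
pose F (r : R) := - ((r ^+ 4 + 4 * r ^+ 2 + 8) * expR (- r ^+ 2 / 2)).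
rewrite (_ : (\int[mu]_(x in _) _ = (0 - F 0)%:E)%E).
  by rewrite -EFinM /F !expr0n/= oppr0 mul0r expR0; congr EFin; ring.
transitivity (\int[mu]_(x in `[0%R, +oo[) (x ^+ 5 * expR (- x ^+ 2 / 2))%:E)%E.
  apply: eq_integral => r /set_mem; rewrite /= in_itv/= andbT => r0; rewrite /radw ger0_norm//.
  by congr EFin; ring.
apply: ge0_FTCy.
- move=> r; have d := is_derive_gexp r; rewrite /F.
  by apply: is_derive_eq; rewrite /GRing.scale/=; ring.
- by move=> r; apply: cvgM; [exact: exprn_continuous|exact: continuous_gexp].
- by move=> r r0; rewrite mulr_ge0 ?expR_ge0// exprn_ge0.
- rewrite -oppr0; apply: cvgN; apply: cvg_bound => r; rewrite moment_bound andbT.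
  apply: mulr_ge0; last exact: expR_ge0.
  have := sqr_ge0 r; have : 0 <= r ^+ 4 by rewrite exprn_even_ge0.
  lra.
Qed.

(* The substitution [y = x s] in the inner integral. *)
Lemma polar (F : R -> R -> \bar R) : measurable_fun setT (fun z : R * R => F z.1 z.2) ->
  (forall x y, 0 <= F x y)%E ->
  (\int[mu]_x \int[mu]_y F x y = \int[mu]_s \int[mu]_x (`|x|%:E * F x (x * s)%R))%E.
Proof.
move=> mF F0.
have mFs : measurable_fun setT (fun z : R * R => (`|z.1|%:E * F z.1 (z.1 * z.2)%R)%E).
  apply: emeasurable_funM.
    by apply/measurable_EFinP; apply: (measurableT_comp (@normr_measurable R setT)); exact: measurable_fst.
  apply: (measurableT_comp mF (g := fun z : R * R => (z.1, z.1 * z.2))).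
  by apply: measurable_fun_pair => //; apply: measurable_funM.
have Fs0 x s : (0 <= `|x|%:E * F x (x * s)%R)%E by rewrite mule_ge0// lee_fin.
rewrite -(@tonelli _ _ _ _ _ mu mu _ mFs Fs0).
apply: ge0_ae_eq_integral => //.
- exact: (@measurable_int2 _ _ _ _ _ mu F).
- exact: (@measurable_int2 _ _ _ _ _ mu _ mFs Fs0).
- by move=> x _; apply: integral_ge0.
- by move=> x _; apply: integral_ge0.
(* The inner substitution degenerates at [x = 0] only. *)
exists [set 0]; split; [exact: measurable_set1|exact: lebesgue_measure_set1|].
move=> x /=; apply: contra_notP => /eqP x0 _.
have mFx : measurable_fun setT (F x).
  by apply: (measurableT_comp mF (g := fun y : R => (x, y))); exact: measurable_fun_pair.
have := @ge0_integral_affine R x 0 (F x) x0 mFx (F0 x).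
under eq_integral do rewrite addr0.
move=> E; rewrite ge0_intZl// ?E.
- by rewrite muleA -EFinM divff ?normr_eq0// mul1e.
- by apply: (measurableT_comp mFx); exact: measurable_funM.
Qed.

End Radial.

Section FourDimensional.
Context {R : realType}.
Local Notation mu := (@lebesgue_measure R).
Local Notation gam := (@gam R).

Let c0 : \bar R := (\int[mu]_s ((2 * pi)^-1 * (1 + s ^+ 2)^-1)%:E)%E.

Let sqrt_oneDsqr (s : R) : exists2 a : R, 0 < a & a ^+ 2 = 1 + s ^+ 2.
Proof.
have h : 0 < 1 + s ^+ 2 by rewrite ltr_pwDl// sqr_ge0.
by exists (Num.sqrt (1 + s ^+ 2)); rewrite ?sqrtr_gt0// sqr_sqrtr// ltW.
Qed.

Let measurable_sum_sqr (g : R -> \bar R) : measurable_fun setT g ->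
  measurable_fun setT (fun z : R * R => g (z.1 ^+ 2 + z.2 ^+ 2)).
Proof.
move=> mg; apply: (measurableT_comp mg).
by apply: measurable_funD; apply: measurable_funX.
Qed.

(** In the coordinates of [polar], rescaling [x] by [sqrt (1 + s^2)] separates the radius from the
    slope [s], which contributes only the constant [c0]. *)
Let radial0 (g : R -> \bar R) : measurable_fun setT g -> (forall r, 0 <= g r)%E ->
  (\int[gam]_x \int[gam]_y g (x ^+ 2 + y ^+ 2)%R = c0 * \int[mu]_r ((radw r)%:E * g (r ^+ 2)%R))%E.
Proof.
move=> mg g0.
have mg2 := measurable_sum_sqr mg.
rewrite (ge0_integral_gam2 mg2 (fun z => g0 _)).
pose F x y := (g (x ^+ 2 + y ^+ 2)%R * (gpdf x * gpdf y)%:E)%E.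
have mF : measurable_fun setT (fun z : R * R => F z.1 z.2).
  apply: emeasurable_funM => //; apply/measurable_EFinP.
  by apply: measurable_funM; apply: (measurableT_comp measurable_gpdf).
have F0 x y : (0 <= F x y)%E by rewrite mule_ge0// lee_fin mulr_ge0 ?gpdf_ge0.
have mrg : measurable_fun setT (fun r => (radw r)%:E * g (r ^+ 2)%R)%E.
  apply: emeasurable_funM; first by apply/measurable_EFinP; exact: measurable_radw.
  by apply: (measurableT_comp mg); exact: measurable_funX.
have rg0 r : (0 <= (radw r)%:E * g (r ^+ 2)%R)%E by rewrite mule_ge0// lee_fin radw_ge0.
transitivity (\int[mu]_s \int[mu]_x (`|x|%:E * F x (x * s)%R))%E; first exact: polar.
set Z := (\int[mu]_r _)%E.
have pi0 : 0 <= (2 * pi : R)^-1 by rewrite invr_ge0 mulr_ge0// pi_ge0.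
rewrite /c0 -ge0_integralZr//; last 3 first.
- apply/measurable_EFinP; apply: measurable_funM => //.
  exact: (continuous_measurable_fun continuous_oneDsqrV).
- by move=> s _; rewrite lee_fin mulr_ge0// invr_ge0 addr_ge0// sqr_ge0.
- by apply: integral_ge0.
apply: eq_integral => s _.
have [a a0 a2] := sqrt_oneDsqr s.
have an : a != 0 by rewrite gt_eqF.
have pin : (pi : R) != 0 by rewrite gt_eqF// pi_gt0.
pose k r := (((2 * pi)^-1 * a^-1)%:E * ((radw r)%:E * g (r ^+ 2)%R))%E.
have ca0 : 0 <= (2 * pi)^-1 * a^-1 by rewrite mulr_ge0// invr_ge0 ltW.
have mk : measurable_fun setT k by apply: emeasurable_funM.
have k0 r : (0 <= k r)%E by rewrite mule_ge0// lee_fin.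
transitivity (\int[mu]_x k (a * x + 0)%R)%E.
  apply: eq_integral => x _; rewrite addr0 /k /F.
  have e1 : (a * x) ^+ 2 = x ^+ 2 + (x * s) ^+ 2 by rewrite exprMn a2; ring.
  rewrite e1 muleCA -EFinM [RHS]muleA -EFinM [RHS]muleC.
  congr (_ * _%:E)%E; rewrite gpdfM -e1 /radw normrM (gtr0_norm a0).
  rewrite exprVn sqr_sqrtr; last by rewrite mulr_ge0// pi_ge0.
  by move: pin; generalize (pi : R) => p pin; field; rewrite an pin.
rewrite ge0_integral_affine ?gt_eqF// ge0_intZl// muleA -EFinM gtr0_norm//; congr (_%:E * _)%E.
by rewrite -a2; move: pin; generalize (pi : R) => p pin; field; rewrite an pin.
Qed.

(** No arctangent is computed: for [g = 1] the left side of [radial0] is 1 and [radw] has mass 2. *)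
Let c0E : c0 = (1 / 2)%:E.
Proof.
have := @radial0 (cst 1%E) (measurable_cst _) (fun=> lee01).
under eq_integral do rewrite integral_cst//= probability_setT mule1.
rewrite integral_cst//= probability_setT mule1.
under eq_integral do rewrite mule1.
rewrite integral_radw => h.
have : (c0 * 2%:E * (1 / 2)%:E = 1 * (1 / 2)%:E)%E by rewrite -h.
by rewrite mul1e -muleA -EFinM (_ : (2 * (1 / 2) = 1 :> R)%R) ?mule1//; field.
Qed.

Lemma radial (g : R -> \bar R) : measurable_fun setT g -> (forall r, 0 <= g r)%E ->
  (\int[gam]_x \int[gam]_y g (x ^+ 2 + y ^+ 2)%R =
   (1 / 2)%:E * \int[mu]_r ((radw r)%:E * g (r ^+ 2)%R))%E.
Proof. by move=> mg g0; rewrite radial0// c0E. Qed.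

(** [radial] replaces each pair by one radius and [polar] separates the size of the two radii from
    their ratio. The constant is [1/2 * 1/2 * 16 * 1/2 = 2], from two uses of [radial],
    [integral_radw4] and [integral_ratio]. *)
Lemma integral_abs_form (x y : R) : x * y < 0 ->
  (\int[gam]_a \int[gam]_b \int[gam]_c \int[gam]_d
     `|x * (a ^+ 2 + b ^+ 2) + y * (c ^+ 2 + d ^+ 2)|%:E =
   (2 * (x ^+ 2 + y ^+ 2) / `|x - y|)%:E)%E.
Proof.
move=> xy.
have mabs : measurable_fun setT (fun z : R * R => `|x * z.1 + y * z.2|%:E).
  apply/measurable_EFinP; apply: (measurableT_comp (@normr_measurable R setT)).
  by apply: measurable_funD; apply: measurable_funM.
have msec A : measurable_fun setT (fun r => `|x * A + y * r|%:E).
  by apply: (measurableT_comp mabs (g := fun r : R => (A, r))); exact: measurable_fun_pair.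
pose F2 A r := ((radw r)%:E * `|x * A + y * r ^+ 2|%:E)%E.
pose Q A := ((1 / 2)%:E * \int[mu]_r F2 A r)%E.
have F20 A r : (0 <= F2 A r)%E by rewrite mule_ge0// lee_fin radw_ge0.
have mF2 : measurable_fun setT (fun z : R * R => F2 z.1 z.2).
  apply: emeasurable_funM.
    by apply/measurable_EFinP; apply: (measurableT_comp measurable_radw).
  apply: (measurableT_comp mabs (g := fun z : R * R => (z.1, z.2 ^+ 2))).
  by apply: measurable_fun_pair => //; exact: measurable_funX.
have mQ : measurable_fun setT Q.
  by apply: emeasurable_funM => //; exact: (@measurable_int2 _ _ _ _ _ mu F2).
have Q0 A : (0 <= Q A)%E by rewrite mule_ge0// ?lee_fin//; apply: integral_ge0.
transitivity (\int[gam]_a \int[gam]_b Q (a ^+ 2 + b ^+ 2)%R)%E.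
  apply: eq_integral => a _; apply: eq_integral => b _.
  by rewrite (@radial (fun r => `|x * (a ^+ 2 + b ^+ 2) + y * r|%:E)).
rewrite radial//.
pose F3 t s := ((radw t)%:E * F2 (t ^+ 2)%R s)%E.
have F30 t s : (0 <= F3 t s)%E by rewrite mule_ge0// lee_fin radw_ge0.
have mF3 : measurable_fun setT (fun z : R * R => F3 z.1 z.2).
  apply: emeasurable_funM.
    by apply/measurable_EFinP; apply: (measurableT_comp measurable_radw).
  apply: (measurableT_comp mF2 (g := fun z : R * R => (z.1 ^+ 2, z.2))).
  by apply: measurable_fun_pair => //; exact: measurable_funX.
have mF2' A : measurable_fun setT (F2 A).
  by apply: (measurableT_comp mF2 (g := fun r : R => (A, r))); exact: measurable_fun_pair.
transitivity ((1 / 2)%:E * ((1 / 2)%:E * \int[mu]_t \int[mu]_s F3 t s))%E.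
  congr (_ * _)%E; rewrite -ge0_intZl//; last 2 first.
  - exact: (@measurable_int2 _ _ _ _ _ mu F3).
  - by move=> t; apply: integral_ge0.
  apply: eq_integral => t _; rewrite /Q muleCA; congr (_ * _)%E.
  by rewrite /F3 ge0_intZl//; [exact: radw_ge0|exact: mF2'].
rewrite (polar mF3 F30).
transitivity ((1 / 2)%:E * ((1 / 2)%:E * (16%:E *
    \int[mu]_s (`|s| * `|x + y * s ^+ 2| * ((1 + s ^+ 2)^-1) ^+ 3)%:E)))%E; last first.
  rewrite integral_ratio// -!EFinM; congr EFin; field.
  rewrite normr_eq0; apply: contraTneq xy; move/eqP; rewrite subr_eq0 => /eqP ->.
  by rewrite -leNgt -expr2 sqr_ge0.
congr (_ * (_ * _))%E; rewrite -ge0_intZl//; last 2 first.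
- apply/measurable_EFinP; apply: measurable_funM; last first.
    by apply: measurable_funX; exact: (continuous_measurable_fun continuous_oneDsqrV).
  apply: measurable_funM; first exact: normr_measurable.
  apply: (measurableT_comp (@normr_measurable R setT)).
  by apply: measurable_funD => //; apply: measurable_funM => //; exact: measurable_funX.
- move=> s; rewrite lee_fin; apply: mulr_ge0; first exact: mulr_ge0.
  by rewrite exprn_ge0// invr_ge0 addr_ge0// sqr_ge0.
apply: eq_integral => s _.
have [a a0 a2] := sqrt_oneDsqr s.
(* In terms of [r = a t] the integrand is homogeneous of degree 5 in [t], and [dt] gives one more
   factor [a^-1]: in all [a^-6 = (1 + s^2)^-3]. *)
pose C := `|s| * `|x + y * s ^+ 2| * a^-1 ^+ 5.
have C0 : 0 <= C.
  by apply: mulr_ge0; [exact: mulr_ge0|rewrite exprn_ge0// invr_ge0 ltW].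
pose k r := (C%:E * (r ^+ 4 * radw r)%:E)%E.
have mr : measurable_fun setT (fun r : R => (r ^+ 4 * radw r)%:E).
  apply/measurable_EFinP; apply: measurable_funM; last exact: measurable_radw.
  exact: measurable_funX.
have r0 (r : R) : (0 <= (r ^+ 4 * radw r)%:E)%E.
  by rewrite lee_fin mulr_ge0 ?radw_ge0// exprn_even_ge0.
have mk : measurable_fun setT k by apply: emeasurable_funM.
have k0 r : (0 <= k r)%E by rewrite mule_ge0// lee_fin.
transitivity (\int[mu]_x k (a * x + 0)%R)%E.
  apply: eq_integral => t _; rewrite addr0 /k /F3 /F2 -!EFinM; congr EFin.
  have -> : x * t ^+ 2 + y * (t * s) ^+ 2 = t ^+ 2 * (x + y * s ^+ 2) by ring.
  rewrite normrM (ger0_norm (sqr_ge0 t)) /radw !normrM (gtr0_norm a0).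
  have -> : expR (- (a * t) ^+ 2 / 2) = expR (- t ^+ 2 / 2) * expR (- (t * s) ^+ 2 / 2).
    by rewrite -expRD exprMn a2; congr expR; field.
  rewrite /C.
  have -> : (a * t) ^+ 4 = a ^+ 4 * (t ^+ 2 * `|t| ^+ 2) by rewrite real_normK ?num_real//; ring.
  by field; rewrite gt_eqF.
rewrite ge0_integral_affine ?gt_eqF// ge0_intZl// integral_radw4 -!EFinM gtr0_norm//; congr EFin.
rewrite /C -a2; field; rewrite gt_eqF//.
Qed.

End FourDimensional.

(** * Conditioning on a zero and diagonalising the Jacobian form *)

Section Reduction.
Context {R : realType}.
Local Notation V3 := (R * R * R)%type.
Local Notation V := (V3 * V3)%type.
Local Notation gam := (@gam R).
Local Notation mu := (@lebesgue_measure R).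
Implicit Types (e : V3) (L : seq V3) (f : V -> \bar R).

Definition re e : V := (e, 0).
Definition im e : V := (0, e).

(** Real and imaginary parts are independent with the same covariance, so one list of real triples
    describes both, and every move is made on both copies. *)
Definition eqv2 L L' := eqv (map re L) (map re L') /\ eqv (map im L) (map im L').

Let re_comb (a b : R) e e' : re (a *: e + b *: e') = a *: re e + b *: re e'.
Proof. by apply: injective_projections => //=; rewrite !scaler0 addr0. Qed.

Let im_comb (a b : R) e e' : im (a *: e + b *: e') = a *: im e + b *: im e'.
Proof. by apply: injective_projections => //=; rewrite !scaler0 addr0. Qed.

Let eqv2_refl L : eqv2 L L. Proof. by []. Qed.

Let eqv2_trans L2 L1 L3 : eqv2 L1 L2 -> eqv2 L2 L3 -> eqv2 L1 L3.
Proof. by move=> [r1 i1] [r2 i2]; split; [exact: eqv_trans r1 r2|exact: eqv_trans i1 i2]. Qed.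

Let eqv2_cons e L L' : eqv2 L L' -> eqv2 (e :: L) (e :: L').
Proof. by move=> [r i]; split; exact: eqv_cons. Qed.

Let eqv2_swap e e' L : eqv2 [:: e, e' & L] [:: e', e & L].
Proof. by split; exact: eqv_swap. Qed.

Let eqv2_rot (c s : R) e e' L : c ^+ 2 + s ^+ 2 = 1 ->
  eqv2 [:: e, e' & L] [:: c *: e + s *: e', c *: e' - s *: e & L].
Proof.
by move=> cs; split; rewrite /= -scaleNr ?re_comb ?im_comb scaleNr; exact: eqv_rot.
Qed.

Let eqv2_0 L : eqv2 (0 :: L) L. Proof. by split; exact: eqv0. Qed.

Let clear2 := @clear R V3 eqv2 eqv2_refl eqv2_trans eqv2_cons eqv2_swap eqv2_rot.

(** [g], [u], [v] read the contributions to [H], [z H_z] and [zbar H_zbar]. *)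
Let g e : R := e.1.1.
Let u e : R := e.1.2.
Let v e : R := e.2.

Let lin_g : islin g. Proof. by []. Qed.
Let lin_u : islin u. Proof. by []. Qed.
Let lin_v : islin v. Proof. by []. Qed.

Lemma Ex_factor (k : V -> R) f ws z : nice f -> (forall z, 0 <= k z) ->
  (forall w z (t : R), w \in ws -> k (z + t *: w) = k z) ->
  Ex ws (fun z => (k z)%:E * f z)%E z = ((k z)%:E * Ex ws f z)%E.
Proof.
move=> nf k0; elim: ws z => [//|w ws IH] z inv /=.
have nE := nice_Ex ws nf.
rewrite -ge0_intZl//.
- apply: eq_integral => t _; rewrite IH; last by move=> w' z' t' w'in; apply: inv; rewrite inE w'in orbT.
  by rewrite inv// mem_head.
- exact: nice_section.
- by move=> t; exact: nE.2.
Qed.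

Lemma Ex_inv f ws z : nice f -> (forall w z (t : R), w \in ws -> f (z + t *: w) = f z) ->
  Ex ws f z = f z.
Proof.
move=> nf; elim: ws z => [//|w ws IH] z inv /=.
transitivity (\int[gam]_t cst (f z) t)%E; last by rewrite integral_cst//= probability_setT mule1.
apply: eq_integral => t _; rewrite IH; first by rewrite inv// mem_head.
by move=> w' z' t' w'in; apply: inv; rewrite inE w'in orbT.
Qed.

(* A Gaussian density at scale [s] tilts the standard normal law into a narrower one. *)
Lemma tilt (s a : R) (H : R -> \bar R) : 0 < s -> measurable_fun setT H -> (forall t, 0 <= H t)%E ->
  let k := Num.sqrt (1 + a ^+ 2 / s ^+ 2) in
  (\int[gam]_t ((normal_pdf 0 s (t * a))%:E * H t) =
   ((Num.sqrt (2 * pi) * s * k)^-1)%:E * \int[gam]_t H (k^-1 * t)%R)%E.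
Proof.
move=> s0 mH H0 k.
have k2 : k ^+ 2 = 1 + a ^+ 2 / s ^+ 2 by rewrite sqr_sqrtr// addr_ge0// divr_ge0// sqr_ge0.
have k0 : 0 < k by rewrite sqrtr_gt0 ltr_pwDl// divr_ge0// sqr_ge0.
have mpdf : measurable_fun setT (fun t : R => (normal_pdf 0 s (t * a))%:E).
  apply/measurable_EFinP; apply: (measurableT_comp (measurable_normal_pdf 0 s)).
  exact: measurable_funM.
have mg : measurable_fun setT (fun t : R => (gpdf t)%:E) by apply/measurable_EFinP; exact: measurable_gpdf.
have mHk : measurable_fun setT (fun t : R => H (k^-1 * t)).
  by apply: (measurableT_comp mH); exact: measurable_funM.
rewrite ge0_integral_gam; last 2 first.
- exact: emeasurable_funM.
- by move=> t; rewrite mule_ge0// lee_fin normal_pdf_ge0.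
rewrite ge0_integral_gam//.
pose K (t : R) := (((Num.sqrt (2 * pi) * s)^-1)%:E * (H (k^-1 * t)%R * (gpdf t)%:E))%E.
have C0 : 0 <= (Num.sqrt (2 * pi) * s)^-1 by rewrite invr_ge0 mulr_ge0// ltW.
have mK : measurable_fun setT K by apply: emeasurable_funM => //; exact: emeasurable_funM.
have K0 t : (0 <= K t)%E by rewrite !mule_ge0// lee_fin ?gpdf_ge0.
transitivity (\int[mu]_t K (k * t + 0)%R)%E.
  apply: eq_integral => t _; rewrite addr0 /K mulKf ?gt_eqF//.
  rewrite -!muleA [RHS]muleCA -!EFinM [LHS]muleCA -EFinM; congr (_ * _%:E)%E.
  rewrite normal_pdf_gpdf// /gpdf invfM.
  have -> : expR (- (k * t) ^+ 2 / 2) = expR (- (t * a / s) ^+ 2 / 2) * expR (- t ^+ 2 / 2).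
    by rewrite -expRD exprMn k2; congr expR; field; rewrite gt_eqF.
  by ring.
rewrite ge0_integral_affine ?gt_eqF// /K ge0_intZl//; last 2 first.
- exact: emeasurable_funM.
- by move=> t; rewrite mule_ge0// lee_fin gpdf_ge0.
rewrite muleA -EFinM gtr0_norm//; congr (_%:E * _)%E.
by rewrite [in RHS]invfM mulrC.
Qed.

(** The polar form of [u^2 - v^2]. *)
Let Bf e e' := u e * u e' - v e * v e'.

Let diagonalise e e' : exists w w',
  [/\ forall L, eqv2 [:: e, e' & L] [:: w, w' & L], Bf w w' = 0 &
   forall l1 l2, islin l1 -> islin l2 -> gram l1 l2 [:: w; w'] = gram l1 l2 [:: e; e']].
Proof.
pose A := Bf e e; pose D := Bf e' e'; pose B := Bf e e'.
have [c [s [cs dg]]] : exists c s : R, c ^+ 2 + s ^+ 2 = 1 /\ (c ^+ 2 - s ^+ 2) * B + c * s * (D - A) = 0.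
  have [B0|B0] := eqVneq B 0; first by exists 1, 0; rewrite B0; split; ring.
  pose q := Num.sqrt ((A - D) ^+ 2 + 4 * B ^+ 2).
  have q2 : q ^+ 2 = (A - D) ^+ 2 + 4 * B ^+ 2.
    by rewrite sqr_sqrtr// addr_ge0 ?sqr_ge0// mulr_ge0// sqr_ge0.
  (* The rotation is along [(B, m)], where [m] is a root of [m^2 - (D - A) m - B^2 = 0]; this
     equation says that the off-diagonal entry vanishes. *)
  pose m := (D - A + q) / 2.
  pose r := Num.sqrt (B ^+ 2 + m ^+ 2).
  have r20 : 0 < B ^+ 2 + m ^+ 2 by rewrite ltr_pwDl ?sqr_ge0// exprn_even_gt0.
  have r2 : r ^+ 2 = B ^+ 2 + m ^+ 2 by rewrite sqr_sqrtr// ltW.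
  have r0 : r != 0 by rewrite gt_eqF// sqrtr_gt0.
  exists (B / r), (m / r); split.
    by rewrite (expr_div_n B) (expr_div_n m) -mulrDl -r2 divff// expf_neq0.
  have key : B ^+ 2 - m ^+ 2 + m * (D - A) = 0.
    have -> : B ^+ 2 - m ^+ 2 + m * (D - A) = ((A - D) ^+ 2 + 4 * B ^+ 2 - q ^+ 2) / 4.
      by rewrite /m; field.
    by rewrite q2 subrr mul0r.
  transitivity ((B ^+ 2 - m ^+ 2 + m * (D - A)) * (B / r ^+ 2)); first by field.
  by rewrite key mul0r.
exists (c *: e + s *: e'), (c *: e' - s *: e); split.
- by move=> L; exact: eqv2_rot.
- rewrite -dg /A /D /B /Bf -scaleNr !(islin_comb lin_u) !(islin_comb lin_v).
  by ring.
- by move=> l1 l2 i1 i2; exact: gram_rot.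
Qed.

(* For [(H, z H_z, zbar H_zbar)] this is [|z|^2] times the absolute value of the Jacobian. *)
Definition absform (z : V) : R := `|u z.1 ^+ 2 + u z.2 ^+ 2 - v z.1 ^+ 2 - v z.2 ^+ 2|.

Let mg1 : measurable_fun setT (fun z : V => g z.1).
Proof. by do !apply: (measurableT_comp measurable_fst). Qed.
Let mg2 : measurable_fun setT (fun z : V => g z.2).
Proof. by do 2!apply: (measurableT_comp measurable_fst); exact: measurable_snd. Qed.
Let mu1 : measurable_fun setT (fun z : V => u z.1).
Proof. by apply: (measurableT_comp measurable_snd); apply: (measurableT_comp measurable_fst). Qed.
Let mu2 : measurable_fun setT (fun z : V => u z.2).
Proof. by apply: (measurableT_comp measurable_snd); apply: (measurableT_comp measurable_fst). Qed.
Let mv1 : measurable_fun setT (fun z : V => v z.1).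
Proof. by apply: (measurableT_comp measurable_snd). Qed.
Let mv2 : measurable_fun setT (fun z : V => v z.2).
Proof. by apply: (measurableT_comp measurable_snd). Qed.

Lemma measurable_form : measurable_fun setT absform.
Proof.
apply: (measurableT_comp (@normr_measurable R setT)).
apply: measurable_funB; last by apply: measurable_funX; exact: mv2.
apply: measurable_funB; last by apply: measurable_funX; exact: mv1.
by apply: measurable_funD; apply: measurable_funX; [exact: mu1|exact: mu2].
Qed.

Lemma nice_form : nice (fun z => (absform z)%:E).
Proof. by split; [apply/measurable_EFinP; exact: measurable_form|move=> z; rewrite lee_fin normr_ge0]. Qed.

Definition dens_form (s : R) (z : V) : R :=
  normal_pdf 0 s (g z.1) * normal_pdf 0 s (g z.2) * absform z.

Lemma nice_dens_form s : nice (fun z => (dens_form s z)%:E).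
Proof.
split=> [|z]; last by rewrite lee_fin mulr_ge0 ?normr_ge0// mulr_ge0 ?normal_pdf_ge0.
apply/measurable_EFinP; apply: measurable_funM; last exact: measurable_form.
by apply: measurable_funM; apply: (measurableT_comp (measurable_normal_pdf 0 s)); [exact: mg1|exact: mg2].
Qed.

Let form_shift (z : V) e (t : R) : u e = 0 -> v e = 0 ->
  absform (z + t *: re e) = absform z /\ absform (z + t *: im e) = absform z.
Proof.
move=> u0 v0; rewrite /absform /re /im /=; split; congr `|_ + _ - _ - _|; congr (_ ^+ 2).
- by rewrite /u/= -/(u e) -/(u z.1) /GRing.scale/= u0 mulr0 addr0.
- by rewrite scaler0 addr0.
- by rewrite /v/= -/(v e) -/(v z.1) /GRing.scale/= v0 mulr0 addr0.
- by rewrite scaler0 addr0.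
- by rewrite scaler0 addr0.
- by rewrite /u/= -/(u e) -/(u z.2) /GRing.scale/= u0 mulr0 addr0.
- by rewrite scaler0 addr0.
- by rewrite /v/= -/(v e) -/(v z.2) /GRing.scale/= v0 mulr0 addr0.
Qed.

Let Ex_two_vectors w w' : Bf w w' = 0 -> Bf w w * Bf w' w' < 0 ->
  Ex [:: re w; im w; re w'; im w'] (fun z => (absform z)%:E) 0 =
  (2 * (Bf w w ^+ 2 + Bf w' w' ^+ 2) / `|Bf w w - Bf w' w'|)%:E.
Proof.
move=> B0 Bneg; rewrite -(integral_abs_form Bneg).
apply: eq_integral => a _; apply: eq_integral => b _; apply: eq_integral => c _; apply: eq_integral => d _.
congr EFin; rewrite /absform; congr `|_|; rewrite /re /im /= /u /v /= /GRing.scale/=.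
move: B0; rewrite /Bf /u /v => B0.
transitivity ((w.1.2 * w.1.2 - w.2 * w.2) * (a ^+ 2 + b ^+ 2) +
  (w'.1.2 * w'.1.2 - w'.2 * w'.2) * (c ^+ 2 + d ^+ 2) +
  2 * (a * c + b * d) * (w.1.2 * w'.1.2 - w.2 * w'.2)); last by rewrite B0 mulr0 addr0.
by ring.
Qed.

(* Givens steps leave two vectors of [L] on which [u] or [v] does not vanish; a rotation
   diagonalising [u u' - v v'] on their span makes the form diagonal. *)
Let Ex_form L : 0 < gram u u L * gram v v L - gram u v L ^+ 2 ->
  let tau := gram u u L - gram v v L in
  let dlt := gram u u L * gram v v L - gram u v L ^+ 2 in
  Ex (map re L ++ map im L) (fun z => (absform z)%:E) 0 =
  (2 * (tau ^+ 2 + 2 * dlt) / Num.sqrt (tau ^+ 2 + 4 * dlt))%:E.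
Proof.
move=> d0 tau dlt.
(* [clear] needs a head vector; a zero vector changes neither the law nor the Gram entries. *)
have [q1 [L1 [E1 z1 G1]]] := clear2 0 L lin_u.
have [q2 [L2 [E2 z2 G2]]] := clear2 0 L1 lin_v.
have [w1 [w2 [E3 B0 G3]]] := diagonalise q1 q2.
have E : eqv2 L [:: w1, w2 & L2].
  apply: eqv2_trans (E3 L2); apply: eqv2_trans (eqv2_cons q1 E2).
  apply: (@eqv2_trans (q1 :: L1)).
    by apply: eqv2_trans E1; split; [exact: eqv_sym (eqv2_0 L).1|exact: eqv_sym (eqv2_0 L).2].
  by apply: eqv2_cons; split; [exact: eqv_sym (eqv2_0 L1).1|exact: eqv_sym (eqv2_0 L1).2].
have u1 : gram u u L1 = 0 by rewrite /gram big_seq big1// => e /z1 ->; rewrite mul0r.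
have u2 : gram u u (q2 :: L2) = 0 by rewrite G2// gram_cons u1 mul0r addr0.
have uL2 : {in L2, forall e, u e = 0}.
  by move=> e eL; apply: (gram0 u2); rewrite inE eL orbT.
have G l1 l2 : l1 = u \/ l1 = v -> l2 = u \/ l2 = v -> gram l1 l2 L = gram l1 l2 [:: w1; w2].
  move=> h1 h2.
  have i1 : islin l1 by case: h1 => ->.
  have i2 : islin l2 by case: h2 => ->.
  have L20 : gram l1 l2 L2 = 0.
    by rewrite /gram big_seq big1// => e eL; case: h1 => ->; rewrite ?uL2 ?z2// mul0r.
  have zl : l1 0 * l2 0 = 0 by case: h1 => ->; rewrite /u/v/= mul0r.
  have := G2 _ _ i1 i2; rewrite !gram_cons zl add0r => H2.
  have := G1 _ _ i1 i2; rewrite !gram_cons zl add0r -H2 => <-.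
  have nil0 : gram l1 l2 [::] = 0 by rewrite /gram big_nil.
  have := G3 _ _ i1 i2; rewrite !gram_cons nil0 => ->.
  by rewrite L20.
have [Guu Guv Gvv] : [/\ gram u u L = gram u u [:: w1; w2], gram u v L = gram u v [:: w1; w2] &
  gram v v L = gram v v [:: w1; w2]] by split; apply: G; tauto.
(* The form has determinant [- (u v' - u' v)^2 = - dlt] on the span. Together with the trace [tau]
   this determines the two diagonal coefficients, of opposite signs because [dlt > 0]. *)
have Bxy : Bf w1 w1 * Bf w2 w2 = - dlt.
  rewrite /dlt Guu Guv Gvv !gram_cons /gram !big_nil.
  move: B0; rewrite /Bf => B0.
  transitivity (- ((u w1 * u w1 + (u w2 * u w2 + 0)) * (v w1 * v w1 + (v w2 * v w2 + 0)) -
    (u w1 * v w1 + (u w2 * v w2 + 0)) ^+ 2) + (u w1 * u w2 - v w1 * v w2) ^+ 2); first by ring.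
  by rewrite B0 expr0n/= addr0.
have Bsum : Bf w1 w1 + Bf w2 w2 = tau.
  by rewrite /tau Guu Gvv !gram_cons /gram !big_nil /Bf; ring.
pose Fo z := (absform z)%:E : \bar R.
pose L4 := [:: re w1; im w1; re w2; im w2].
pose L' := map re [:: w1, w2 & L2] ++ map im [:: w1, w2 & L2].
pose rest := map re L2 ++ map im L2.
have P : perm_eq L' (L4 ++ rest).
  exact: (perm_pairs_cat re im [:: w1; w2] L2).
have Erest : Ex rest Fo = Fo.
  apply/funext => z; apply: Ex_inv; first exact: nice_form.
  move=> w z' t; rewrite mem_cat => /orP[] /mapP[e eL ->];
    by have [h1 h2] := @form_shift z' e t (uL2 _ eL) (z2 _ eL); rewrite /Fo ?h1 ?h2.
have -> : Ex (map re L ++ map im L) (fun z => (absform z)%:E) 0 = Ex L4 Fo 0.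
  transitivity (Ex L' Fo 0); first exact: (eqv_cat E.1 E.2 nice_form).
  transitivity (Ex (L4 ++ rest) Fo 0); first exact: (eqv_perm P nice_form).
  by transitivity (Ex L4 (Ex rest Fo) 0); [exact: Ex_cat|rewrite Erest].
rewrite (Ex_two_vectors B0); last by rewrite Bxy oppr_lt0.
congr EFin; congr (2 * _ / _).
  by rewrite -Bsum -[dlt]opprK -Bxy; ring.
rewrite (_ : tau ^+ 2 + 4 * dlt = (Bf w1 w1 - Bf w2 w2) ^+ 2) ?sqrtr_sqr//.
by rewrite -Bsum -[dlt]opprK -Bxy; ring.
Qed.

(** Elimination leaves a single vector [p] with a [g]-entry. By [tilt] the density divides [p] by
    [k], in the real and in the imaginary copy, where [k^2 = c / s^2]. The Gram entries become the
    Schur complements [Cuu], [Cuv], [Cvv], which are the covariances given a zero, and the prefactor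
    is [K^2 = (2 pi c)^-1]. *)
Lemma Ex_dens_form (s : R) L : 0 < s ->
  let c := s ^+ 2 + gram g g L in
  let Cuu := gram u u L - gram g u L ^+ 2 / c in
  let Cuv := gram u v L - gram g u L * gram g v L / c in
  let Cvv := gram v v L - gram g v L ^+ 2 / c in
  let tau := Cuu - Cvv in
  let dlt := Cuu * Cvv - Cuv ^+ 2 in
  0 < dlt ->
  Ex (map re L ++ map im L) (fun z => (dens_form s z)%:E) 0 =
  ((2 * pi * c)^-1 * (2 * (tau ^+ 2 + 2 * dlt) / Num.sqrt (tau ^+ 2 + 4 * dlt)))%:E.
Proof.
move=> s0 c Cuu Cuv Cvv tau dlt d0.
have [p [L1 [E1 z1 G1]]] := clear2 0 L lin_g.
have E : eqv2 L (p :: L1).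
  by apply: eqv2_trans E1; split; [exact: eqv_sym (eqv2_0 L).1|exact: eqv_sym (eqv2_0 L).2].
have GL l1 l2 : islin l1 -> islin l2 -> l1 0 = 0 -> gram l1 l2 L = l1 p * l2 p + gram l1 l2 L1.
  by move=> i1 i2 l10; have := G1 _ _ i1 i2; rewrite !gram_cons l10 mul0r add0r.
have g0 l : gram g l L1 = 0 by rewrite /gram big_seq big1// => e /z1 ->; rewrite mul0r.
have gg : gram g g L = g p ^+ 2 by rewrite GL// g0 addr0.
have gu : gram g u L = g p * u p by rewrite GL// g0 addr0.
have gv : gram g v L = g p * v p by rewrite GL// g0 addr0.
pose k := Num.sqrt (1 + g p ^+ 2 / s ^+ 2).
have k2 : k ^+ 2 = c / s ^+ 2.
  rewrite sqr_sqrtr; last by rewrite addr_ge0// divr_ge0// sqr_ge0.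
  by rewrite /c gg; field; rewrite gt_eqF.
have c0 : 0 < c by rewrite /c gg ltr_pwDl ?exprn_gt0// sqr_ge0.
have k0 : 0 < k by rewrite sqrtr_gt0 ltr_pwDl// divr_ge0// sqr_ge0.
pose K := (Num.sqrt (2 * pi) * s * k)^-1.
have K0 : 0 <= K by rewrite invr_ge0 !mulr_ge0// ltW.
pose rest := map re L1 ++ map im L1.
pose h := Ex rest (fun z => (absform z)%:E).
have nh : nice h by exact: nice_Ex nice_form.
pose p' := k^-1 *: p.
have step : Ex (map re L ++ map im L) (fun z => (dens_form s z)%:E) 0 =
   ((K ^+ 2)%:E * Ex (map re (p' :: L1) ++ map im (p' :: L1)) (fun z => (absform z)%:E) 0%R)%E.
  pose Fd z := (dens_form s z)%:E : \bar R.
  pose Fo z := (absform z)%:E : \bar R.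
  have P e : perm_eq (map re (e :: L1) ++ map im (e :: L1)) ([:: re e; im e] ++ rest).
    exact: (perm_pairs_cat re im [:: e] L1).
  have E4 : Ex (map re L ++ map im L) Fd 0 = Ex [:: re p; im p] (Ex rest Fd) 0.
    transitivity (Ex (map re (p :: L1) ++ map im (p :: L1)) Fd 0).
      exact: (eqv_cat E.1 E.2 (nice_dens_form s)).
    transitivity (Ex ([:: re p; im p] ++ rest) Fd 0); first exact: (eqv_perm (P p) (nice_dens_form s)).
    exact: Ex_cat.
  have E5 : Ex (map re (p' :: L1) ++ map im (p' :: L1)) Fo 0 = Ex [:: re p'; im p'] h 0.
    transitivity (Ex ([:: re p'; im p'] ++ rest) Fo 0); first exact: (eqv_perm (P p') nice_form).
    exact: Ex_cat.
  rewrite -/Fd -/Fo E4 E5.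
  pose pg z := normal_pdf 0 s (g z.1) * normal_pdf 0 s (g z.2).
  have Ef z : Ex rest (fun z => (dens_form s z)%:E) z = ((pg z)%:E * h z)%E.
    rewrite -Ex_factor//; first exact: nice_form.
      by move=> z'; rewrite mulr_ge0 ?normal_pdf_ge0.
    move=> w z' t; rewrite mem_cat => /orP[] /mapP[e eL ->]; rewrite /pg /re /im/=.
      rewrite scaler0 addr0; congr (normal_pdf 0 s _ * _).
      by rewrite /g/= /GRing.scale/= -/(g e) z1// mulr0 addr0.
    rewrite scaler0 addr0; congr (_ * normal_pdf 0 s _).
    by rewrite /g/= /GRing.scale/= -/(g e) z1// mulr0 addr0.
  transitivity (\int[gam]_t ((normal_pdf 0 s (t * g p))%:E *
     \int[gam]_t' ((normal_pdf 0 s (t' * g p))%:E * h (0 + t *: re p + t' *: im p)%R)))%E.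
    apply: eq_integral => t _; rewrite -ge0_intZl ?normal_pdf_ge0//; last 2 first.
    - apply: emeasurable_funM; last exact: nice_section.
      apply/measurable_EFinP; apply: (measurableT_comp (measurable_normal_pdf 0 s)).
      exact: measurable_funM.
    - by move=> t'; rewrite mule_ge0 ?lee_fin ?normal_pdf_ge0//; exact: nh.2.
    apply: eq_integral => t' _; rewrite Ef muleA -EFinM; congr ((normal_pdf 0 s _ * normal_pdf 0 s _)%:E * _)%E.
      by rewrite /g/= /GRing.scale/= mulr0 addr0 add0r.
    by rewrite /g/= /GRing.scale/= mulr0 !add0r.
  have T1 t : (\int[gam]_t' ((normal_pdf 0 s (t' * g p))%:E * h (0 + t *: re p + t' *: im p)%R) =
      K%:E * \int[gam]_t' h (0 + t *: re p + t' *: im p')%R)%E.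
    rewrite (tilt (g p) (H := fun t' => h (0 + t *: re p + t' *: im p)) s0); last 2 first.
    - exact: nice_section.
    - by move=> t'; exact: nh.2.
    congr (_ * _)%E; apply: eq_integral => t' _; congr h; congr (_ + _).
    rewrite -/k /p' /im; apply: injective_projections => /=; first by rewrite !scaler0.
    by rewrite scalerA mulrC.
  under eq_integral do rewrite T1.
  pose H1 t := (\int[gam]_t' h (0 + t *: re p + t' *: im p')%R)%E.
  have nH1 : measurable_fun setT H1.
    exact: (nice_section 0 (re p) (nice_Ex [:: im p'] nh)).
  have H10 t : (0 <= H1 t)%E by apply: integral_ge0 => t' _; exact: nh.2.
  transitivity (K%:E * \int[gam]_t ((normal_pdf 0 s (t * g p))%:E * H1 t))%E.
    rewrite -(ge0_intZl gam K0); last 2 first.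
    - apply: emeasurable_funM; last exact: nH1.
      apply/measurable_EFinP.
      by apply: (measurableT_comp (measurable_normal_pdf 0 s)); exact: measurable_funM.
    - by move=> t; rewrite mule_ge0// lee_fin normal_pdf_ge0.
    by apply: eq_integral => t _; rewrite muleCA.
  transitivity (K%:E * (K%:E * \int[gam]_t H1 (k^-1 * t)%R))%E.
    by congr (_ * _)%E; exact: (tilt (g p) s0 nH1 H10).
  have -> : Ex [:: re p'; im p'] h 0 = (\int[gam]_t H1 (k^-1 * t)%R)%E.
    apply: eq_integral => t _; apply: eq_integral => t' _; congr (h (_ + _ + _)).
    rewrite /p' /re; apply: injective_projections => /=; last by rewrite !scaler0.
    by rewrite scalerA mulrC.
  by rewrite expr2 EFinM muleA.
have Gp l1 l2 : islin l1 -> islin l2 -> l1 0 = 0 -> l2 0 = 0 ->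
    gram l1 l2 (p' :: L1) = gram l1 l2 L - (1 - k ^- 2) * (l1 p * l2 p).
  move=> i1 i2 z10 z20; rewrite gram_cons GL//.
  have lZ l : islin l -> l 0 = 0 -> l p' = k^-1 * l p by move=> i z0; rewrite /p' -[_ *: _]addr0 i z0 addr0.
  by rewrite !lZ// -exprVn; ring.
have km l1 l2 : gram l1 l2 L - (1 - k ^- 2) * (l1 p * l2 p) = gram l1 l2 L - (g p * l1 p) * (g p * l2 p) / c.
  congr (_ - _); rewrite k2 invf_div.
  have -> : 1 - s ^+ 2 / c = g p ^+ 2 / c by rewrite /c gg; field; rewrite gt_eqF// -gg.
  by ring.
have Euu : gram u u (p' :: L1) = Cuu by rewrite Gp// km /Cuu gu; ring.
have Euv : gram u v (p' :: L1) = Cuv by rewrite Gp// km /Cuv gu gv; ring.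
have Evv : gram v v (p' :: L1) = Cvv by rewrite Gp// km /Cvv gv; ring.
rewrite step Ex_form; last by rewrite Euu Euv Evv.
rewrite Euu Euv Evv -EFinM; congr EFin; congr (_ * _).
rewrite /K exprVn !exprMn k2 sqr_sqrtr; last by rewrite mulr_ge0// pi_ge0.
by congr (_^-1); field; rewrite gt_eqF.
Qed.

End Reduction.

(** * Harmonic polynomials *)

Section SdiffCalculus.
Context {R : realType}.
Implicit Types (f k : R * R -> R) (z : R * R).

Let lin_bound (p q : R) z : `|p * z.1 + q * z.2| <= (`|p| + `|q|) * `|z|.
Proof.
rewrite (le_trans (ler_normD _ _))// !normrM mulrDl; apply: lerD; apply: ler_wpM2l => //.
  exact: norm_fst_le.
exact: norm_snd_le.
Qed.

Lemma sdiff_lip f p q z0 : sdiff f p q z0 -> exists2 dl, 0 < dl &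
  forall z z', `|z - z0| < dl -> `|z' - z0| < dl -> `|f z - f z'| <= (`|p| + `|q| + 1) * `|z - z'|.
Proof.
move=> /(_ 1 ltr01)[dl dl0 h]; exists dl => // z z' zd zd'.
have := h z z' zd zd'; have := lin_bound p q (z - z').
set E := _ * _ + _ * _ => hE hf.
rewrite (_ : f z - f z' = (f z - f z' - E) + E); last by rewrite subrK.
by rewrite (le_trans (ler_normD _ _))// mulrDl addrC; exact: lerD.
Qed.

Lemma sdiff_continuous f p q z0 : sdiff f p q z0 -> {for z0, continuous f}.
Proof.
move=> /sdiff_lip[dl dl0 h]; apply/cvgrPdist_lt => e e0.
set K := `|p| + `|q| + 1 in h.
have K0 : 0 < K by rewrite ltr_wpDl// addr_ge0.
have m0 : 0 < Num.min dl (e / K) by rewrite lt_min dl0 divr_gt0.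
apply: (@filterS _ (nbhs z0) _ (ball z0 (Num.min dl (e / K)))); last exact: nbhsx_ballx.
move=> z; rewrite ball_prod_normE /ball_/= lt_min => /andP[zd ze].
have zd0 : `|z0 - z0| < dl by rewrite subrr normr0.
have zd' : `|z - z0| < dl by rewrite distrC.
by rewrite (le_lt_trans (h _ _ zd0 zd'))// mulrC -ltr_pdivlMr.
Qed.

Lemma sdiff_cst (c : R) z0 : sdiff (fun=> c) 0 0 z0.
Proof.
move=> e e0; exists 1 => // z z' _ _.
by rewrite subrr !mul0r addr0 subr0 normr0 mulr_ge0// ltW.
Qed.

Lemma sdiff_fst z0 : sdiff (fun z => z.1) 1 0 z0.
Proof.
move=> e e0; exists 1 => // z z' _ _.
by rewrite mul1r mul0r addr0 subrr normr0 mulr_ge0// ltW.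
Qed.

Lemma sdiff_snd z0 : sdiff (fun z => z.2) 0 1 z0.
Proof.
move=> e e0; exists 1 => // z z' _ _.
by rewrite mul1r mul0r add0r subrr normr0 mulr_ge0// ltW.
Qed.

Lemma sdiff_eq f k p q p' q' z0 : f =1 k -> p = p' -> q = q' -> sdiff f p q z0 -> sdiff k p' q' z0.
Proof. by move=> fk <- <- h e /h[dl dl0 H]; exists dl => // z z' zd zd'; rewrite -!fk; exact: H. Qed.

Lemma sdiffD f k p q p' q' z0 : sdiff f p q z0 -> sdiff k p' q' z0 ->
  sdiff (fun z => f z + k z) (p + p') (q + q') z0.
Proof.
move=> hf hk e e0; have e20 : 0 < e / 2 by rewrite divr_gt0.
have [d1 d10 h1] := hf _ e20; have [d2 d20 h2] := hk _ e20.
exists (Num.min d1 d2) => [|z z']; first by rewrite lt_min d10.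
rewrite !lt_min => /andP[za zb] /andP[za' zb'].
rewrite (_ : _ - _ = (f z - f z' - (p * (z.1 - z'.1) + q * (z.2 - z'.2))) +
  (k z - k z' - (p' * (z.1 - z'.1) + q' * (z.2 - z'.2)))); last by ring.
rewrite (le_trans (ler_normD _ _))//.
have -> : e * `|z - z'| = e / 2 * `|z - z'| + e / 2 * `|z - z'| by field.
by apply: lerD; [exact: h1|exact: h2].
Qed.

Lemma sdiffM f k p q p' q' z0 : sdiff f p q z0 -> sdiff k p' q' z0 ->
  sdiff (fun z => f z * k z) (p * k z0 + f z0 * p') (q * k z0 + f z0 * q') z0.
Proof.
move=> hf hk e e0.
have cf := sdiff_continuous hf; have ck := sdiff_continuous hk.
pose K := (`|f z0| + 1) + (`|k z0| + 1) + (`|p| + `|q|) + (`|p'| + `|q'|).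
have K0 : 0 < K by rewrite /K; have := normr_ge0 (f z0); have := normr_ge0 (k z0);
  have := normr_ge0 p; have := normr_ge0 q; have := normr_ge0 p'; have := normr_ge0 q'; lra.
pose s := Num.min 1 (e / K).
have s0 : 0 < s by rewrite lt_min divr_gt0// ltr01.
have s1 : s <= 1 by rewrite ge_min lexx.
have sK : s * K <= e by rewrite -ler_pdivlMr// ge_min lexx orbT.
have [d1 d10 h1] := hf _ s0; have [d2 d20 h2] := hk _ s0.
have [d3 d30 h3] := continuous_ball cf s0; have [d4 d40 h4] := continuous_ball ck s0.
exists (Num.min (Num.min d1 d2) (Num.min d3 d4)) => [|z z']; first by rewrite !lt_min d10 d20 d30.
rewrite !lt_min => /andP[/andP[za zb] /andP[zc zd]] /andP[/andP[za' zb'] /andP[zc' zd']].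
have := h1 _ _ za za'; set Ef := _ - (_ + _); move=> hEf.
have := h2 _ _ zb zb'; set Ek := _ - (_ + _); move=> hEk.
set D := p * (z.1 - z'.1) + q * (z.2 - z'.2) in Ef hEf.
set D' := p' * (z.1 - z'.1) + q' * (z.2 - z'.2) in Ek hEk.
have hD : `|D| <= (`|p| + `|q|) * `|z - z'| by exact: (lin_bound p q (z - z')).
have hD' : `|D'| <= (`|p'| + `|q'|) * `|z - z'| by exact: (lin_bound p' q' (z - z')).
(* Each of the four terms is a factor bounded near [z0] times a quantity at most [s], relative to
   [|z - z'|]; [K] adds up the four bounds. *)
rewrite (_ : _ - _ = f z * Ek + k z' * Ef + (f z - f z0) * D' + (k z' - k z0) * D); last first.
  by rewrite /Ef /Ek /D /D'; ring.
have fz : `|f z| <= `|f z0| + 1.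
  have := ler_normD (f z - f z0) (f z0); rewrite subrK.
  by have := h3 _ zc; clear - s1; lra.
have kz : `|k z'| <= `|k z0| + 1.
  have := ler_normD (k z' - k z0) (k z0); rewrite subrK.
  by have := h4 _ zd'; clear - s1; lra.
have nz : 0 <= `|z - z'| by [].
apply: (@le_trans _ _ (s * K * `|z - z'|)); last by rewrite ler_wpM2r.
have -> : s * K * `|z - z'| = (`|f z0| + 1) * (s * `|z - z'|) + (`|k z0| + 1) * (s * `|z - z'|) +
  s * ((`|p'| + `|q'|) * `|z - z'|) + s * ((`|p| + `|q|) * `|z - z'|) by rewrite /K; ring.
apply: le_trans (ler_normD _ _) _; apply: lerD;
  [apply: le_trans (ler_normD _ _) _; apply: lerD;
    [apply: le_trans (ler_normD _ _) _; apply: lerD|]|]; rewrite normrM; apply: ler_pM => //.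
- exact/ltW/h3.
- exact/ltW/h4.
Qed.

Lemma sdiffZ f (c p q : R) z0 : sdiff f p q z0 -> sdiff (fun z => c * f z) (c * p) (c * q) z0.
Proof.
move=> h; apply: (sdiff_eq _ _ _ (sdiffM (sdiff_cst c z0) h)) => //; rewrite mul0r add0r//.
Qed.

Lemma sdiff_sum (T : Type) (s : seq T) (F : T -> R * R -> R) (p q : T -> R) z0 :
  (forall i, sdiff (F i) (p i) (q i) z0) ->
  sdiff (fun z => \sum_(i <- s) F i z) (\sum_(i <- s) p i) (\sum_(i <- s) q i) z0.
Proof.
move=> h; elim: s => [|i s IH].
  by apply: (sdiff_eq _ _ _ (sdiff_cst 0 z0)) => [z| |]; rewrite big_nil.
by apply: (sdiff_eq _ _ _ (sdiffD (h i) IH)) => [z| |]; rewrite big_cons.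
Qed.

End SdiffCalculus.

Section Regular.
Context {R : realType}.
Implicit Types f k : R * R -> R.

Definition regular f := continuous f /\ measurable_fun setT f.

Lemma regular_cst (c : R) : regular (fun=> c).
Proof. by split=> [z|]; [exact: cvg_cst|exact: measurable_cst]. Qed.

Lemma regular_fst : regular fst. Proof. by split; [exact: continuous_fst|exact: measurable_fst]. Qed.

Lemma regular_snd : regular snd. Proof. by split; [exact: continuous_snd|exact: measurable_snd]. Qed.

Lemma regularD f k : regular f -> regular k -> regular (fun z => f z + k z).
Proof.
by move=> [cf mf] [ck mk]; split=> [z|]; [apply: cvgD; [exact: cf|exact: ck]|exact: measurable_funD].
Qed.

Lemma regularM f k : regular f -> regular k -> regular (fun z => f z * k z).
Proof.
by move=> [cf mf] [ck mk]; split=> [z|]; [apply: cvgM; [exact: cf|exact: ck]|exact: measurable_funM].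
Qed.

Lemma regularN f : regular f -> regular (fun z => - f z).
Proof.
by move=> [cf mf]; split=> [z|]; [apply: cvgN; exact: cf|exact: (measurableT_comp _ mf)].
Qed.

Lemma regular_sum (T : Type) (s : seq T) (F : T -> R * R -> R) : (forall i, regular (F i)) ->
  regular (fun z => \sum_(i <- s) F i z).
Proof.
move=> rF; elim: s => [|i s IH]; first by under eq_fun do rewrite big_nil; exact: regular_cst.
by under eq_fun do rewrite big_cons; exact: regularD.
Qed.

End Regular.

Section ComplexPowers.
Context {R : realType}.
Implicit Types z : R * R.

(* Real and imaginary parts of [(x + i y) ^ j]. *)
Fixpoint pw (j : nat) z : R * R :=
  if j is j'.+1 then (z.1 * (pw j' z).1 - z.2 * (pw j' z).2, z.1 * (pw j' z).2 + z.2 * (pw j' z).1)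
  else (1, 0).

Lemma pwE j z : ((z.1 +i* z.2) ^+ j = (pw j z).1 +i* (pw j z).2)%C.
Proof. by elim: j => [//|j IH]; rewrite exprS IH. Qed.

Lemma pw_sqr j z : (pw j z).1 ^+ 2 + (pw j z).2 ^+ 2 = (z.1 ^+ 2 + z.2 ^+ 2) ^+ j.
Proof.
elim: j => [|j IH] /=; first by rewrite expr1n expr0n/= addr0.
by rewrite [RHS]exprS -IH; ring.
Qed.

Lemma sdiff_pw j z0 :
  sdiff (fun z => (pw j z).1) (j%:R * (pw j.-1 z0).1) (- (j%:R * (pw j.-1 z0).2)) z0 /\
  sdiff (fun z => (pw j z).2) (j%:R * (pw j.-1 z0).2) (j%:R * (pw j.-1 z0).1) z0.
Proof.
elim: j => [|j [IH1 IH2]].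
  by split; [apply: (sdiff_eq _ _ _ (sdiff_cst 1 z0))|apply: (sdiff_eq _ _ _ (sdiff_cst 0 z0))];
    rewrite ?mul0r ?oppr0.
have x1 := sdiff_fst z0; have y1 := sdiff_snd z0.
(* The truncated predecessor at [j = 0] is harmless since its factor [j%:R] vanishes. *)
have key : j%:R * (pw j z0).1 = j%:R * (z0.1 * (pw j.-1 z0).1 - z0.2 * (pw j.-1 z0).2) /\
  j%:R * (pw j z0).2 = j%:R * (z0.1 * (pw j.-1 z0).2 + z0.2 * (pw j.-1 z0).1).
  by case: j {IH1 IH2} => [|j]; rewrite ?mulr0n ?mul0r.
have [k1 k2] := key.
split.
  have := sdiffD (sdiffM x1 IH1) (sdiffZ (-1) (sdiffM y1 IH2)).
  apply: sdiff_eq => [z||] /=; rewrite -?natr1 ?mulrDl ?k1 ?k2; ring.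
have := sdiffD (sdiffM x1 IH2) (sdiffM y1 IH1).
by apply: sdiff_eq => [z||] /=; rewrite -?natr1 ?mulrDl ?k1 ?k2; ring.
Qed.

Lemma regular_pw j : regular (fun z => (pw j z).1) /\ regular (fun z => (pw j z).2).
Proof.
have x := @regular_fst R; have y := @regular_snd R.
elim: j => [|j [r1 r2]]; first by split; exact: regular_cst.
by split; apply: regularD; try apply: regularN; exact: regularM.
Qed.

End ComplexPowers.

Section HarmonicPolynomial.
Context {R : realType} (n m : nat).
Local Notation I := (('I_n.+1 * bool) + ('I_m.+1 * bool))%type.
Local Notation V := ((R * R * R) * (R * R * R))%type.
Implicit Types (z : R * R) (i : I) (c : I -> R).

Definition dpw (j : nat) z : R * R := (j%:R * (pw j.-1 z).1, j%:R * (pw j.-1 z).2).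

Lemma pw_dpw j z :
  j%:R * (pw j z).1 = z.1 * (dpw j z).1 - z.2 * (dpw j z).2 /\
  j%:R * (pw j z).2 = z.1 * (dpw j z).2 + z.2 * (dpw j z).1.
Proof. by case: j => [|j]; rewrite /dpw /= ?mul0r ?mulr0 ?subrr ?addr0//; split; ring. Qed.

(* The polynomial is affine in its coefficients; [gv i] is the (complex) coefficient
   of the [i]-th real variable in [H], and [pv i], [qv i] those in the Wirtinger
   derivatives [H_z] and [H_zbar]. *)
Definition gv i z : R * R :=
  match i with
  | inl (j, false) => ((pw j z).1, (pw j z).2)
  | inl (j, true) => (- (pw j z).2, (pw j z).1)
  | inr (j, false) => ((pw j z).1, - (pw j z).2)
  | inr (j, true) => ((pw j z).2, (pw j z).1)
  end.

Definition pv i z : R * R :=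
  match i with
  | inl (j, false) => ((dpw j z).1, (dpw j z).2)
  | inl (j, true) => (- (dpw j z).2, (dpw j z).1)
  | inr _ => (0, 0)
  end.

Definition qv i z : R * R :=
  match i with
  | inl _ => (0, 0)
  | inr (j, false) => ((dpw j z).1, - (dpw j z).2)
  | inr (j, true) => ((dpw j z).2, (dpw j z).1)
  end.

(* Real and imaginary parts of the contributions to [(H, z H_z, zbar H_zbar)]; the factors
   [z] and [zbar] make the three entries multiples of one power of [z] or [zbar]. *)
Definition vec z i : V :=
  (((gv i z).1, z.1 * (pv i z).1 - z.2 * (pv i z).2, z.1 * (qv i z).1 + z.2 * (qv i z).2),
   ((gv i z).2, z.1 * (pv i z).2 + z.2 * (pv i z).1, z.1 * (qv i z).2 - z.2 * (qv i z).1)).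

Definition ia j b : I := inl (inord j, b).
Definition ib j b : I := inr (inord j, b).

(** The two variables of [A_0] are left out: they are integrated first, through the area formula. *)
Definition tail_idx : seq I :=
  flatten [seq [:: ia j false; ia j true] | j <- iota 1 n] ++
  flatten [seq [:: ib j false; ib j true] | j <- iota 0 m.+1].

Definition lc c (f : I -> R) : R := \sum_(i <- tail_idx) c i * f i.

Lemma lcE c f : lc c f =
  \sum_(1 <= j < n.+1) (c (ia j false) * f (ia j false) + c (ia j true) * f (ia j true)) +
  \sum_(0 <= j < m.+1) (c (ib j false) * f (ib j false) + c (ib j true) * f (ib j true)).
Proof.
rewrite /lc /tail_idx big_cat !big_flatten !big_map /index_iota subSS !subn0.
by congr (_ + _); apply: eq_bigr => j _; rewrite !big_cons big_nil /= addr0.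
Qed.

Lemma lc_comb c (x y : R) f h k : (forall i, f i = x * h i + y * k i) ->
  lc c f = x * lc c h + y * lc c k.
Proof.
move=> E; rewrite /lc !mulr_sumr -big_split; apply: eq_bigr => i _.
by rewrite E /=; ring.
Qed.

Lemma comb_vec c z : \sum_(i <- tail_idx) c i *: vec z i =
  ((lc c (fun i => (vec z i).1.1.1), lc c (fun i => (vec z i).1.1.2), lc c (fun i => (vec z i).1.2)),
   (lc c (fun i => (vec z i).2.1.1), lc c (fun i => (vec z i).2.1.2), lc c (fun i => (vec z i).2.2))).
Proof.
rewrite /lc; elim: tail_idx => [|i l IH]; first by rewrite !big_nil.
by rewrite !big_cons IH.
Qed.

(** The polynomial without its term [A_0]. *)
Definition Gp c z : R * R := (lc c (fun i => (gv i z).1), lc c (fun i => (gv i z).2)).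

Definition Hp c z : R * R := (c (ia 0 false) + (Gp c z).1, c (ia 0 true) + (Gp c z).2).

Lemma complex_sum (T : Type) (s : seq T) (f h : T -> R) :
  (\sum_(i <- s) (f i +i* h i)%C = (\sum_(i <- s) f i) +i* (\sum_(i <- s) h i))%C.
Proof. by elim: s => [|i s IH]; rewrite ?big_nil// !big_cons IH. Qed.

Lemma mul_complex (x y x' y' : R) :
  ((x +i* y) * (x' +i* y') = (x * x' - y * y') +i* (x * y' + y * x'))%C.
Proof. by []. Qed.

Lemma add_complex (x y x' y' : R) : ((x +i* y) + (x' +i* y') = (x + x') +i* (y + y'))%C.
Proof. by []. Qed.

Lemma harm_polyE c (A B : nat -> R[i]) z :
  (forall j, (j <= n)%N -> A j = (c (ia j false) +i* c (ia j true))%C) ->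
  (forall j, (j <= m)%N -> B j = (c (ib j false) +i* c (ib j true))%C) ->
  harm_poly n m A B (z.1 +i* z.2)%C = ((Hp c z).1 +i* (Hp c z).2)%C.
Proof.
move=> hA hB; rewrite /harm_poly.
have -> : \sum_(j < n.+1) A j * (z.1 +i* z.2)%C ^+ j =
  \sum_(0 <= j < n.+1) ((c (ia j false) * (gv (ia j false) z).1 + c (ia j true) * (gv (ia j true) z).1)
     +i* (c (ia j false) * (gv (ia j false) z).2 + c (ia j true) * (gv (ia j true) z).2))%C.
  rewrite big_mkord; apply: eq_bigr => j _; rewrite pwE hA -1?ltnS; last exact: ltn_ord.
  rewrite mul_complex /ia /gv inordK; last exact: ltn_ord.
  by congr (_ +i* _)%C; rewrite /fst /snd; ring.
have -> : \sum_(j < m.+1) B j * ((z.1 +i* z.2)^*)%C ^+ j =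
  \sum_(0 <= j < m.+1) ((c (ib j false) * (gv (ib j false) z).1 + c (ib j true) * (gv (ib j true) z).1)
     +i* (c (ib j false) * (gv (ib j false) z).2 + c (ib j true) * (gv (ib j true) z).2))%C.
  rewrite big_mkord; apply: eq_bigr => j _; rewrite -rmorphXn pwE hB -1?ltnS; last exact: ltn_ord.
  rewrite [X in _ * X](_ : _ = ((pw j z).1 +i* - (pw j z).2)%C)//.
  rewrite mul_complex /ib /gv inordK; last exact: ltn_ord.
  by congr (_ +i* _)%C; rewrite /fst /snd; ring.
rewrite !complex_sum add_complex /Hp /Gp !lcE /fst /snd.
by congr (_ +i* _)%C; rewrite big_ltn// /ia /gv inordK// /pw /fst /snd; ring.
Qed.

(** Real partial derivatives from Wirtinger ones: [f_x = f_z + f_zbar] and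
    [f_y = i (f_z - f_zbar)]. *)
Lemma sdiff_gv i z0 :
  sdiff (fun z => (gv i z).1) ((pv i z0).1 + (qv i z0).1) ((qv i z0).2 - (pv i z0).2) z0 /\
  sdiff (fun z => (gv i z).2) ((pv i z0).2 + (qv i z0).2) ((pv i z0).1 - (qv i z0).1) z0.
Proof.
case: i => [[j b]|[j b]]; have [s1 s2] := sdiff_pw j z0;
  have n2 := sdiffZ (-1) s2; case: b => /=; split.
- by refine (sdiff_eq _ _ _ n2) => [z||]; rewrite /dpw /=; ring.
- by refine (sdiff_eq _ _ _ s1) => [z||]; rewrite /dpw /=; ring.
- by refine (sdiff_eq _ _ _ s1) => [z||]; rewrite /dpw /=; ring.
- by refine (sdiff_eq _ _ _ s2) => [z||]; rewrite /dpw /=; ring.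
- by refine (sdiff_eq _ _ _ s2) => [z||]; rewrite /dpw /=; ring.
- by refine (sdiff_eq _ _ _ s1) => [z||]; rewrite /dpw /=; ring.
- by refine (sdiff_eq _ _ _ s1) => [z||]; rewrite /dpw /=; ring.
- by refine (sdiff_eq _ _ _ n2) => [z||]; rewrite /dpw /=; ring.
Qed.

Local Notation P1 c z := (lc c (fun i => (pv i z).1)).
Local Notation P2 c z := (lc c (fun i => (pv i z).2)).
Local Notation Q1 c z := (lc c (fun i => (qv i z).1)).
Local Notation Q2 c z := (lc c (fun i => (qv i z).2)).

Lemma sdiff_Gp c z0 :
  sdiff (fun z => (Gp c z).1) (P1 c z0 + Q1 c z0) (Q2 c z0 - P2 c z0) z0 /\
  sdiff (fun z => (Gp c z).2) (P2 c z0 + Q2 c z0) (P1 c z0 - Q1 c z0) z0.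
Proof.
have lcB f h : lc c f - lc c h = lc c (fun i => f i - h i).
  by rewrite [RHS](@lc_comb c 1 (-1) _ f h) => [|i] /=; ring.
have lcD f h : lc c f + lc c h = lc c (fun i => f i + h i).
  by rewrite [RHS](@lc_comb c 1 1 _ f h) => [|i] /=; ring.
split; rewrite lcB lcD; apply: sdiff_sum => i; apply: sdiffZ; have [s1 s2] := sdiff_gv i z0.
  exact: s1.
exact: s2.
Qed.

Definition Jp c z : R := P1 c z ^+ 2 + P2 c z ^+ 2 - Q1 c z ^+ 2 - Q2 c z ^+ 2.

Lemma JpE c z : (P1 c z + Q1 c z) * (P1 c z - Q1 c z) - (Q2 c z - P2 c z) * (P2 c z + Q2 c z) = Jp c z.
Proof. by rewrite /Jp; ring. Qed.

Lemma Jp_form c z :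
  let w := \sum_(i <- tail_idx) c i *: vec z i in
  w.1.1.2 ^+ 2 + w.2.1.2 ^+ 2 - w.1.2 ^+ 2 - w.2.2 ^+ 2 = (z.1 ^+ 2 + z.2 ^+ 2) * Jp c z.
Proof.
rewrite comb_vec /=.
have -> : lc c (fun i => z.1 * (pv i z).1 - z.2 * (pv i z).2) = z.1 * P1 c z - z.2 * P2 c z.
  by rewrite -mulNr; apply: lc_comb => i; rewrite mulNr.
have -> : lc c (fun i => z.1 * (pv i z).2 + z.2 * (pv i z).1) = z.1 * P2 c z + z.2 * P1 c z.
  exact: lc_comb.
have -> : lc c (fun i => z.1 * (qv i z).1 + z.2 * (qv i z).2) = z.1 * Q1 c z + z.2 * Q2 c z.
  exact: lc_comb.
have -> : lc c (fun i => z.1 * (qv i z).2 - z.2 * (qv i z).1) = z.1 * Q2 c z - z.2 * Q1 c z.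
  by rewrite -mulNr; apply: lc_comb => i; rewrite mulNr.
by rewrite /Jp; ring.
Qed.

Lemma regular_lc c (f : I -> R * R -> R) : (forall i, regular (f i)) ->
  regular (fun z => lc c (fun i => f i z)).
Proof. by move=> rf; apply: regular_sum => i; apply: regularM => //; exact: regular_cst. Qed.

Lemma regular_dpw j : regular (fun z => (dpw j z).1) /\ regular (fun z => (dpw j z).2).
Proof.
by have [r1 r2] := @regular_pw R j.-1; split; apply: regularM => //; exact: regular_cst.
Qed.

Lemma regular_gv i : regular (fun z => (gv i z).1) /\ regular (fun z => (gv i z).2).
Proof.
by case: i => [[j []]|[j []]]; have [r1 r2] := @regular_pw R j; split => //=; exact: regularN.
Qed.

Lemma regular_pv i : regular (fun z => (pv i z).1) /\ regular (fun z => (pv i z).2).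
Proof.
by case: i => [[j []]|[j []]]; have [r1 r2] := regular_dpw j; split => //=;
  by [exact: regular_cst|exact: regularN].
Qed.

Lemma regular_qv i : regular (fun z => (qv i z).1) /\ regular (fun z => (qv i z).2).
Proof.
by case: i => [[j []]|[j []]]; have [r1 r2] := regular_dpw j; split => //=;
  by [exact: regular_cst|exact: regularN].
Qed.

Lemma regular_Gp c : regular (fun z => (Gp c z).1) /\ regular (fun z => (Gp c z).2).
Proof. by split; apply: regular_lc => i; have [] := regular_gv i. Qed.

Lemma regular_Jp c : regular (Jp c).
Proof.
have sq f : regular f -> regular (fun z => f z ^+ 2) by move=> rf; exact: regularM.
by apply: regularD; [apply: regularD; [apply: regularD|]|]; try apply: regularN;
  apply: sq; apply: regular_lc => i; have [] := regular_pv i; have [] := regular_qv i.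
Qed.

Lemma continuous_Gp c : continuous (Gp c).
Proof. by have [[c1 _] [c2 _]] := regular_Gp c; exact: continuous_pair. Qed.

Lemma measurable_Gp c : measurable_fun setT (Gp c).
Proof. by have [[_ m1] [_ m2]] := regular_Gp c; exact: measurable_fun_pair. Qed.

Let regular_Hp c : regular (fun z => (Hp c z).1) /\ regular (fun z => (Hp c z).2).
Proof.
by have [r1 r2] := regular_Gp c; split; apply: regularD => //; exact: regular_cst.
Qed.

Lemma continuous_Hp c : continuous (Hp c).
Proof. by have [[c1 _] [c2 _]] := regular_Hp c; exact: continuous_pair. Qed.

Lemma measurable_Hp c : measurable_fun setT (Hp c).
Proof. by have [[_ m1] [_ m2]] := regular_Hp c; exact: measurable_fun_pair. Qed.

Lemma measurable_lc_coef f : measurable_fun setT (fun c : @cspace R I => lc c f).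
Proof.
apply: measurable_sum => i; apply: measurable_funM; last exact: measurable_cst.
exact: measurable_coord.
Qed.

Lemma measurable_Hp_coef z : measurable_fun setT (fun c : @cspace R I => Hp c z).
Proof.
by apply: measurable_fun_pair; apply: measurable_funD; by [exact: measurable_coord|
  exact: measurable_lc_coef].
Qed.

(** Joint measurability, needed to exchange the expectation with the integral over [z]. *)
Lemma measurable_lc_joint (f : I -> R * R -> R) : (forall i, measurable_fun setT (f i)) ->
  measurable_fun setT (fun x : @cspace R I * (R * R) => lc x.1 (fun i => f i x.2)).
Proof.
move=> mf; apply: measurable_sum => i; apply: measurable_funM.
  exact: (measurableT_comp (measurable_coord i) measurable_fst).
exact: (measurableT_comp (mf i) measurable_snd).
Qed.

Lemma measurable_Gp_joint : measurable_fun setT (fun x : @cspace R I * (R * R) => Gp x.1 x.2).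
Proof.
apply: measurable_fun_pair.
  exact: (measurable_lc_joint (f := fun i z => (gv i z).1) (fun i => proj2 (proj1 (regular_gv i)))).
exact: (measurable_lc_joint (f := fun i z => (gv i z).2) (fun i => proj2 (proj2 (regular_gv i)))).
Qed.

Lemma measurable_Jp_joint : measurable_fun setT (fun x : @cspace R I * (R * R) => Jp x.1 x.2).
Proof.
apply: measurable_funB; [apply: measurable_funB; [apply: measurable_funD|]|];
  apply: measurable_funX.
- exact: (measurable_lc_joint (f := fun i z => (pv i z).1) (fun i => proj2 (proj1 (regular_pv i)))).
- exact: (measurable_lc_joint (f := fun i z => (pv i z).2) (fun i => proj2 (proj2 (regular_pv i)))).
- exact: (measurable_lc_joint (f := fun i z => (qv i z).1) (fun i => proj2 (proj1 (regular_qv i)))).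
- exact: (measurable_lc_joint (f := fun i z => (qv i z).2) (fun i => proj2 (proj2 (regular_qv i)))).
Qed.

Lemma uniq_pairs (T : eqType) (f : nat -> bool -> T) (s : seq nat) : uniq s ->
  {in s &, forall j k b b', f j b = f k b' -> j = k /\ b = b'} ->
  uniq (flatten [seq [:: f j false; f j true] | j <- s]).
Proof.
elim: s => //= j s IH /andP[js us] inj.
have jf b b' k : k \in s -> f j b != f k b'.
  move=> ks; apply/eqP => /inj; rewrite !inE eqxx ks orbT => -[]// E; by rewrite E ks in js.
have nf b : f j b \notin flatten [seq [:: f k false; f k true] | k <- s].
  apply/negP => /flattenP[_ /mapP[k ks ->]]; rewrite !inE => /orP[] /eqP; apply/eqP; exact: jf.
rewrite inE negb_or !nf IH//= ?andbT.
  by apply/eqP => /inj; rewrite !inE eqxx => -[].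
by move=> k l ks ls; apply: inj; rewrite !inE ?ks ?ls orbT.
Qed.

Lemma uniq_tail_idx : uniq tail_idx.
Proof.
rewrite cat_uniq; apply/and3P; split.
- apply: uniq_pairs; first exact: iota_uniq.
  move=> j k; rewrite !mem_iota => /andP[_ hj] /andP[_ hk].
  by move=> b b' [] /(congr1 val); rewrite /= !inordK// => -> ->.
- apply/hasPn => x /flattenP[_ /mapP[k ks ->]]; rewrite !inE => /orP[] /eqP -> ;
  apply/negP => /flattenP[_ /mapP[l ls ->]]; by rewrite !inE.
- apply: uniq_pairs; first exact: iota_uniq.
  move=> j k; rewrite !mem_iota => /andP[_ hj] /andP[_ hk].
  by move=> b b' [] /(congr1 val); rewrite /= !inordK// => -> ->.
Qed.

Lemma ia0_tail b : ia 0 b \notin tail_idx.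
Proof.
rewrite mem_cat negb_or; apply/andP; split; apply/negP => /flattenP[_ /mapP[k ks ->]].
  move: ks; rewrite mem_iota !inE => /andP[k0 kn] /orP[] /eqP[] /(congr1 val) /=;
  by rewrite !inordK// => E; rewrite -E in k0.
by rewrite !inE.
Qed.

Lemma lc_upd c b t f : lc (upd c (ia 0 b) t) f = lc c f.
Proof.
rewrite /lc !big_seq; apply: eq_bigr => i il; rewrite /upd; case: eqP => // E.
by have := ia0_tail b; rewrite -E il.
Qed.

Lemma Hp_upd c s t z :
  Hp (upd (upd c (ia 0 false) s) (ia 0 true) t) z = (s + (Gp c z).1, t + (Gp c z).2).
Proof.
by rewrite /Hp /Gp !lc_upd /upd !eqxx /=; case: eqP => // -[].
Qed.

End HarmonicPolynomial.

(** * The density of zeros *)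

Section Phases.
Context {R : realType}.
Local Notation V3 := (R * R * R)%type.
Local Notation V := (V3 * V3)%type.

(* A circularly symmetric Gaussian absorbs the phase of its complex coefficient. *)
Lemma eqv_phase (x y r : R) (e : V3) : 0 < r -> x ^+ 2 + y ^+ 2 = r ^+ 2 ->
  eqv [:: (x *: e, y *: e) : V; (- y *: e, x *: e)] [:: re (r *: e); im (r *: e)].
Proof.
move=> r0 E; have rn : r != 0 by rewrite gt_eqF.
have cs : (x / r) ^+ 2 + (- (y / r)) ^+ 2 = 1.
  by rewrite sqrrN !expr_div_n -mulrDl E divff// expf_neq0.
have r1 : x / r * x + y / r * y = r.
  by rewrite (_ : _ + _ = (x ^+ 2 + y ^+ 2) / r); [rewrite E expr2 mulfK|ring].
have := eqv_rot (x *: e, y *: e) (- y *: e, x *: e) [::] cs.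
set w1 := _ + _; set w2 := _ - _.
have -> : w1 = re (r *: e).
  rewrite /w1 /re -[in RHS]r1; apply: injective_projections => /=; rewrite !scalerA -scalerDl.
    by congr (_ *: _); ring.
  by rewrite (_ : _ + _ = 0) ?scale0r//; ring.
have -> // : w2 = im (r *: e).
rewrite /w2 /im -[in RHS]r1; apply: injective_projections => /=; rewrite !scalerA -scalerBl.
  by rewrite (_ : _ - _ = 0) ?scale0r//; ring.
by congr (_ *: _); ring.
Qed.

Lemma eqv_phaseZ (s x y r : R) (e : V3) : 0 < s -> 0 < r -> x ^+ 2 + y ^+ 2 = r ^+ 2 ->
  eqv [:: s *: (x *: e, y *: e) : V; s *: (- y *: e, x *: e)] [:: re ((s * r) *: e); im ((s * r) *: e)].
Proof.
move=> s0 r0 E.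
have -> : s *: ((x *: e, y *: e) : V) = ((s * x) *: e, (s * y) *: e).
  by apply: injective_projections; rewrite /= scalerA.
have -> : s *: ((- y *: e, x *: e) : V) = (- (s * y) *: e, (s * x) *: e).
  by apply: injective_projections; rewrite /= scalerA ?mulrN.
by apply: eqv_phase; [exact: mulr_gt0|rewrite !exprMn -mulrDr E].
Qed.

End Phases.

Section DensityAlgebra.
Context {R : realType}.

(** A variance: [s0 (s0 s2 - s1^2)] is the sum of the [w j (j s0 - s1)^2]. *)
Lemma sum_cauchy (r : seq nat) (w : nat -> R) : {in r, forall j, 0 <= w j} ->
  0 < \sum_(j <- r) w j ->
  (\sum_(j <- r) j%:R * w j) ^+ 2 <= (\sum_(j <- r) w j) * \sum_(j <- r) j%:R ^+ 2 * w j.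
Proof.
move=> w0; set s0 := \sum_(j <- r) w j; set s1 := \sum_(j <- r) _; set s2 := \sum_(j <- r) _ => p0.
rewrite -subr_ge0 -(pmulr_rge0 _ p0).
have -> : s0 * (s0 * s2 - s1 ^+ 2) = \sum_(j <- r) w j * (j%:R * s0 - s1) ^+ 2.
  rewrite (eq_bigr (fun j => s0 ^+ 2 * (j%:R ^+ 2 * w j) - 2 * s0 * s1 * (j%:R * w j) + s1 ^+ 2 * w j)).
    by rewrite !big_split/= sumrN -!mulr_sumr -/s0 -/s1 -/s2; ring.
  by move=> j _; ring.
by rewrite big_seq sumr_ge0// => j jr; rewrite mulr_ge0 ?w0// sqr_ge0.
Qed.

(* [Sk], [Tk] stand for [s_k], [t_k]; [dlt] is the determinant of the conditional covariance
   of the real parts of the derivatives given the value, [(r1 r2 - r12^2) / (4 r3^2)]. *)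
Lemma density_value (p rho a0 b0 S0 S1 S2 T0 T1 T2 : R) :
  0 < p -> 0 < rho -> 0 < a0 -> 0 < b0 -> 0 < S2 -> 0 < T2 ->
  S1 ^+ 2 <= S0 * S2 -> T1 ^+ 2 <= T0 * T2 -> 0 <= S0 -> 0 <= T0 ->
  let r3 := a0 + S0 + (b0 + T0) in
  let r12 := S1 * T1 in let r1 := r3 * S2 - S1 ^+ 2 in let r2 := r3 * T2 - T1 ^+ 2 in
  let c := r3 / 2 in
  let tau := (S2 / 2 - (S1 / 2) ^+ 2 / c) - (T2 / 2 - (T1 / 2) ^+ 2 / c) in
  let dlt := (S2 / 2 - (S1 / 2) ^+ 2 / c) * (T2 / 2 - (T1 / 2) ^+ 2 / c) -
    (0 - S1 / 2 * (T1 / 2) / c) ^+ 2 in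
  0 < dlt /\
  (2 * p * c)^-1 * (2 * (tau ^+ 2 + 2 * dlt) / Num.sqrt (tau ^+ 2 + 4 * dlt)) =
  rho * (p^-1 * (rho^-1 * ((r1 ^+ 2 + r2 ^+ 2 - 2 * r12 ^+ 2)
     / (r3 ^+ 2 * Num.sqrt ((r1 + r2) ^+ 2 - 4 * r12 ^+ 2))))).
Proof.
move=> p0 h0 ha hb hs ht cs ct s00 t00 r3 r12 r1 r2 c tau dlt.
have r30 : 0 < r3 by rewrite /r3; lra.
have r3n : r3 != 0 by rewrite gt_eqF.
have pn : p != 0 by rewrite gt_eqF.
have hn : rho != 0 by rewrite gt_eqF.
have Edlt : dlt = (r1 * r2 - r12 ^+ 2) / (4 * r3 ^+ 2).
  by rewrite /dlt /r1 /r2 /r12 /c; field.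
have d0 : 0 < r1 * r2 - r12 ^+ 2.
  (* Strictness comes from the constant coefficients [a0], [b0]; the remaining terms are the two
     Cauchy-Schwarz defects. *)
  have -> : r1 * r2 - r12 ^+ 2 = r3 * ((a0 + b0) * (S2 * T2) +
      (S2 * (T0 * T2 - T1 ^+ 2) + T2 * (S0 * S2 - S1 ^+ 2))) by rewrite /r1 /r2 /r12 /r3; ring.
  rewrite mulr_gt0// ltr_pwDl ?mulr_gt0 ?addr_gt0//.
  by rewrite addr_ge0// mulr_ge0 ?subr_ge0// ltW.
have dlt0 : 0 < dlt by rewrite Edlt divr_gt0// mulr_gt0// exprn_gt0.
split => //.
have Es : Num.sqrt (tau ^+ 2 + 4 * dlt) = Num.sqrt ((r1 + r2) ^+ 2 - 4 * r12 ^+ 2) / (2 * r3).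
  have -> : tau ^+ 2 + 4 * dlt = ((r1 + r2) ^+ 2 - 4 * r12 ^+ 2) * (2 * r3)^-1 ^+ 2.
    by rewrite Edlt /tau /r1 /r2 /r12 /c; field.
  rewrite mulrC sqrtrM ?sqr_ge0// sqrtr_sqr ger0_norm 1?mulrC//.
  by rewrite invr_ge0 mulr_ge0// ltW.
have D0 : 0 < (r1 + r2) ^+ 2 - 4 * r12 ^+ 2.
  have -> : (r1 + r2) ^+ 2 - 4 * r12 ^+ 2 = (r1 - r2) ^+ 2 + 4 * (r1 * r2 - r12 ^+ 2) by ring.
  by rewrite ltr_wpDl ?sqr_ge0// mulr_gt0.
have Et : tau ^+ 2 + 2 * dlt = (r1 ^+ 2 + r2 ^+ 2 - 2 * r12 ^+ 2) / (4 * r3 ^+ 2).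
  by rewrite Edlt /tau /r1 /r2 /r12 /c; field.
rewrite Es Et /c; move: D0; rewrite -sqrtr_gt0.
move: (Num.sqrt _) (r1 ^+ 2 + r2 ^+ 2 - 2 * r12 ^+ 2) => q N q0.
have qn : q != 0 by rewrite gt_eqF.
clear Es Et dlt0 d0 Edlt tau dlt c r1 r2 r12; clearbody r3.
by field; rewrite ?r3n ?qn ?pn ?hn.
Qed.

End DensityAlgebra.

Section Density.
Context {R : realType} (n m : nat) (alpha beta : nat -> R).
Hypotheses (m1 : (1 <= m)%N) (mn : (m <= n)%N)
  (a0 : forall j, (j <= n)%N -> 0 < alpha j) (b0 : forall j, (j <= m)%N -> 0 < beta j).
Local Notation I := (('I_n.+1 * bool) + ('I_m.+1 * bool))%type.
Local Notation V3 := (R * R * R)%type.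
Local Notation V := (V3 * V3)%type.

Definition sd (i : I) : R :=
  match i with inl (j, _) => Num.sqrt (alpha j / 2) | inr (j, _) => Num.sqrt (beta j / 2) end.

Lemma sd_gt0 i : 0 < sd i.
Proof.
by case: i => [[j b]|[j b]] /=; rewrite sqrtr_gt0 divr_gt0// ?a0 ?b0// -ltnS.
Qed.

Variable z : R * R.
Local Notation rho := (z.1 ^+ 2 + z.2 ^+ 2).
Hypothesis rho0 : 0 < rho.

(** [z^j] contributes [z^j (1, j, 0)] to [(H, z H_z, zbar H_zbar)] and [zbar^j] contributes
    [zbar^j (1, 0, j)]; once the phase is absorbed only [|z|^j] remains. *)
Definition vA j : V3 := (Num.sqrt (alpha j / 2) * Num.sqrt (rho ^+ j)) *: (1, j%:R, 0).
Definition vB j : V3 := (Num.sqrt (beta j / 2) * Num.sqrt (rho ^+ j)) *: (1, 0, j%:R).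

Let scale3 (k x y t : R) : k *: ((x, y, t) : V3) = (k * x, k * y, k * t). Proof. by []. Qed.

Lemma vec_A j : (j <= n)%N ->
  vec z (ia n m j false) = ((pw j z).1 *: (1, j%:R, 0) : V3, (pw j z).2 *: (1, j%:R, 0) : V3) /\
  vec z (ia n m j true) = (- (pw j z).2 *: (1, j%:R, 0) : V3, (pw j z).1 *: (1, j%:R, 0) : V3).
Proof.
move=> jn; have [E1 E2] := pw_dpw j z.
rewrite /vec /gv /pv /qv /ia inordK// !scale3.
move: (dpw j z) (pw j z) (j%:R : R) E1 E2 => [x y] [x' y'] k /= E1 E2.
by split; congr (_, _, _, (_, _, _)); first [ring|lra].
Qed.

Lemma vec_B j : (j <= m)%N ->
  vec z (ib n m j false) = ((pw j z).1 *: (1, 0, j%:R) : V3, - (pw j z).2 *: (1, 0, j%:R) : V3) /\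
  vec z (ib n m j true) = ((pw j z).2 *: (1, 0, j%:R) : V3, (pw j z).1 *: (1, 0, j%:R) : V3).
Proof.
move=> jn; have [E1 E2] := pw_dpw j z.
rewrite /vec /gv /pv /qv /ib inordK// !scale3.
move: (dpw j z) (pw j z) (j%:R : R) E1 E2 => [x y] [x' y'] k /= E1 E2.
by split; congr (_, _, _, (_, _, _)); first [ring|lra].
Qed.

Lemma sdA j b : (j <= n)%N -> sd (ia n m j b) = Num.sqrt (alpha j / 2).
Proof. by move=> jn; rewrite /sd /ia inordK. Qed.

Lemma sdB j b : (j <= m)%N -> sd (ib n m j b) = Num.sqrt (beta j / 2).
Proof. by move=> jn; rewrite /sd /ib inordK. Qed.

Let radius j : 0 < Num.sqrt (rho ^+ j) /\ (pw j z).1 ^+ 2 + (pw j z).2 ^+ 2 = Num.sqrt (rho ^+ j) ^+ 2.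
Proof.
have r0 : 0 < rho ^+ j by rewrite exprn_gt0.
by split; [rewrite sqrtr_gt0|rewrite pw_sqr sqr_sqrtr// ltW].
Qed.

Lemma eqv_A j : (j <= n)%N ->
  eqv [:: sd (ia n m j false) *: vec z (ia n m j false); sd (ia n m j true) *: vec z (ia n m j true)]
    [:: re (vA j); im (vA j)].
Proof.
move=> jn; have [-> ->] := vec_A jn.
have s0 : 0 < Num.sqrt (alpha j / 2) by rewrite sqrtr_gt0 divr_gt0// a0.
have [r0 rE] := radius j.
by rewrite (sdA false jn) (sdA true jn); exact: eqv_phaseZ.
Qed.

Lemma eqv_B j : (j <= m)%N ->
  eqv [:: sd (ib n m j false) *: vec z (ib n m j false); sd (ib n m j true) *: vec z (ib n m j true)]
    [:: re (vB j); im (vB j)].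
Proof.
move=> jn; have [-> ->] := vec_B jn.
have s0 : 0 < Num.sqrt (beta j / 2) by rewrite sqrtr_gt0 divr_gt0// b0.
have [r0 rE] := radius j.
rewrite (sdB false jn) (sdB true jn) -{2}[(pw j z).2]opprK.
by apply: eqv_phaseZ => //; rewrite sqrrN.
Qed.

Definition Lz : seq V3 := map vA (iota 1 n) ++ map vB (iota 0 m.+1).

Lemma eqv_Lz : eqv [seq sd i *: vec z i | i <- tail_idx n m] (map re Lz ++ map im Lz).
Proof.
apply: eqv_trans (eqv_perm (perm_pairs re im Lz)).
have memB j : j \in iota 0 m.+1 -> (j <= m)%N by rewrite mem_iota.
rewrite /tail_idx /Lz; move: (iota 0 m.+1) memB => l memB.
rewrite !map_cat flatten_cat -!map_comp !map_flatten -!map_comp.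
apply: eqv_cat; apply: eqv_map_pair => j; last by move=> /memB; exact: eqv_B.
by rewrite mem_iota => /andP[_ hj]; exact: eqv_A.
Qed.

Local Notation S k := (\sum_(1 <= j < n.+1) (j%:R ^+ k * alpha j * rho ^+ j)).
Local Notation T k := (\sum_(1 <= j < m.+1) (j%:R ^+ k * beta j * rho ^+ j)).

Let wsq (a : R) j : 0 < a -> (Num.sqrt (a / 2) * Num.sqrt (rho ^+ j)) ^+ 2 = 2^-1 * (a * rho ^+ j).
Proof.
move=> a1; rewrite exprMn !sqr_sqrtr ?exprn_ge0 ?divr_ge0 ?ltW//.
by rewrite mulrA [a / 2]mulrC.
Qed.

Lemma gram_Lz (l1 l2 : V3 -> R) :
  islin l1 -> islin l2 -> l1 0 = 0 -> l2 0 = 0 ->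
  gram l1 l2 Lz = 2^-1 * (\sum_(1 <= j < n.+1) (l1 (1, j%:R, 0) * l2 (1, j%:R, 0) * (alpha j * rho ^+ j)) +
    \sum_(0 <= j < m.+1) (l1 (1, 0, j%:R) * l2 (1, 0, j%:R) * (beta j * rho ^+ j))).
Proof.
move=> i1 i2 z1 z2; rewrite /gram /Lz big_cat !big_map /index_iota subSS !subn0 mulrDr !mulr_sumr.
have lZ (l : V3 -> R) (k : R) e : islin l -> l 0 = 0 -> l (k *: e) = k * l e.
  by move=> il l0; rewrite -[k *: e]addr0 il l0 addr0.
congr (_ + _); rewrite !big_seq; apply: eq_bigr => j; rewrite mem_iota => /andP[_ hj].
  rewrite /vA (lZ _ _ _ i1 z1) (lZ _ _ _ i2 z2) mulrACA -expr2 (wsq _ (a0 _))//.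
  by ring.
rewrite /vB (lZ _ _ _ i1 z1) (lZ _ _ _ i2 z2) mulrACA -expr2 (wsq _ (b0 _))//.
by ring.
Qed.

(** The Gram entries of [Lz] are half of the sums [s_k] and [t_k], and the variance of [A_0]
    completes the first one to [r3 / 2]. The mixed entry of [u] and [v] is 0 because no coefficient
    enters both derivatives. *)
Lemma Ex_dens_zero :
  Ex [seq sd i *: vec z i | i <- tail_idx n m]
    (fun w => (dens_form (Num.sqrt (alpha 0%N / 2)) w)%:E) 0 =
  (rho * (pi^-1 * zero_density n m alpha beta z.1 z.2))%:E.
Proof.
have aa0 : 0 < alpha 0%N by apply: a0.
have bb0 : 0 < beta 0%N by apply: b0.
have s0 : 0 < Num.sqrt (alpha 0%N / 2) by rewrite sqrtr_gt0 divr_gt0.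
rewrite (eqv_Lz (nice_dens_form _) 0).
have SE (f : nat -> R) k : (forall j, f j = j%:R ^+ k) ->
    \sum_(1 <= j < n.+1) f j * (alpha j * rho ^+ j) = S k.
  by move=> fE; apply: eq_bigr => j _; rewrite fE mulrA.
(* The list [Lz] contains [B_0] whereas [t_k] starts at [j = 1], so the term of index 0 is split
   off. *)
have TE (f : nat -> R) k : (forall j, (0 < j)%N -> f j = j%:R ^+ k) ->
    \sum_(0 <= j < m.+1) f j * (beta j * rho ^+ j) = f 0%N * beta 0%N + T k.
  move=> fE; rewrite big_ltn// expr0 mulr1; congr (_ + _).
  by apply: eq_big_nat => j /andP[j0 _]; rewrite fE// mulrA.
have S0 : \sum_(0 <= j < n.+1) (alpha j * rho ^+ j) = alpha 0%N + S 0.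
  by rewrite big_ltn// expr0 mulr1; congr (_ + _); apply: eq_bigr => j _; rewrite expr0 mul1r.
have T0 : \sum_(0 <= j < m.+1) (beta j * rho ^+ j) = beta 0%N + T 0.
  by rewrite big_ltn// expr0 mulr1; congr (_ + _); apply: eq_bigr => j _; rewrite expr0 mul1r.
have wA j : (j <= n)%N -> 0 < alpha j * rho ^+ j by move=> jn; rewrite mulr_gt0 ?a0// exprn_gt0.
have wB j : (j <= m)%N -> 0 < beta j * rho ^+ j by move=> jm; rewrite mulr_gt0 ?b0// exprn_gt0.
(* The term [j = 1] is positive, which is where degrees at least 1 are needed. *)
have pos (w : nat -> R) N k : (1 <= N)%N -> (forall j, (j <= N)%N -> 0 < w j * rho ^+ j) ->
    0 < \sum_(1 <= j < N.+1) (j%:R ^+ k * w j * rho ^+ j).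
  move=> N1 w0; rewrite big_ltn// ltr_wpDr//.
    rewrite big_nat sumr_ge0// => j /andP[_ jN].
    by rewrite -mulrA mulr_ge0 ?exprn_ge0// ltW// w0.
  by rewrite expr1n mul1r w0.
have cs (w : nat -> R) N : (1 <= N)%N -> (forall j, (j <= N)%N -> 0 < w j * rho ^+ j) ->
    let U k := \sum_(1 <= j < N.+1) (j%:R ^+ k * w j * rho ^+ j) in
    (U 1%N ^+ 2 <= U 0%N * U 2%N) = true.
  move=> N1 w0 U; have := @sum_cauchy R (index_iota 1 N.+1) (fun j => w j * rho ^+ j).
  have -> : \sum_(1 <= j < N.+1) w j * rho ^+ j = U 0%N.
    by apply: eq_bigr => j _; rewrite expr0 mul1r.
  have -> : \sum_(1 <= j < N.+1) j%:R * (w j * rho ^+ j) = U 1%N.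
    by apply: eq_bigr => j _; rewrite expr1 mulrA.
  have -> : \sum_(1 <= j < N.+1) j%:R ^+ 2 * (w j * rho ^+ j) = U 2%N.
    by apply: eq_bigr => j _; rewrite mulrA.
  apply; last exact: pos.
  by move=> j; rewrite mem_index_iota => /andP[_ jN]; rewrite ltW// w0.
have n1 : (1 <= n)%N := leq_trans m1 mn.
pose g := fun e : V3 => e.1.1; pose u := fun e : V3 => e.1.2; pose v := fun e : V3 => e.2.
have lg : islin g by []. have lu : islin u by []. have lv : islin v by [].
have gg : Num.sqrt (alpha 0%N / 2) ^+ 2 + gram g g Lz = (alpha 0%N + S 0 + (beta 0%N + T 0)) / 2.
  rewrite gram_Lz// /g /fst /snd (SE (fun=> 1 * 1) 0%N) => [|j]; last by rewrite expr0 mulr1.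
  rewrite (TE (fun=> 1 * 1) 0%N) => [|j _]; last by rewrite expr0 mulr1.
  by rewrite sqr_sqrtr ?divr_ge0 ?ltW//; ring.
have gu : gram g u Lz = S 1 / 2.
  rewrite gram_Lz// /g /u /fst /snd (SE (fun j => 1 * j%:R) 1%N) => [|j]; last by rewrite mul1r.
  by rewrite [X in _ + X]big1 => [|j _]; ring.
have gv : gram g v Lz = T 1 / 2.
  rewrite gram_Lz// /g /v /fst /snd (TE (fun j => 1 * j%:R) 1%N) => [|j _]; last by rewrite mul1r.
  by rewrite [X in X + _]big1 => [|j _]; ring.
have uu : gram u u Lz = S 2 / 2.
  rewrite gram_Lz// /u /fst /snd (SE (fun j => j%:R * j%:R) 2%N) => [|j]; last by rewrite expr2.
  by rewrite [X in _ + X]big1 => [|j _]; ring.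
have uv : gram u v Lz = 0.
  rewrite gram_Lz// /u /v /fst /snd [X in _ + X]big1 => [|j _]; last by ring.
  by rewrite big1 => [|j _]; ring.
have vv : gram v v Lz = T 2 / 2.
  rewrite gram_Lz// /v /fst /snd (TE (fun j => j%:R * j%:R) 2%N) => [|j _]; last by rewrite expr2.
  by rewrite [X in X + _]big1 => [|j _]; ring.
have [d0 E] := density_value (pi_gt0 R) rho0 aa0 bb0 (pos _ _ 2%N n1 wA) (pos _ _ 2%N m1 wB)
  (cs _ _ n1 wA) (cs _ _ m1 wB) (ltW (pos _ _ 0%N n1 wA)) (ltW (pos _ _ 0%N m1 wB)).
have := @Ex_dens_form R _ Lz s0; rewrite -/g -/u -/v gg gu gv uu uv vv => /(_ d0) ->.
by rewrite E /zero_density S0 T0.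
Qed.

End Density.

Section Square.
Context {R : realType} (n m : nat).
Local Notation I := (('I_n.+1 * bool) + ('I_m.+1 * bool))%type.
Local Notation mu := (@lebesgue_measure R).
Local Notation mu2 := (mu \x mu)%E.
Local Notation Hp := (@Hp R n m).
Local Notation Gp := (@Gp R n m).
Local Notation Jp := (@Jp R n m).
Local Notation ia := (ia n m).

Definition zeros_in (D : set (R * R)) (c : I -> R) : \bar R :=
  @counting _ R ([set z | Hp c z = 0] `&` D).

Lemma measurable_zeros_sq p h : 0 <= h ->
  measurable_fun setT (zeros_in (sq p h) : @cspace R I -> \bar R).
Proof.
move=> h0; apply: (@measurable_counting R _ (@cspace R I) Hp) => //.
- by move=> z; exact: measurable_Hp_coef.
- by move=> c; exact: continuous_Hp.
- by move=> c; exact: measurable_Hp.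
Qed.

Lemma normal_pdfN (s x : R) : 0 < s -> normal_pdf 0 s (- x) = normal_pdf 0 s x.
Proof. by move=> s0; rewrite !normal_pdf_gpdf// /gpdf [(- x) / s]mulNr sqrrN. Qed.

Lemma counting_ge0 (T : choiceType) (A : set T) : (0 <= @counting T R A)%E.
Proof. by rewrite /counting; case: ifP. Qed.

(** The zeros of [H] form the fibre of [G] over [- A_0]; the reflection [w -> - w] preserves the
    density of [A_0], and the area formula applies with that density as weight. *)
Lemma area_density (s : R) (c : I -> R) p h : 0 < s -> 0 < h ->
  (\int[normal_prob 0 s]_r \int[normal_prob 0 s]_t
     zeros_in (sq p h) (upd (upd c (ia 0 false) r) (ia 0 true) t) =
   \int[mu2]_(z in sq p h)
     (normal_pdf 0 s (Gp c z).1 * normal_pdf 0 s (Gp c z).2 * `|Jp c z|)%:E)%E.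
Proof.
move=> s0 h0; have sn : s != 0 by rewrite gt_eqF.
pose g (w : R * R) := normal_pdf 0 s w.1 * normal_pdf 0 s w.2.
pose ct w := @counting _ R ([set z | Gp c z = w] `&` sq p h).
have mct : measurable_fun setT ct.
  exact: (measurable_counting_fiber (@continuous_Gp R n m c) (@measurable_Gp R n m c) p (ltW h0)).
have mg : measurable_fun setT g.
  by apply: measurable_funM; apply: (measurableT_comp (measurable_normal_pdf _ _)).
have g0 w : 0 <= g w by rewrite mulr_ge0// normal_pdf_ge0.
have cg : continuous g.
  move=> w; apply: cvgM.
    by apply: (continuous_comp (@cvg_fst _ _ _ _ _) _); apply: continuous_normal_pdf.
  by apply: (continuous_comp (@cvg_snd _ _ _ _ _) _); apply: continuous_normal_pdf.
pose f (w : R * R) : \bar R := (ct w * (g w)%:E)%E.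
have mf : measurable_fun setT f by apply: emeasurable_funM => //; exact/measurable_EFinP.
have f0 w : (0 <= f w)%E by rewrite mule_ge0 ?counting_ge0// lee_fin.
transitivity (\int[mu]_r \int[mu]_t f (- 1 * r + 0 * t, 0 * r + - 1 * t)%R)%E.
  pose K (r t : R) := ct (- r, - t).
  have mK : measurable_fun setT (fun w : R * R => K w.1 w.2).
    by apply: (measurableT_comp mct (g := fun w : R * R => (- w.1, - w.2)));
      apply: measurable_fun_pair; exact: measurableT_comp.
  have K0 r t : (0 <= K r t)%E by exact: counting_ge0.
  have mKr r : measurable_fun setT (K r) by exact: (measurable_section2 r mK).
  transitivity (\int[normal_prob 0 s]_r \int[normal_prob 0 s]_t K r t)%E.
    apply: eq_integral => r _; apply: eq_integral => t _.
    rewrite /zeros_in /K /ct; congr (@counting _ R (_ `&` _)).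
    apply/seteqP; split => z; rewrite /mkset Hp_upd => E; last by rewrite E /= !subrr.
    apply: injective_projections; apply/esym; apply: addr0_eq.
      exact: (congr1 fst E).
    exact: (congr1 snd E).
  rewrite ge0_integral_normal; last 2 first.
  - exact: (@measurable_int2 _ _ _ _ _ (normal_prob 0 s) K).
  - by move=> r; exact: integral_ge0.
  apply: eq_integral => r _; rewrite ge0_integral_normal// -ge0_integralZr//; last 3 first.
  - apply: emeasurable_funM; first exact: mKr.
    by apply/measurable_EFinP; exact: measurable_normal_pdf.
  - by move=> t _; rewrite mule_ge0// lee_fin normal_pdf_ge0.
  - by rewrite lee_fin normal_pdf_ge0.
  apply: eq_integral => t _; rewrite /f /g /K /= !mul0r !mulN1r addr0 add0r !normal_pdfN//.
  by rewrite -muleA -EFinM [(normal_pdf 0 s t * _)%R]mulrC.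
have det : - 1 * - 1 - 0 * 0 = 1 :> R by ring.
rewrite ge0_integral_linear2 ?det ?oner_eq0// normr1 invr1 mul1e.
rewrite -(@tonelli_prod _ _ _ _ _ mu mu (fun x y => f (x, y))); last 2 first.
- by move: mf; congr (measurable_fun _ _); apply/funext => -[].
- by move=> x y; exact: f0.
transitivity (\int[mu2]_w f w)%E; first by apply: eq_integral => -[x y] _.
rewrite /f /ct.
have S z := @sdiff_Gp R n m c z.
pose L f : R := @lc R n m c f.
have JE : (fun z => (L (fun i => (pv i z).1) + L (fun i => (qv i z).1)) *
    (L (fun i => (pv i z).1) - L (fun i => (qv i z).1)) -
    (L (fun i => (qv i z).2) - L (fun i => (pv i z).2)) *
    (L (fun i => (pv i z).2) + L (fun i => (qv i z).2))) = Jp c.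
  by apply/funext => z; exact: JpE.
have [cJ mJ] := @regular_Jp R n m c.
rewrite -JE in cJ mJ.
have := area_formula (@continuous_Gp R n m c) (@measurable_Gp R n m c)
  (fun z => proj1 (S z)) (fun z => proj2 (S z)) cJ mJ cg mg g0 p h0.
by move=> ->; apply: eq_integral => z _; congr (_ * `|_|)%:E; exact: (congr1 (fun k => k z) JE).
Qed.

End Square.

Section PlaneLebesgue.
Context {R : realType}.
Local Notation mu := (@lebesgue_measure R).

(* The library's sigma-finite instance for products is hidden by the one for probabilities. *)
Definition lebesgue2 := (mu \x mu)%E.

HB.instance Definition _ := Measure.on lebesgue2.

Let lebesgue2_sigma_finite : sigma_finite setT lebesgue2.
Proof.
exists (fun k => sq (- k%:R, - k%:R) (k%:R + k%:R)); last first.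
  move=> k; split; first exact: measurable_sq.
  by rewrite [X in (X < _)%E]mu2_sq ?ltry// addr_ge0.
apply/seteqP; split => // z _; exists (Num.truncn `|z|).+1 => //.
have /andP[_ zk] := truncn_itv (normr_ge0 z).
have := le_lt_trans (norm_fst_le z) zk; have := le_lt_trans (norm_snd_le z) zk.
rewrite !ltr_norml => /andP[h1 h2] /andP[h3 h4].
by rewrite /sq /= addrA addNr add0r; split; apply/andP; split; rewrite ?h2 ?h4 ?ltW.
Qed.

HB.instance Definition _ := Measure_isSigmaFinite.Build _ _ _ lebesgue2 lebesgue2_sigma_finite.

End PlaneLebesgue.

Section Intensity.
Context {d} {Omega : measurableType d} {R : realType} (P : probability Omega R) (n m : nat).
Local Notation I := (('I_n.+1 * bool) + ('I_m.+1 * bool))%type.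
Local Notation mu := (@lebesgue_measure R).
Local Notation mu2 := (mu \x mu)%E.
Variables (alpha beta : nat -> R) (X : I -> Omega -> R).
Hypotheses (m1 : (1 <= m)%N) (mn : (m <= n)%N)
  (a0 : forall j, (j <= n)%N -> 0 < alpha j) (b0 : forall j, (j <= m)%N -> 0 < beta j).
Hypothesis indX : mutually_independent P X.
Local Notation sd := (@sd R n m alpha beta).
Hypothesis lawX : forall i V, measurable V -> P (X i @^-1` V) = normal_prob 0 (sd i) V.
Local Notation Xv w := (fun i => X i w).
Local Notation s := (Num.sqrt (alpha 0%N / 2)).

(** The Gaussian computation yields the expectation with [|z|^2 |J|] in place of [|J|]; dividing by
    [|z|^2] excludes the origin. *)
Lemma expect_density (z : R * R) : z != 0 ->
  (\int[P]_w (normal_pdf 0 s (Gp (Xv w) z).1 * normal_pdf 0 s (Gp (Xv w) z).2 *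
     `|@Jp R n m (Xv w) z|)%:E = (pi^-1 * zero_density n m alpha beta z.1 z.2)%:E)%E.
Proof.
move=> z0.
have rho0 : 0 < z.1 ^+ 2 + z.2 ^+ 2.
  rewrite lt_neqAle addr_ge0 ?sqr_ge0// andbT eq_sym paddr_eq0 ?sqr_ge0// !sqrf_eq0.
  by apply: contraNN z0 => /andP[/eqP z1 /eqP z2]; apply/eqP/injective_projections.
have := expect_linear indX (sd_gt0 a0 b0) lawX (vec z) 0 (nice_dens_form s) (uniq_tail_idx n m).
rewrite (Ex_dens_zero m1 mn a0 b0 rho0) => E.
have -> : (pi^-1 * zero_density n m alpha beta z.1 z.2)%:E =
    ((z.1 ^+ 2 + z.2 ^+ 2)^-1%:E *
     ((z.1 ^+ 2 + z.2 ^+ 2) * (pi^-1 * zero_density n m alpha beta z.1 z.2))%:E)%E.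
  by rewrite -EFinM mulKf// gt_eqF.
rewrite -E -ge0_intZl; last 3 first.
- by rewrite invr_ge0 ltW.
- apply: (measurableT_comp (nice_dens_form s).1).
  exact: (measurableT_comp (measurable_comb 0 (vec z) (tail_idx n m)) (measurable_vec indX)).
- by move=> w; exact: (nice_dens_form s).2.
apply: eq_integral => w _; rewrite -EFinM add0r; congr _%:E.
rewrite /dens_form; have -> : absform (\sum_(i <- tail_idx n m) X i w *: vec z i) =
    (z.1 ^+ 2 + z.2 ^+ 2) * `|Jp (Xv w) z|.
  by rewrite /absform (Jp_form (Xv w) z) normrM gtr0_norm.
rewrite (comb_vec (Xv w) z) /fst /snd.
rewrite -/(Gp (Xv w) z).1 -/(Gp (Xv w) z).2.
have rn := lt0r_neq0 rho0; move: (_ ^+ 2 + _) rn => r rn.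
by move: `|_| => j; field.
Qed.

Let f (c : @cspace R I) (z : R * R) : \bar R :=
  (normal_pdf 0 s (Gp c z).1 * normal_pdf 0 s (Gp c z).2 * `|Jp c z|)%:E.

Let f0 c z : (0 <= f c z)%E. Proof. by rewrite lee_fin !mulr_ge0// normal_pdf_ge0. Qed.

Let mfX : measurable_fun setT (fun x : Omega * (R * R) => f (Xv x.1) x.2).
Proof.
have mf : measurable_fun setT (fun x : @cspace R I * (R * R) => f x.1 x.2).
  apply/measurable_EFinP; apply: measurable_funM; last first.
    exact: (measurableT_comp (@normr_measurable R setT) (@measurable_Jp_joint R n m)).
  have mG := @measurable_Gp_joint R n m.
  apply: measurable_funM.
    exact: (measurableT_comp (measurable_normal_pdf 0 s) (measurableT_comp measurable_fst mG)).
  exact: (measurableT_comp (measurable_normal_pdf 0 s) (measurableT_comp measurable_snd mG)).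
apply: (measurableT_comp mf (g := fun x : Omega * (R * R) => (Xv x.1 : @cspace R I, x.2))).
apply: measurable_fun_pair => //.
exact: (measurableT_comp (measurable_vec indX) measurable_fst).
Qed.

Local Notation dens z := (pi^-1 * zero_density n m alpha beta z.1 z.2).

Let measurable_origin : measurable [set (0 : R * R)].
Proof. exact: (measurable_finite (finite_set1 _)). Qed.

(** Off the origin the density is an integral depending measurably on a parameter, so the closed
    formula need not be analysed. *)
Lemma measurable_density : measurable_fun setT (fun z : R * R => (dens z)%:E).
Proof.
rewrite -(setUv [set (0 : R * R)]); apply/measurable_funU => //; first exact: measurableC.
split; first exact: measurable_fun_set1.
apply: (eq_measurable_fun (fun z => \int[P]_w f (Xv w) z)%E).
  by move=> z /set_mem /eqP z0; exact: expect_density.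
apply: measurable_funTS.
exact: (@measurable_int1 _ _ _ _ _ P (fun w z => f (Xv w) z)).
Qed.

(** Resampling both variables of [A_0] makes [area_density] applicable for almost no cost: the other
    coefficients stay fixed, Tonelli exchanges them with [z], and the origin is a null set. *)
Lemma expect_zeros_sq p h : 0 < h ->
  (\int[P]_w zeros_in (sq p h) (Xv w) =
   \int[mu2]_(z in sq p h) (pi^-1 * zero_density n m alpha beta z.1 z.2)%:E)%E.
Proof.
move=> h0; have s0 : 0 < s by rewrite sqrtr_gt0 divr_gt0// a0.
have law b V : measurable V -> P (X (ia n m 0 b) @^-1` V) = normal_prob 0 s V.
  by move=> mV; rewrite (lawX _ mV) sdA.
pose N := zeros_in (sq p h) : @cspace R I -> \bar R.
have mN : measurable_fun setT N := measurable_zeros_sq p (ltW h0).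
have N0 c : (0 <= N c)%E by exact: counting_ge0.
pose N1 (c : @cspace R I) : \bar R := (\int[normal_prob 0 s]_t N (upd c (ia n m 0 true) t))%E.
have mN1 : measurable_fun setT N1.
  apply: (@measurable_int2 _ _ _ _ _ (normal_prob 0 s) (fun (c : @cspace R I) (t : R) => N (upd c (ia n m 0 true) t))).
    exact: (measurableT_comp mN (measurable_upd (ia n m 0 true))).
  by move=> *; exact: N0.
rewrite (resample indX (law true) mN N0) (resample (F := N1) indX (law false) mN1); last first.
  by move=> c; exact: integral_ge0.
under eq_integral => w _ do rewrite (area_density (Xv w) p s0 h0).
pose k (w : Omega) (z : R * R) : \bar R := (f (Xv w) z * (\1_(sq p h) z)%:E)%E.
have mk : measurable_fun setT (fun x : Omega * (R * R) => k x.1 x.2).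
  apply: emeasurable_funM => //; apply/measurable_EFinP.
  by apply: (measurableT_comp _ measurable_snd); apply: measurable_indic; exact: measurable_sq.
have k0 w z : (0 <= k w z)%E by rewrite mule_ge0// lee_fin.
transitivity (\int[P]_w \int[mu2]_z k w z)%E.
  apply: eq_integral => w _; rewrite [LHS]integral_mkcond; apply: eq_integral => z _.
  by rewrite epatch_indic.
rewrite (@tonelli _ _ _ _ _ P lebesgue2 k mk k0) [RHS]integral_mkcond.
apply: ae_eq_integral => //.
- exact: (@measurable_int1 _ _ _ _ _ P k).
- by apply/(measurable_restrictT _ _).1; [exact: measurable_sq|
    apply: measurable_funTS; exact: measurable_density].
exists [set (0 : R * R)]; split => //.
  have -> : [set (0 : R * R)] = [set 0] `*` [set 0].
    by apply/seteqP; split => -[x y] /=; [case=> -> ->|case=> -> ->].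
  have := @product_measure1E _ _ _ _ R mu mu [set 0] [set 0] (measurable_set1 _) (measurable_set1 _).
  move=> /= E; apply: (etrans E); rewrite [X in (X * _)%E](_ : _ = 0%E) ?mul0e//.
  exact: lebesgue_measure_set1.
move=> z /=; apply: contra_notP => z0 _.
rewrite epatch_indic /k ge0_integralZr//; last first.
  exact: (measurableT_comp mfX (g := fun w => (w, z))).
congr (_ * _)%E; rewrite -expect_density//; exact/eqP.
Qed.

End Intensity.

(** * From squares to open sets *)

Section Exhaustion.
Context {R : realType} (T : set (R * R)).
Implicit Types p q z : R * R.

(** The union of the dyadic subsquares of generation at most [k] that lie in [T]. *)
Fixpoint inner (k : nat) p (h : R) : set (R * R) :=
  if `[< sq p h `<=` T >] then sq p h
  else if k is k'.+1 then \big[setU/set0]_(q <- children p h) inner k' q (h / 2) else set0.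

Lemma children_disjoint p h q q' z : q \in children p h -> q' \in children p h ->
  sq q (h / 2) z -> sq q' (h / 2) z -> q = q'.
Proof.
rewrite !inE => /or4P[] /eqP-> /or4P[] /eqP-> //;
  by move=> [/= /andP[? ?] /andP[? ?]] [/= /andP[? ?] /andP[? ?]]; exfalso; lra.
Qed.

Lemma measurable_inner k p h : measurable (inner k p h).
Proof.
elim: k p h => [|k IH] p h /=; case: ifP => _; try exact: measurable_sq; first exact: measurable0.
by apply: bigsetU_measurable => q _; exact: IH.
Qed.

Lemma inner_sub k p h : 0 < h -> inner k p h `<=` T `&` sq p h.
Proof.
elim: k p h => [|k IH] p h h0 /=; case: asboolP => // sT; try by move=> z zs; split => //; exact: sT.
rewrite -bigcup_seq => z [q qc zi]; have h2 : 0 < h / 2 by rewrite divr_gt0.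
by have [Tz zq] := IH q _ h2 _ zi; split => //; exact: (children_sub (ltW h0) qc).
Qed.

Lemma inner_leS k p h : inner k p h `<=` inner k.+1 p h.
Proof.
elim: k p h => [|k IH] p h.
  by rewrite /=; case: asboolP => [_|_] z //.
change (inner k.+1 p h `<=` if `[< sq p h `<=` T >] then sq p h
  else \big[setU/set0]_(q <- children p h) inner k.+1 q (h / 2)).
rewrite [inner k.+1 p h]/=; case: asboolP => [_|sT]; first exact: subset_refl.
by rewrite -!bigcup_seq => z [q qc zi]; exists q => //; exact: IH.
Qed.

Lemma inner_nondecreasing p h : nondecreasing_seq (fun k => inner k p h).
Proof. by apply/nondecreasing_seqP => k; rewrite subsetEset; exact: inner_leS. Qed.

Lemma inner_near p h z e k : 0 <= h -> h < e * 2 ^+ k -> (forall z', `|z - z'| < e -> T z') ->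
  sq p h z -> inner k p h z.
Proof.
move=> + + Te; elim: k p h => [|k IH] p h h0 hk zp /=; case: asboolP => //.
  by case; move=> z' zp'; apply: Te; rewrite expr0 mulr1 in hk; exact: le_lt_trans (sq_dist zp zp') hk.
move=> _; have [q qc zq] := sq_children zp; rewrite -bigcup_seq; exists q => //.
by apply: IH => //; [rewrite divr_ge0|rewrite ltr_pdivrMr// -mulrA -exprSr].
Qed.

Lemma bigcup_inner p h : open T -> 0 < h -> \bigcup_k inner k p h = T `&` sq p h.
Proof.
move=> oT h0; apply/seteqP; split => [z [k _]|z [Tz zp]]; first exact: inner_sub.
have [e e0 Te] := @near_norm_ball R T z (open_nbhs_nbhs (conj oT Tz)).
pose k := (Num.truncn (h / e)).+1.
exists k => //; apply: (@inner_near _ _ z e) => //; first exact: ltW.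
  rewrite mulrC -ltr_pdivrMr//; have /andP[_ lt] := truncn_itv (divr_ge0 (ltW h0) (ltW e0)).
  by rewrite (lt_le_trans lt)// -natrX ler_nat ltnW// ltn_expl.
by move=> z'; rewrite distrC => /Te.
Qed.

Lemma innerSF k p h : ~ sq p h `<=` T ->
  inner k.+1 p h = \bigcup_(q in [set` children p h]) inner k q (h / 2).
Proof. by move=> sT; rewrite bigcup_seq /=; case: asboolP. Qed.

Lemma measure_innerS (mu : {measure set (R * R) -> \bar R}) k p h : 0 < h -> ~ sq p h `<=` T ->
  mu (inner k.+1 p h) = (\sum_(q <- children p h) mu (inner k q (h / 2)))%E.
Proof.
move=> h0 sT; have h2 : 0 < h / 2 by rewrite divr_gt0.
have E : inner k.+1 p h = inner k.+1 p h `&` sq p h.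
  by apply/esym/setIidPl => z /(inner_sub h0)[].
rewrite E measure_children ?(ltW h0)//; last exact: measurable_inner.
apply: eq_big_seq => q qc; congr (mu _); rewrite (innerSF k sT); apply/seteqP; split => z.
  move=> [[q' qc' zi] zq]; have [_ zq'] := inner_sub h2 zi.
  by rewrite (children_disjoint qc qc' zq zq').
by move=> zi; have [_ zq] := inner_sub h2 zi; split => //; exists q.
Qed.

Definition big_sq (k : nat) : set (R * R) := sq (- k.+1%:R, - k.+1%:R) (k.+1%:R + k.+1%:R).

Lemma bigcup_big_sq : \bigcup_k (T `&` big_sq k) = T.
Proof.
apply/seteqP; split => [z [k _ []//]|z Tz].
exists (Num.truncn `|z|) => //; split => //.
have /andP[_ zk] := truncn_itv (normr_ge0 z).
have := le_lt_trans (norm_fst_le z) zk; have := le_lt_trans (norm_snd_le z) zk.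
rewrite !ltr_norml => /andP[h1 h2] /andP[h3 h4].
by rewrite /big_sq /sq /= addrA addNr add0r; split; apply/andP; split; rewrite ?h2 ?h4 ?ltW.
Qed.

Lemma big_sq_nondecreasing : nondecreasing_seq (fun k => T `&` big_sq k).
Proof.
apply/nondecreasing_seqP => k; rewrite subsetEset => z [Tz zk]; split => //; move: zk.
have: k.+1%:R <= k.+2%:R :> R by rewrite ler_nat.
rewrite /big_sq /sq /=; move: (k.+1%:R) (k.+2%:R) => x y xy [/andP[? ?] /andP[? ?]].
by split; apply/andP; split; lra.
Qed.

Lemma open_measurable_plane : open T -> measurable T.
Proof.
move=> oT; rewrite -bigcup_big_sq; apply: bigcup_measurable => k _.
rewrite /big_sq -bigcup_inner// ?addr_gt0//.
by apply: bigcup_measurable => j _; exact: measurable_inner.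
Qed.

End Exhaustion.

(** * Expectations of random measures on open sets *)

Section ExpectedMeasure.
Context {d} {Omega : measurableType d} {R : realType} (P : probability Omega R).
Variables (N : Omega -> {measure set (R * R) -> \bar R}) (nu : {measure set (R * R) -> \bar R}).

Let good A := measurable_fun setT (fun w => N w A) /\ (\int[P]_w N w A = nu A)%E.

Hypothesis good_sq : forall p h, 0 < h -> good (sq p h).

(** Continuity from below of [nu] and of each [N w], with monotone convergence for the expectation.
    No finiteness is used, so infinite values are allowed. *)
Let good_bigcup (F : (set (R * R))^nat) : nondecreasing_seq F -> (forall k, measurable (F k)) ->
  (forall k, good (F k)) -> good (\bigcup_k F k).
Proof.
move=> ndF mF gF; have mU : measurable (\bigcup_k F k) by exact: bigcup_measurable.
have cN w : N w (F k) @[k --> \oo] --> N w (\bigcup_k F k) by exact: nondecreasing_cvg_mu.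
have m : measurable_fun setT (fun w => N w (\bigcup_k F k)).
  by apply: (emeasurable_fun_cvg (fun k w => N w (F k))) => [k|w _]; [exact: (gF k).1|exact: cN].
split => //.
have NE : (fun w => N w (\bigcup_k F k)) = (fun w => limn (fun k => N w (F k))).
  by apply/funext => w; apply/esym/cvg_lim => //; exact: cN.
have c1 : (\int[P]_w N w (F k))%E @[k --> \oo] --> (\int[P]_w N w (\bigcup_k F k))%E.
  rewrite NE; apply: (cvg_monotone_convergence measurableT).
  - by move=> k; exact: (gF k).1.
  - by move=> k w _; exact: measure_ge0.
  - move=> w _ k l kl; apply: le_measure; [exact/mem_set|exact/mem_set|].
    by rewrite -subsetEset; exact: ndF.
have c2 : nu (F k) @[k --> \oo] --> nu (\bigcup_k F k) by exact: nondecreasing_cvg_mu.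
have E : (fun k => \int[P]_w N w (F k))%E = (fun k => nu (F k)).
  by apply/funext => k; exact: (gF k).2.
by rewrite E in c1; exact: (cvg_unique _ c1 c2).
Qed.

(** Two monotone limits: inner unions inside one large square, then growing large squares. *)
Lemma expected_measure_open (T : set (R * R)) : open T -> good T.
Proof.
move=> oT.
have gin k p h : 0 < h -> good (inner T k p h).
  elim: k p h => [|k IH] p h h0.
    rewrite /=; case: asboolP => sT; first exact: good_sq.
    split; first by under eq_fun do rewrite measure0; exact: measurable_cst.
    by under eq_integral do rewrite measure0; rewrite integral0 measure0.
  have h2 : 0 < h / 2 by rewrite divr_gt0.
  have [sT|sT] := pselect (sq p h `<=` T).
    by rewrite /= asboolT//; exact: good_sq.
  have E (mu : {measure set (R * R) -> \bar R}) := measure_innerS mu k h0 sT.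
  have m q : measurable_fun setT (fun w => N w (inner T k q (h / 2))) by exact: (IH q _ h2).1.
  split; first by under eq_fun do rewrite E; exact: emeasurable_sum.
  under eq_integral do rewrite E.
  rewrite ge0_integral_sum//; rewrite E; apply: eq_bigr => q _; exact: (IH q _ h2).2.
rewrite -(bigcup_big_sq T); apply: good_bigcup => [|k|k].
- exact: big_sq_nondecreasing.
- by apply: measurableI; [exact: open_measurable_plane|exact: measurable_sq].
rewrite /big_sq -bigcup_inner// ?addr_gt0//; apply: good_bigcup => [|j|j].
- exact: inner_nondecreasing.
- exact: measurable_inner.
- by apply: gin; rewrite addr_gt0.
Qed.

End ExpectedMeasure.

Section ZeroCount.
Context {R : realType}.

Lemma npoints_image (T U : choiceType) (f : T -> U) (g : U -> T) (A : set T) : cancel f g ->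
  @npoints U R (f @` A) = @counting T R A.
Proof.
move=> fK; rewrite /npoints /counting.
have [fA|nA] := pselect (finite_set A).
  rewrite !asboolT//; last exact: finite_image.
  by rewrite fset_set_image// card_imfset//; exact: can_inj fK.
rewrite !asboolF// => /(finite_image g); rewrite image_comp.
by rewrite (eq_image_id (fun x _ => fK x)).
Qed.

Lemma zero_countE (n m : nat) (A B : nat -> R[i]) c (T : set (R * R)) :
  (forall j, (j <= n)%N -> A j = (c (ia n m j false) +i* c (ia n m j true))%C) ->
  (forall j, (j <= m)%N -> B j = (c (ib n m j false) +i* c (ib n m j true))%C) ->
  zero_count n m A B T = zeros_in T c.
Proof.
move=> hA hB; pose f (p : R * R) := (p.1 +i* p.2)%C.
pose g (z : R[i]) := (complex.Re z, complex.Im z).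
have fK : cancel f g by case.
rewrite /zero_count /zeros_in -(npoints_image _ fK); congr npoints.
apply/seteqP; split => [[x y] /= [Txy]|_ [[x y] [Hz Txy] <-]].
  rewrite (@harm_polyE _ _ _ c _ _ (x, y) hA hB) => -[h1 h2].
  by exists (x, y) => //; split => //; apply: injective_projections.
by split => //; rewrite (@harm_polyE _ _ _ c _ _ (x, y) hA hB) Hz.
Qed.

End ZeroCount.

Section ExpectedZeros.
Context {d} {Omega : measurableType d} {R : realType} (P : probability Omega R) (n m : nat).
Local Notation I := (('I_n.+1 * bool) + ('I_m.+1 * bool))%type.
Local Notation mu := (@lebesgue_measure R).
Local Notation mu2 := (mu \x mu)%E.
Variables (alpha beta : nat -> R) (X : I -> Omega -> R).
Hypotheses (m1 : (1 <= m)%N) (mn : (m <= n)%N)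
  (a0 : forall j, (j <= n)%N -> 0 < alpha j) (b0 : forall j, (j <= m)%N -> 0 < beta j).
Hypothesis indX : mutually_independent P X.
Hypothesis lawX : forall i V, measurable V -> P (X i @^-1` V) = normal_prob 0 (sd alpha beta i) V.
Local Notation Xv w := (fun i => X i w).
Local Notation zd z := (zero_density n m alpha beta z.1 z.2).

Let mdens := measurable_density m1 mn a0 b0 indX lawX.

(** Off the origin it is [pi] times an expectation of a non-negative quantity; at the origin the
    convention that the inverse of 0 is 0 makes it vanish. *)
Lemma zero_density_ge0 (z : R * R) : 0 <= zd z.
Proof.
have [->|z0] := eqVneq z 0.
  by rewrite /zero_density /= expr0n/= addr0 invr0 mul0r.
have : (0 <= (pi^-1 * zd z)%:E)%E.
  rewrite -(expect_density m1 mn a0 b0 indX lawX z0); apply: integral_ge0 => w _.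
  by rewrite lee_fin !mulr_ge0// normal_pdf_ge0.
by rewrite lee_fin pmulr_rge0// invr_gt0 pi_gt0.
Qed.

Let dens0 (z : R * R) : (0 <= (pi^-1 * zd z)%:E)%E.
Proof. by rewrite lee_fin mulr_ge0 ?zero_density_ge0// invr_ge0 pi_ge0. Qed.

Definition intensity (A : set (R * R)) : \bar R := (\int[mu2]_(z in A) (pi^-1 * zd z)%:E)%E.

Let intensity0 : intensity set0 = 0%E. Proof. exact: integral_set0. Qed.

Let intensity_ge0 A : (0 <= intensity A)%E. Proof. by apply: integral_ge0. Qed.

Let intensity_additive : semi_sigma_additive intensity.
Proof.
move=> F mF tF mUF; rewrite /intensity ge0_integral_bigcup//=; last exact: measurable_funTS.
by apply: is_cvg_ereal_nneg_natsum_cond => // k _ _; exact: integral_ge0.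
Qed.

Lemma expected_zeros (T : set (R * R)) : open T ->
  (\int[P]_w zeros_in T (Xv w) = pi^-1%:E * \int[mu2]_(z in T) (zd z)%:E)%E.
Proof.
move=> oT.
pose nu : {measure set (R * R) -> \bar R} := HB.pack intensity
  (isMeasure.Build _ _ _ intensity intensity0 intensity_ge0 intensity_additive).
have mZ w : measurable [set z | Hp (Xv w) z = 0].
  exact: (@measurable_zeros R _ Omega (fun w => Hp (Xv w)) (fun w => measurable_Hp (Xv w)) w).
(* The counting measure of the zero set, random through [w]. *)
pose N w : {measure set (R * R) -> \bar R} := mrestr (@counting (R * R)%type R) (mZ w).
have NE w A : N w A = zeros_in A (Xv w) by rewrite /N /= /mrestr setIC.
have [p h h0|_ E] := @expected_measure_open _ _ _ P N nu _ _ oT.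
  split.
    under eq_fun do rewrite NE.
    exact: (measurableT_comp (measurable_zeros_sq p (ltW h0)) (measurable_vec indX)).
  under eq_integral do rewrite NE.
  exact: (expect_zeros_sq m1 mn a0 b0 indX lawX).
transitivity (\int[P]_w N w T)%E; first by apply: eq_integral => w _; rewrite NE.
rewrite {}E /nu /= /intensity; under eq_integral do rewrite EFinM.
have mzd : measurable_fun setT (fun z : R * R => (zd z)%:E).
  rewrite (_ : (fun z => _) = (fun z => pi%:E * (pi^-1 * zd z)%:E)%E); last first.
    by apply/funext => z; rewrite -EFinM mulVKf// gt_eqF// pi_gt0.
  by apply: emeasurable_funM.
rewrite ge0_integralZl//.
- exact: open_measurable_plane.
- exact: measurable_funTS.
- by move=> z _; rewrite lee_fin zero_density_ge0.
- by rewrite lee_fin invr_ge0 pi_ge0.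
Qed.

End ExpectedZeros.

Theorem theorem2p1 (R : realType) (d : measure_display) (Omega : measurableType d)
  (P : probability Omega R) (n m : nat) (alpha beta : nat -> R)
  (a a' b b' : nat -> Omega -> R) :
  (1 <= m)%N -> (m <= n)%N ->
  (forall j, (j <= n)%N -> 0 < alpha j) ->
  (forall j, (j <= m)%N -> 0 < beta j) ->
  (* A_j = a j + i a' j, B_j = b j + i b' j: circularly-symmetric complex
     Gaussians with E|A_j|^2 = alpha j, E|B_j|^2 = beta j *)
  (forall j, (j <= n)%N -> centered_normal_rv P (a j) (alpha j / 2)
                         /\ centered_normal_rv P (a' j) (alpha j / 2)) ->
  (forall j, (j <= m)%N -> centered_normal_rv P (b j) (beta j / 2)
                         /\ centered_normal_rv P (b' j) (beta j / 2)) ->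
  (* mutual independence of A_0..A_n, B_0..B_m (and of their real/imaginary parts) *)
  mutually_independent P
    (fun (i : (('I_n.+1 * bool) + ('I_m.+1 * bool))%type) =>
       match i with
       | inl (j, false) => a j | inl (j, true) => a' j
       | inr (j, false) => b j | inr (j, true) => b' j
       end) ->
  forall T : set (R * R), open T ->
    (\int[P]_w zero_count n m (fun j => (a j w +i* a' j w)%C)
                              (fun j => (b j w +i* b' j w)%C) T)%E
    = ((pi^-1)%:E *
       \int[(@lebesgue_measure R \x @lebesgue_measure R)%E]_(p in T)
          (zero_density n m alpha beta p.1 p.2)%:E)%E.
Proof.
move=> m1 mn a0 b0 lawa lawb indX T oT.
set X := (fun i : ('I_n.+1 * bool) + ('I_m.+1 * bool) => _) in indX.
have lawX i V : measurable V -> P (X i @^-1` V) = normal_prob 0 (sd alpha beta i) V.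
  case: i => [[[j jn] e]|[[j jm] e]] mV.
    by have [h1 h2] := lawa j jn; case: e; [exact: (h2 V mV)|exact: (h1 V mV)].
  by have [h1 h2] := lawb j jm; case: e; [exact: (h2 V mV)|exact: (h1 V mV)].
rewrite -(expected_zeros m1 mn a0 b0 indX lawX oT); apply: eq_integral => w _.
by apply: zero_countE => j hj; rewrite /X /ia /ib /= inordK.
Qed.
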